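(* Let $n\ge 2$, let $\omega\subset\mathbb{R}^{n-1}$ be an open, bounded and connected Lipschitz domain, let $f\in L^2(\omega)$ with $f\neq 0$, and let $\ell>0$. Let $u_\ell$, $u_\infty$, $\lambda_\infty$, $\psi_\ell$ and $\lambda_1$ be as defined in the context. Then for every $\delta_\ell$ with $0\le\delta_\ell<\ell$, \[ \left\Vert \nabla\left(u_\ell-\psi_\ell(\lambda_\infty,\cdot)\otimes u_\infty\right)\right\Vert_{L^2(\Omega_{\ell-\delta_\ell})}^2\le C^{(1)}_{\omega,\delta_\ell}\left\Vert u_\infty\right\Vert_{L^2(\omega)}^2+C^{(2)}_{\omega,\delta_\ell}\left\Vert\nabla' u_\infty\right\Vert_{L^2(\omega)}^2, \] where \[ C^{(1)}_{\omega,\delta_\ell}:=4e^{-2\lambda_1\delta_\ell},\qquad C^{(2)}_{\omega,\delta_\ell}:=4\left(\frac{1}{\lambda_1}e^{-2\lambda_1\delta_\ell}+6(\ell-\delta_\ell)e^{-2\lambda_1\ell}\right). \] Moreover, the right-hand side of this estimate goes to $0$ with an exponential rate of convergence if $\delta_\ell$ is bounded from below when $\ell\to\infty$.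
   Context: For $L>0$ put $I_L:=(-L,L)$ and $\Omega_L:=I_L\times\omega\subset\mathbb{R}^n$. Points of $\Omega_L$ are written $x=(x_1,x')$ with $x_1\in I_L$ and $x'\in\omega$. $\nabla$ and $\Delta$ denote the gradient and Laplacian in all $n$ variables; $\nabla'$ and $\Delta'$ denote the gradient and Laplacian in the variable $x'$ only. For functions $g$ on $I_L$ and $h$ on $\omega$, $(g\otimes h)(x_1,x'):=g(x_1)h(x')$. $u_\ell\in H_0^1(\Omega_\ell)$ is the weak solution of $-\Delta u_\ell=1\otimes f$ in $\Omega_\ell$, $u_\ell=0$ on $\partial\Omega_\ell$, i.e. $\int_{\Omega_\ell}\nabla u_\ell\cdot\nabla v\,dx=\int_{\Omega_\ell}f(x')v(x)\,dx$ for all $v\in H_0^1(\Omega_\ell)$. $u_\infty\in H_0^1(\omega)$ is the weak solution of $-\Delta' u_\infty=f$ in $\omega$, $u_\infty=0$ on $\partial\omega$, i.e. $\int_\omega\nabla' u_\infty\cdot\nabla' v\,dx'=\int_\omega f v\,dx'$ for all $v\in H_0^1(\omega)$. $\lambda_\infty:=\Vert\nabla' u_\infty\Vert_{L^2(\omega)}/\Vert u_\infty\Vert_{L^2(\omega)}$. For $a>0$ and $x_1\in I_\ell$, $\psi_\ell(a,x_1):=1-\dfrac{\cosh(a x_1)}{\cosh(a\ell)}$. $\lambda_1:=\inf_{v\in H_0^1(\omega)\setminus\{0\}}\dfrac{\Vert\nabla' v\Vert_{L^2(\omega)}}{\Vert v\Vert_{L^2(\omega)}}$.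
   Formalization: The ''Moreover'' sentence fails for constant δ_ℓ (C^(1) is then independent of ℓ). Proved instead: for any lower bound β(ℓ) ≤ δ_ℓ for large ℓ, the right-hand side is at most K exp(-2λ_1 β(ℓ)), and it tends to 0 if β(ℓ) → ∞. *)

(* Defs.v *)
From HB Require Import structures.
From mathcomp Require Import all_boot all_order all_algebra.
From mathcomp Require Import all_classical all_reals all_analysis.

Set Implicit Arguments.
Unset Strict Implicit.
Unset Printing Implicit Defensive.
Import Order.TTheory GRing.Theory Num.Theory.
Import numFieldNormedType.Exports.
Local Open Scope classical_set_scope.
Local Open Scope ring_scope.

(* 'rV[R]_n carries the product (= Borel) sigma-algebra: the one generated by
   the coordinate maps. *)
Section rV_measurable.
Context {R : realType} (n : nat).

Let coords : 'I_n -> 'rV[R]_n -> R := fun i x => x ord0 i.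

Let rV_set0 : g_sigma_preimage coords set0.
Proof. exact: sigma_algebra0. Qed.

Let rV_setC A : g_sigma_preimage coords A -> g_sigma_preimage coords (~` A).
Proof. exact: sigma_algebraC. Qed.

Let rV_bigcup (F : (set 'rV[R]_n)^nat) : (forall i, g_sigma_preimage coords (F i)) ->
  g_sigma_preimage coords (\bigcup_i (F i)).
Proof. exact: sigma_algebra_bigcup. Qed.

HB.instance Definition _ := @isMeasurable.Build
  (measure_tuple_display default_measure_display)
  'rV[R]_n (g_sigma_preimage coords) rV_set0 rV_setC rV_bigcup.

Lemma measurable_coord (i : 'I_n) :
  measurable_fun [set: 'rV[R]_n] (fun x : 'rV[R]_n => x ord0 i).
Proof.
move=> _ Y mY; rewrite setTI; apply: sub_sigma_algebra => /=.
rewrite -bigcup_seq/=; exists i => /=; first by rewrite mem_index_enum.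
by exists Y => //; rewrite setTI.
Qed.

End rV_measurable.


Lemma measurable_fun_rVP {R : realType} d (T : measurableType d) n
    (f : T -> 'rV[R]_n) :
  (forall i, measurable_fun setT (fun t => f t ord0 i)) ->
  measurable_fun setT f.
Proof.
move=> mf; apply: (@measurability _ _ _ _ setT f
  (\big[setU/set0]_(i < n) preimage_set_system setT
     (fun x : 'rV[R]_n => x ord0 i) measurable)) => //.
move=> _ [B + <-]; rewrite -bigcup_seq => -[i /= _ [C mC <-]].
rewrite setTI -[X in measurable X]setTI.
have -> : f @^-1` (setT `&` (fun x : 'rV[R]_n => x ord0 i) @^-1` C) =
    (fun t => f t ord0 i) @^-1` C by rewrite setTI.
exact: mf.
Qed.

Lemma sigma_finite_prod {R : realType} d1 d2 (T1 : measurableType d1)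
    (T2 : measurableType d2) (m1 : {sigma_finite_measure set T1 -> \bar R})
    (m2 : {sigma_finite_measure set T2 -> \bar R}) :
  sigma_finite setT (m1 \x m2)%E.
Proof.
have /sigma_finiteP[F [TF ndF Foo]] := sigma_finiteT m1.
have /sigma_finiteP[G [TG ndG Goo]] := sigma_finiteT m2.
exists (fun n => F n `*` G n).
  rewrite -setXTT TF TG predeqE => -[x y]; split.
    move=> [/= [n _ Fnx] [k _ Gky]]; exists (maxn n k) => //; split.
    - by move: x Fnx; exact/subsetPset/ndF/leq_maxl.
    - by move: y Gky; exact/subsetPset/ndG/leq_maxr.
  by move=> [n _ []/= ? ?]; split; exists n.
move=> k; have [? ?] := Foo k; have [? ?] := Goo k.
split; first exact: measurableX.
by rewrite product_measure1E// lte_mul_pinfty// ge0_fin_numE.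
Qed.

Section lebesgue_rV.
Context {R : realType}.

Definition rV_cons n (p : measurableTypeR R * 'rV[R]_n) : 'rV[R]_n.+1 :=
  \row_i oapp (p.2 ord0) p.1 (unlift ord0 i).

Definition rV_tail n (x : 'rV[R]_n.+1) : 'rV[R]_n := col' ord0 x.

Lemma rV_cons0 n (p : measurableTypeR R * 'rV[R]_n) :
  rV_cons p ord0 ord0 = p.1.
Proof. by rewrite mxE unlift_none. Qed.

Lemma rV_consS n (p : measurableTypeR R * 'rV[R]_n) (i : 'I_n) :
  rV_cons p ord0 (lift ord0 i) = p.2 ord0 i.
Proof. by rewrite mxE liftK. Qed.

Lemma rV_cons_tail n (x : 'rV[R]_n.+1) :
  rV_cons (x ord0 ord0 : measurableTypeR R, rV_tail x) = x.
Proof.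
apply/rowP => i; have [j ->|->] := unliftP ord0 i.
  by rewrite rV_consS mxE.
by rewrite rV_cons0.
Qed.

Lemma measurable_rV_cons n : measurable_fun setT (@rV_cons n).
Proof.
apply: measurable_fun_rVP => i; have [j ->|->] := unliftP ord0 i.
  under eq_fun do rewrite rV_consS.
  exact: (measurableT_comp (measurable_coord j)).
under eq_fun do rewrite rV_cons0.
exact: measurable_fst.
Qed.

Lemma measurable_rV_tail n : measurable_fun setT (@rV_tail n).
Proof.
apply: measurable_fun_rVP => i.
under eq_fun do rewrite mxE.
exact: measurable_coord.
Qed.

Section step.
Variables (n : nat) (mu : {sigma_finite_measure set 'rV[R]_n -> \bar R}).

Definition lebesgue_rV_step : set 'rV[R]_n.+1 -> \bar R :=
  pushforward (lebesgue_measure \x mu)%E (@rV_cons n).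

Let step0 : lebesgue_rV_step set0 = 0%E.
Proof. by rewrite /lebesgue_rV_step /pushforward preimage_set0 measure0. Qed.

Let step_ge0 A : (0 <= lebesgue_rV_step A)%E.
Proof. by rewrite /lebesgue_rV_step /pushforward measure_ge0. Qed.

Let step_sigma_additive : semi_sigma_additive lebesgue_rV_step.
Proof.
have mc := @measurable_rV_cons n.
move=> F mF tF mUF; rewrite /lebesgue_rV_step /pushforward preimage_bigcup.
apply: measure_semi_sigma_additive.
- by move=> k; rewrite -[X in measurable X]setTI; exact: mc.
- apply/trivIsetP => /= i j _ _ ij; rewrite -preimage_setI.
  by move/trivIsetP : tF => /(_ _ _ _ _ ij) ->//; rewrite preimage_set0.
- by rewrite -preimage_bigcup -[X in measurable X]setTI; exact: mc.
Qed.

HB.instance Definition _ := isMeasure.Build _ _ _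
  lebesgue_rV_step step0 step_ge0 step_sigma_additive.

Let step_sigma_finite : sigma_finite setT lebesgue_rV_step.
Proof.
have [F FT Foo] := sigma_finite_prod (@lebesgue_measure R) mu.
pose g (x : 'rV[R]_n.+1) : measurableTypeR R * 'rV[R]_n :=
  (x ord0 ord0, rV_tail x).
have mg : measurable_fun setT g.
  apply: measurable_fun_pair; first exact: measurable_coord.
  exact: measurable_rV_tail.
have gK p : g (rV_cons p) = p.
  case: p => a y; rewrite /g rV_cons0; congr pair.
  by apply/rowP => i; rewrite mxE rV_consS.
exists (fun k => g @^-1` F k).
  by rewrite -preimage_bigcup -FT preimage_setT.
move=> k; have [mF Fk] := Foo k; split.
  by rewrite -[X in measurable X]setTI; exact: mg.
rewrite /lebesgue_rV_step /pushforward -comp_preimage.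
by rewrite (_ : g \o @rV_cons n = id) //; apply/funext => p /=.
Qed.

HB.instance Definition _ := Measure_isSigmaFinite.Build _ _ _
  lebesgue_rV_step step_sigma_finite.

End step.

(* Lebesgue measure on R^n, as an iterated product of one-dimensional Lebesgue
   measures transported along R * R^n ~ R^n.+1; see [lebesgue_rV_prod]. *)
Fixpoint lebesgue_rV n : {sigma_finite_measure set 'rV[R]_n -> \bar R} :=
  if n is k.+1 then lebesgue_rV_step (lebesgue_rV k) else \d_(0 : 'rV[R]_0).

End lebesgue_rV.

Lemma lebesgue_rV_prod {R : realType} n (A : 'I_n -> set (measurableTypeR R)) :
  (forall i, measurable (A i)) ->
  lebesgue_rV n [set x : 'rV[R]_n | forall i, A i (x ord0 i)] =
  (\prod_(i < n) lebesgue_measure (A i))%E.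
Proof.
elim: n A => [|n IH] A mA.
  rewrite big_ord0 /= diracE; suff -> : (0 : 'rV[R]_0) \in
    [set x : 'rV[R]_0 | forall i, A i (x ord0 i)] by [].
  by rewrite inE /= => -[].
rewrite big_ord_recl /= /lebesgue_rV_step /pushforward.
have -> : @rV_cons R n @^-1` [set x | forall i, A i (x ord0 i)] =
    A ord0 `*` [set y : 'rV[R]_n | forall i, A (lift ord0 i) (y ord0 i)].
  apply/seteqP; split => -[a y] /=.
    move=> H; split; first by have := H ord0; rewrite rV_cons0.
    by move=> i; have := H (lift ord0 i); rewrite rV_consS.
  move=> [Aa Ay] i; have [j ->|->] := unliftP ord0 i.
    by rewrite rV_consS; exact: Ay.
  by rewrite rV_cons0.
rewrite product_measure1E//; first by congr (_ * _)%E; exact: IH.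
have -> : [set y : 'rV[R]_n | forall i, A (lift ord0 i) (y ord0 i)] =
    \bigcap_(i in [set: 'I_n])
      ((fun y : 'rV[R]_n => y ord0 i) @^-1` A (lift ord0 i)).
  by apply/seteqP; split=> [y H i _|y H i]; exact: H.
apply: fin_bigcap_measurable => [|i _]; first exact: finite_finset.
rewrite -[X in measurable X]setTI.
exact: (measurable_coord i measurableT (mA (lift ord0 i))).
Qed.

Section sobolev.
Context {R : realType}.

Definition L2 n (D : set 'rV[R]_n) (f : 'rV[R]_n -> R) : Prop :=
  measurable_fun D f /\
  (lebesgue_rV n).-integrable D (fun x => ((f x) ^+ 2)%:E).

Definition L2norm n (D : set 'rV[R]_n) (f : 'rV[R]_n -> R) : R :=
  Num.sqrt (\int[lebesgue_rV n]_(x in D) (f x) ^+ 2).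

Definition ae_zero n (D : set 'rV[R]_n) (f : 'rV[R]_n -> R) : Prop :=
  {ae lebesgue_rV n, forall x, D x -> f x = 0}.

Definition partial n (i : 'I_n) (f : 'rV[R]_n -> R) : 'rV[R]_n -> R :=
  fun x => 'D_(delta_mx ord0 i) f x.

Definition smooth n (f : 'rV[R]_n -> R) : Prop :=
  forall (s : seq 'I_n) (x : 'rV[R]_n), differentiable (foldr (@partial n) f s) x.

Definition test_function n (D : set 'rV[R]_n) (phi : 'rV[R]_n -> R) : Prop :=
  [/\ smooth phi,
      compact (closure [set x | phi x != 0]) &
      closure [set x | phi x != 0] `<=` D].

Definition weak_partial n (D : set 'rV[R]_n) (i : 'I_n)
    (u g : 'rV[R]_n -> R) : Prop :=
  forall phi, test_function D phi ->
    \int[lebesgue_rV n]_(x in D) (u x * partial i phi x) =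
    - \int[lebesgue_rV n]_(x in D) (g x * phi x).

Definition sobolevH1 n (D : set 'rV[R]_n) (u : 'rV[R]_n -> R) : Prop :=
  L2 D u /\ forall i, exists g, L2 D g /\ weak_partial D i u g.

(* For [u] in H^1(D) this is a representative of the weak gradient, unique up
   to a null subset of [D]. Outside H^1(D) its value is meaningless. *)
Definition wgrad n (D : set 'rV[R]_n) (u : 'rV[R]_n -> R) (x : 'rV[R]_n) :
    'rV[R]_n :=
  \row_i xget (fun=> 0) [set g | L2 D g /\ weak_partial D i u g] x.

Definition dotv n (v w : 'rV[R]_n) : R := \sum_(i < n) v ord0 i * w ord0 i.

Definition L2norm_field n (D : set 'rV[R]_n) (G : 'rV[R]_n -> 'rV[R]_n) : R :=
  Num.sqrt (\int[lebesgue_rV n]_(x in D) dotv (G x) (G x)).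

(* The closure of the test functions in H^1(D). *)
Definition sobolevH10 n (D : set 'rV[R]_n) (u : 'rV[R]_n -> R) : Prop :=
  sobolevH1 D u /\
  exists phi : nat -> 'rV[R]_n -> R,
    [/\ forall k, test_function D (phi k),
        L2norm D (fun x => phi k x - u x) @[k --> \oo] --> (0 : R) &
        L2norm_field D (fun x => \row_i partial i (phi k) x - wgrad D u x)
          @[k --> \oo] --> (0 : R)].

(* - Delta u = F in D, u = 0 on the boundary of D *)
Definition weak_solution n (D : set 'rV[R]_n) (F u : 'rV[R]_n -> R) : Prop :=
  sobolevH10 D u /\
  forall v, sobolevH10 D v ->
    \int[lebesgue_rV n]_(x in D) dotv (wgrad D u x) (wgrad D v x) =
    \int[lebesgue_rV n]_(x in D) (F x * v x).

(* Near each boundary point, in suitable orthonormal coordinates [x *m Q], the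
   set [D] is the strict epigraph of a Lipschitz function of the last [k]
   coordinates (so the boundary is locally the graph). *)
Definition lipschitz_boundary k (D : set 'rV[R]_k.+1) : Prop :=
  forall p, (closure D `\` D°) p ->
    exists (Q : 'M[R]_k.+1) (gamma : 'rV[R]_k -> R) (r : R),
      [/\ Q *m Q^T = 1%:M, lipschitz gamma, 0 < r &
          forall x, ball p r x ->
            D x <-> gamma (rV_tail (x *m Q)) < (x *m Q) ord0 ord0].

(* The first coordinate of ['rV_k.+1] is x_1, the remaining ones form x'. *)
Definition cylinder k (L : R) (omega : set 'rV[R]_k) : set 'rV[R]_k.+1 :=
  [set x : 'rV[R]_k.+1 | - L < x ord0 ord0 < L /\ omega (rV_tail x)].

Definition tens k (g : R -> R) (h : 'rV[R]_k -> R) : 'rV[R]_k.+1 -> R :=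
  fun x => g (x ord0 ord0) * h (rV_tail x).

Definition rayleigh n (D : set 'rV[R]_n) (v : 'rV[R]_n -> R) : R :=
  L2norm_field D (wgrad D v) / L2norm D v.

Definition lambda1 n (D : set 'rV[R]_n) : R :=
  inf [set rayleigh D v | v in [set v | sobolevH10 D v /\ ~ ae_zero D v]].

Definition coshR (t : R) : R := (expR t + expR (- t)) / 2.

Definition psi (l a x1 : R) : R := 1 - coshR (a * x1) / coshR (a * l).

Definition constC1 n (omega : set 'rV[R]_n) (delta : R) : R :=
  4 * expR (- (2 * lambda1 omega * delta)).

Definition constC2 n (omega : set 'rV[R]_n) (l delta : R) : R :=
  4 * ((lambda1 omega)^-1 * expR (- (2 * lambda1 omega * delta))
       + 6 * (l - delta) * expR (- (2 * lambda1 omega * l))).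

Definition error_bound n (omega : set 'rV[R]_n) (u : 'rV[R]_n -> R) (l delta : R) : R :=
  constC1 omega delta * L2norm omega u ^+ 2
  + constC2 omega l delta * L2norm_field omega (wgrad omega u) ^+ 2.

End sobolev.

(* Main.v *)
(* Write w = u_l - psi_l (x) u_oo, a = lambda_oo and g_b(t) = cosh (b t) / cosh (b l), so
   that g_b'' = b^2 g_b and psi_l = 1 - g_a.  Formally, expand u_oo in eigenfunctions v_k of
   the Dirichlet Laplacian of omega, with eigenvalues m_k^2: then w is the sum of the
   (g_a - g_{m_k}) (x) v_k.  Completeness of the eigenfunctions is avoided by a Galerkin
   argument.  Approximate w in H^1 by a finite sum of p_i (x) h_i (a test function, then
   Bernstein polynomials in x_1), diagonalise the Dirichlet form with respect to the L^2
   product on the span of u_oo and the h_i, and let w_V be the sum above for the resulting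
   v_k.  Then w - w_V is orthogonal, for the Dirichlet form, to w_V and to every p_i (x) h_i,
   so its energy is at most that of the approximation error.

   As g_a and g_m, and likewise g_a' and g_m', have the same sign, the energy of w_V on the
   smaller cylinder (L = l - delta) is at most the sum over k of |v_k|^2 times the integral
   over (-L, L) of g_a'^2 + m_k^2 g_a^2 + g_m'^2 + m_k^2 g_m^2 (m = m_k).  Now g_b'^2 +
   b^2 g_b^2 is the derivative of g_b g_b', so its integral is at most 2 b e^(-2 b delta),
   and a >= lambda_1, m_k >= lambda_1 since they are Rayleigh quotients. *)
Require Import Defs.
From HB Require Import structures.
From mathcomp Require Import all_boot all_order all_algebra.
From mathcomp Require complex.
From mathcomp Require Import all_classical all_reals all_analysis.
From mathcomp Require Import measurable_realfun ring lra.
Set Implicit Arguments.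
Unset Strict Implicit.
Unset Printing Implicit Defensive.
Import Order.TTheory GRing.Theory Num.Theory.
Import numFieldNormedType.Exports.
Local Open Scope classical_set_scope.
Local Open Scope ring_scope.

(** * Square-integrable functions *)

(** Let b be the L^2 product and a the Dirichlet form on omega. The orthogonality of w - w_V to p
    (x) h, for p vanishing at both ends, has two sources: g_m'' = m^2 g_m holds weakly against such
    p, and a(v_k, h) = m_k^2 b(v_k, h) because h belongs to the span on which both forms are
    diagonal. It is available for these tensor products only, whence the density theorem. Bernstein
    polynomials serve there because their derivative is again a Bernstein polynomial, of difference
    quotients, so that derivatives are approximated as well. The v_k change with the approximation,
    so the bound on w_V may see them only through the sums of |v_k|^2 and of m_k^2 |v_k|^2, which
    are b(u_oo, u_oo) and a(u_oo, u_oo). The Rayleigh quotient lambda_oo enters through a(u_oo,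
    u_oo) = lambda_oo^2 b(u_oo, u_oo): with it the g_a part and the g_m part obey the same bound (2
    / lambda_1) e^(-2 lambda_1 delta) a(u_oo, u_oo), and the two add up to 4 / lambda_1. Functions
    are not identified almost everywhere, so b is only semidefinite; vectors of zero norm have to be
    carried along and shown to be invisible to both forms. *)

Section square_integrable.
Context d (T : measurableType d) (R : realType).
Variables (mu : {measure set T -> \bar R}) (D : set T).
Hypothesis mD : measurable D.
Implicit Types f g h : T -> R.

(** [L2] unfolds to the instance at [lebesgue_rV], so the lemmas below apply to it directly; the
    general measure also covers the interval factor of the cylinder. *)
Definition sqint f : Prop :=
  measurable_fun D f /\ mu.-integrable D (fun x => ((f x) ^+ 2)%:E).

Definition ip f g : R := \int[mu]_(x in D) (f x * g x).

(** The product is dominated by f^2 + g^2. *)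
Lemma sqint_integrableM f g : sqint f -> sqint g ->
  mu.-integrable D (EFin \o (fun x => f x * g x)).
Proof.
move=> [mf f2] [mg g2].
apply: (le_integrable mD _ _ (integrableD mD f2 g2)) => /=.
  exact/measurable_EFinP/measurable_funM.
move=> x _; rewrite /= lee_fin.
rewrite [leRHS]ger0_norm ?addr_ge0 ?sqr_ge0//.
by rewrite ler_norml; apply/andP; split; nra.
Qed.

Lemma sqint0 : sqint (fun=> 0).
Proof.
split; first exact: measurable_cst.
by under eq_fun do rewrite expr0n; exact: integrable0.
Qed.

Lemma sqintZ c f : sqint f -> sqint (fun x => c * f x).
Proof.
move=> [mf f2]; split; first exact: measurable_funM.
apply: eq_integrable (integrableZl mD (c ^+ 2) f2) => // x _ /=.
by rewrite -EFinM exprMn.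
Qed.

Lemma sqintD f g : sqint f -> sqint g -> sqint (fun x => f x + g x).
Proof.
move=> sf sg; have [mf f2] := sf; have [mg g2] := sg.
split; first exact: measurable_funD.
have fg := integrableZl mD 2 (sqint_integrableM sf sg).
apply: eq_integrable (integrableD mD (integrableD mD f2 g2) fg) => // x _ /=.
by rewrite -EFinM -!EFinD; congr EFin; ring.
Qed.

Lemma sqintB f g : sqint f -> sqint g -> sqint (fun x => f x - g x).
Proof.
move=> sf sg; have := sqintD sf (sqintZ (-1) sg).
by under eq_fun do rewrite mulN1r.
Qed.

Lemma sqintM_bounded f h (M : R) : sqint f -> measurable_fun D h ->
  (forall x, D x -> `|h x| <= M) -> sqint (fun x => h x * f x).
Proof.
move=> [mf f2] mh hM; split; first exact: measurable_funM.
apply: (le_integrable mD _ _ (integrableZl mD (M ^+ 2) f2)) => /=.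
  by apply/measurable_EFinP/measurable_funX; exact: measurable_funM.
move=> x Dx /=.
rewrite lee_fin (ger0_norm (sqr_ge0 _)) (ger0_norm (mulr_ge0 (sqr_ge0 _) (sqr_ge0 _))).
rewrite exprMn ler_wpM2r ?sqr_ge0// -(real_normK (num_real (h x))).
by rewrite lerXn2r ?nnegrE// ?hM//; apply: le_trans (hM _ Dx).
Qed.

Lemma sqint_bounded f (M : R) : (mu D < +oo)%E -> measurable_fun D f ->
  (forall x, D x -> `|f x| <= M) -> sqint f.
Proof.
move=> Doo mf fM; split => //.
apply: measurable_bounded_integrable => //; first exact: measurable_funX.
exists (M ^+ 2); split; first exact: num_real.
move=> K MK x Dx /=; rewrite normrX; apply: le_trans (ltW MK).
by have := fM _ Dx; rewrite !expr2 => ?; rewrite ler_pM.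
Qed.

Lemma ipC f g : ip f g = ip g f.
Proof. by apply: eq_Rintegral => x _; rewrite mulrC. Qed.

Lemma ipDl f g h : sqint f -> sqint g -> sqint h ->
  ip (fun x => f x + g x) h = ip f h + ip g h.
Proof.
move=> sf sg sh; rewrite /ip -RintegralD//; try exact: sqint_integrableM.
by apply: eq_Rintegral => x _; rewrite mulrDl.
Qed.

Lemma ipZl c f g : sqint f -> sqint g ->
  ip (fun x => c * f x) g = c * ip f g.
Proof.
move=> sf sg; rewrite /ip -RintegralZl//; last exact: sqint_integrableM.
by apply: eq_Rintegral => x _; rewrite mulrA.
Qed.

Lemma ip_ge0 f : 0 <= ip f f.
Proof. by apply: Rintegral_ge0 => x _; rewrite -expr2 sqr_ge0. Qed.

Lemma ip0l f : ip (fun=> 0) f = 0.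
Proof.
rewrite /ip (@eq_Rintegral _ _ _ _ _ (fun=> 0)) ?Rintegral_cst ?mul0r//.
by move=> x _; rewrite mul0r.
Qed.

Lemma eq_ip f f' g g' : {in D, f =1 f'} -> {in D, g =1 g'} ->
  ip f g = ip f' g'.
Proof. by move=> ff gg; apply: eq_Rintegral => x xD; rewrite ff// gg. Qed.

(** Weak derivatives are determined only up to null sets; every computation with them replaces a
    representative by another through this lemma. *)
Lemma ae_eq_ip f f' g : measurable_fun D f -> measurable_fun D f' ->
  measurable_fun D g ->
  {ae mu, forall x, D x -> f x = f' x} -> ip f g = ip f' g.
Proof.
move=> mf mf' mg ff; rewrite /ip /Rintegral; congr fine.
apply: ae_eq_integral => //; try exact/measurable_EFinP/measurable_funM.
by apply: filterS ff => x + Dx => ->.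
Qed.

Lemma ip_eq0_ae f : sqint f -> ip f f = 0 ->
  {ae mu, forall x, D x -> f x = 0}.
Proof.
move=> sf f0.
have i0 : (\int[mu]_(x in D) `|(f x * f x)%:E| = 0)%E.
  have i1 : (\int[mu]_(x in D) `|(f x * f x)%:E| =
      \int[mu]_(x in D) (f x * f x)%:E)%E.
    by apply: eq_integral => x _; rewrite /= ger0_norm// -expr2 sqr_ge0.
  rewrite i1; have /integrable_fin_num/fineK <- := sqint_integrableM sf sf.
    by rewrite -[X in (X%:E)]/(ip f f) f0.
  exact: mD.
have mff : measurable_fun D (EFin \o (fun x => f x * f x)).
  by apply/measurable_EFinP/measurable_funM; exact: sf.1.
have := (ae_eq_integral_abs mu mD mff).1 i0.
apply: filterS => x /= + Dx => /(_ Dx) /eqP.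
by rewrite eqe mulf_eq0 orbb => /eqP.
Qed.

End square_integrable.

(* The Cauchy-Schwarz inequality for a bilinear form given only through its
   values on the plane spanned by two vectors. *)
Lemma discriminant_le (R : realFieldType) (A B C : R) : 0 <= C ->
  (forall t : R, 0 <= A + 2 * t * B + t ^+ 2 * C) -> B ^+ 2 <= A * C.
Proof.
move=> C0 H; have [C00|Cn0] := eqVneq C 0.
  have [->|Bn0] := eqVneq B 0; first by rewrite C00 expr0n mulr0.
  have := H (- (A + 1) / (2 * B)); rewrite C00 mulr0 addr0.
  have -> : A + 2 * (- (A + 1) / (2 * B)) * B = -1 by field.
  by rewrite leNgt ltrN10.
have {C0}Cp : 0 < C by rewrite lt_def Cn0.
have := H (- B / C).
have -> : A + 2 * (- B / C) * B + (- B / C) ^+ 2 * C = A - B ^+ 2 / C by field.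
by rewrite subr_ge0 ler_pdivrMr.
Qed.

(** * Cauchy-Schwarz and parallelogram inequalities in L^2 *)

Section cauchy_schwarz.
Context d (T : measurableType d) (R : realType).
Variables (mu : {measure set T -> \bar R}) (D : set T).
Hypothesis mD : measurable D.
Implicit Types f g h : T -> R.
Notation ip := (ip mu D).
Notation sqint := (sqint mu D).

Lemma ip_polar f g t : sqint f -> sqint g ->
  ip (fun x => f x + t * g x) (fun x => f x + t * g x) =
  ip f f + 2 * t * ip f g + t ^+ 2 * ip g g.
Proof.
move=> sf sg; have stg := sqintZ mD t sg.
rewrite ipDl//; last exact: sqintD.
rewrite ipZl//; last exact: sqintD.
rewrite (ipC _ _ f) ipDl// ipZl// (ipC _ _ g (fun x => _ + _)) ipDl// ipZl//.
by rewrite (ipC _ _ g f); ring.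
Qed.

Lemma ip_CS f g : sqint f -> sqint g -> ip f g ^+ 2 <= ip f f * ip g g.
Proof.
move=> sf sg; apply: discriminant_le; first exact: ip_ge0.
by move=> t; rewrite -ip_polar// ip_ge0.
Qed.

(** The parallelogram identity, with the square of f - g dropped. *)
Lemma ip_triangle2 f g : sqint f -> sqint g ->
  ip (fun x => f x + g x) (fun x => f x + g x) <= 2 * ip f f + 2 * ip g g.
Proof.
move=> sf sg; have h1 := ip_polar 1 sf sg; have h2 := ip_polar (-1) sf sg.
have h3 := ip_ge0 mu D (fun x => f x + -1 * g x).
have -> : ip (fun x => f x + g x) (fun x => f x + g x) =
   ip (fun x => f x + 1 * g x) (fun x => f x + 1 * g x).
  by apply: eq_ip => x _; rewrite mul1r.
by rewrite h1; rewrite h2 in h3; nra.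
Qed.

Lemma ipBl f g h : sqint f -> sqint g -> sqint h ->
  ip (fun x => f x - g x) h = ip f h - ip g h.
Proof.
move=> sf sg sh; rewrite -mulN1r -(ipZl mD (-1) sg sh) -(ipDl mD sf (sqintZ mD (-1) sg) sh).
by apply: eq_ip => // x _; rewrite mulN1r.
Qed.

(** For factors of the same sign the cross term -2 [ip f g] is nonpositive. This saves the factor 2
    of [ip_triangle2], and the constant of the final estimate depends on it. *)
Lemma ipB_le f g : sqint f -> sqint g -> (forall x, D x -> 0 <= f x * g x) ->
  ip (fun x => f x - g x) (fun x => f x - g x) <= ip f f + ip g g.
Proof.
move=> sf sg fg; have sd := sqintB mD sf sg.
have fg0 : 0 <= ip f g by exact: Rintegral_ge0.
rewrite (ipBl sf sg sd) ipC (ipBl sf sg sf) [X in _ - X <= _]ipC (ipBl sf sg sg).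
rewrite (ipC _ _ g f); move: fg0; move: (ip f f) (ip f g) (ip g g) => x y z; lra.
Qed.

End cauchy_schwarz.

(** * Open and bounded subsets of R^n *)

Section rV_borel.
Context {R : realType} (n : nat).
Implicit Types (D : set 'rV[R]_n).

Definition box (a b : 'rV[R]_n) : set 'rV[R]_n :=
  [set x | forall i, a ord0 i < x ord0 i < b ord0 i].

Lemma measurable_rV_forall (A : 'I_n -> set (measurableTypeR R)) :
  (forall i, measurable (A i)) ->
  measurable [set x : 'rV[R]_n | forall i, A i (x ord0 i)].
Proof.
move=> mA.
have -> : [set x : 'rV[R]_n | forall i, A i (x ord0 i)] =
    \bigcap_(i in [set: 'I_n]) ((fun y : 'rV[R]_n => y ord0 i) @^-1` A i).
  by apply/seteqP; split=> [y H i _|y H i]; exact: H.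
apply: fin_bigcap_measurable => [|i _]; first exact: finite_finset.
rewrite -[X in measurable X]setTI.
exact: (measurable_coord i measurableT (mA i)).
Qed.

Lemma measurable_box a b : measurable (box a b).
Proof.
have := @measurable_rV_forall (fun i => `]a ord0 i, b ord0 i[%classic).
rewrite (_ : [set x | _] = box a b); first by apply => i; exact: measurable_itv.
by apply/seteqP; split => x /= H i; have := H i; rewrite in_itv.
Qed.

Lemma ball_rVP (x y : 'rV[R]_n) e : 0 < e ->
  ball x e y <-> forall i, `|x ord0 i - y ord0 i| < e.
Proof.
move=> e0; split.
  by case=> _ H i; exact: (H ord0 i).
by move=> H; split => // i j; rewrite (ord1 i); exact: H.
Qed.

Definition rat_box (q : 'rV[rat]_n * 'rV[rat]_n) : set 'rV[R]_n :=
  box (map_mx ratr q.1) (map_mx ratr q.2).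

(** Rational corners make the family of boxes countable. The intermediate compact [K], the closed
    box, later serves as a common support for test functions approximating indicators of smaller
    boxes. *)
Lemma rat_box_nbhs D x : open D -> D x ->
  exists q, [/\ rat_box q x, rat_box q `<=` D &
    exists K : set 'rV[R]_n, [/\ compact K, rat_box q `<=` K & K `<=` D]].
Proof.
move=> oD Dx; have /nbhs_ballP[e /= e0 eD] := open_nbhs_nbhs (conj oD Dx).
(* Corners at distance less than e / 2 keep even the closed box inside the ball of radius e. *)
have ha i : {q : rat | x ord0 i - e / 2 < ratr q < x ord0 i}.
  apply/cid; have /(_ _)[] := @rat_in_itvoo R (x ord0 i - e / 2) (x ord0 i).
    by rewrite ltrBlDr ltrDl divr_gt0.
  by move=> q; rewrite in_itv => ?; exists q.
have hb i : {q : rat | x ord0 i < ratr q < x ord0 i + e / 2}.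
  apply/cid; have /(_ _)[] := @rat_in_itvoo R (x ord0 i) (x ord0 i + e / 2).
    by rewrite ltrDl divr_gt0.
  by move=> q; rewrite in_itv => ?; exists q.
pose a : 'rV[rat]_n := \row_i sval (ha i).
pose b : 'rV[rat]_n := \row_i sval (hb i).
pose K := [set y : 'rV[R]_n | forall i, `[ratr (a ord0 i), ratr (b ord0 i)]%classic (y ord0 i)].
have KD : K `<=` D.
  move=> y Ky; apply: eD; apply/ball_rVP => // i.
  have := Ky i; rewrite /a /b !mxE /= in_itv/=.
  case: (ha i) (hb i) => p /= /andP[p1 p2] [q /= /andP[q1 q2]] /andP[? ?].
  by rewrite ltr_norml; apply/andP; split; lra.
have bK : rat_box (a, b) `<=` K.
  by move=> y By i; have /andP[h1 h2] := By i; move: h1 h2;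
    rewrite !mxE /= in_itv/= => /ltW -> /ltW ->.
exists (a, b); split.
- move=> i; rewrite !mxE.
  by case: (ha i) (hb i) => p /= /andP[p1 ->] [q /= /andP[-> q2]].
- exact: subset_trans bK KD.
- exists K; split => //; apply: (@rV_compact R n (fun i => `[ratr (a ord0 i), ratr (b ord0 i)]%classic)) => i.
  exact: segment_compact.
Qed.

Lemma open_rat_boxE D : open D ->
  D = \bigcup_(k in [set k : nat | exists q : 'rV[rat]_n * 'rV[rat]_n,
         unpickle k = Some q /\ rat_box q `<=` D])
      (if unpickle k is Some q then rat_box q else set0).
Proof.
move=> oD; apply/seteqP; split => [x Dx|x [k [q [/= kq qD]]]].
  have [q [qx qD _]] := rat_box_nbhs oD Dx.
  by exists (pickle q) => /=; [exists q; rewrite pickleK|rewrite pickleK].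
by rewrite kq => /qD.
Qed.

(** The sigma-algebra is generated by the coordinates, not by the topology; open sets belong to it
    as countable unions of rational boxes, indexed by [nat] through [unpickle]. *)
Lemma open_measurable_rV D : open D -> measurable D.
Proof.
move=> oD; rewrite (open_rat_boxE oD).
apply: bigcup_measurable => k _; case: unpickle => [q|]; last exact: measurable0.
exact: measurable_box.
Qed.

Lemma continuous_measurable_rV (f : 'rV[R]_n -> R) :
  continuous f -> measurable_fun setT f.
Proof.
move=> cf; apply: (measurability _ (RGenOInfty.measurableE R)).
move=> _ [_ [a ->] <-]; rewrite setTI; apply: open_measurable_rV.
by apply: open_comp => // x _; exact: cf.
Qed.

Lemma bounded_rVP D : bounded_set D ->
  exists2 M : R, 0 < M & forall x i, D x -> `|x ord0 i| < M.
Proof.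
move=> [M [Mr HM]]; exists (`|M| + 2); first by rewrite ltr_wpDl.
move=> x i Dx; apply: (@le_lt_trans _ _ `|x|).
  have -> : `|x| = mx_norm x by [].
  rewrite mx_normrE; apply: le_trans (le_bigmax _ _ (ord0, i)) => //.
apply: (@le_lt_trans _ _ (`|M| + 1)); last by rewrite ltrD2l ltr1n.
by apply: HM => //; rewrite (le_lt_trans (ler_norm _))// ltrDl.
Qed.

Lemma lebesgue_rV_bounded D : measurable D -> bounded_set D ->
  (lebesgue_rV n D < +oo)%E.
Proof.
move=> mD /bounded_rVP[M M0 DM].
pose A (i : 'I_n) := `]-M, M[%classic : set (measurableTypeR R).
have mA i : measurable (A i) by exact: measurable_itv.
apply: (@le_lt_trans _ _ (lebesgue_rV n [set x : 'rV[R]_n | forall i, A i (x ord0 i)])).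
  apply: le_measure; rewrite ?inE//; first exact: measurable_rV_forall.
  by move=> x Dx i; rewrite /A/= in_itv/= -ltr_norml; exact: DM.
rewrite lebesgue_rV_prod//.
have -> : (\prod_(i < n) lebesgue_measure (A i))%E = (\prod_(i < n) (2 * M)%:E)%E.
  apply: eq_bigr => i _; rewrite /A lebesgue_measure_itv/= lte_fin.
  by rewrite gtrN// opprK mulr2n mulrDl mul1r.
by rewrite prodEFin ltry.
Qed.

End rV_borel.

(** * Fubini on R * R^n *)

Section fubini_rV.
Context {R : realType} (n : nat).
Notation mu := (@lebesgue_measure R).
Notation nu := (@lebesgue_rV R n).

Definition rV_prod (A : set R) (E : set 'rV[R]_n) : set 'rV[R]_n.+1 :=
  [set x : 'rV[R]_n.+1 | A (x ord0 ord0) /\ E (rV_tail x)].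

Lemma rV_tail_cons (p : measurableTypeR R * 'rV[R]_n) : rV_tail (rV_cons p) = p.2.
Proof. by apply/rowP => i; rewrite mxE rV_consS. Qed.

Lemma measurable_rV_prod (A : set (measurableTypeR R)) E : measurable A -> measurable E ->
  measurable (rV_prod A E).
Proof.
move=> mA mE; apply: measurableI; rewrite -[X in measurable X]setTI.
  exact: (measurable_coord ord0 measurableT mA).
exact: (measurable_rV_tail measurableT mE).
Qed.

Lemma ge0_integral_rVS (F : 'rV[R]_n.+1 -> \bar R) : measurable_fun setT F ->
  (forall x, 0 <= F x)%E ->
  (\int[lebesgue_rV n.+1]_x F x =
   \int[mu]_t \int[nu]_y F (rV_cons (t : measurableTypeR R, y)))%E.
Proof.
move=> mF F0.
rewrite (@ge0_integral_pushforward _ _ _ _ R _ (@measurable_rV_cons R n) (mu \x nu)%E setT F)//.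
rewrite preimage_setT fubini_tonelli1//; last by move=> x; exact: F0.
by apply: measurableT_comp => //; exact: measurable_rV_cons.
Qed.

Lemma integrable_rVS (F : 'rV[R]_n.+1 -> \bar R) :
  (lebesgue_rV n.+1).-integrable setT F ->
  (mu \x nu)%E.-integrable setT (F \o @rV_cons R n).
Proof.
move=> /integrableP[mF Foo]; apply/integrableP; split.
  by apply: measurableT_comp => //; exact: measurable_rV_cons.
move: Foo.
rewrite (@ge0_integral_pushforward _ _ _ _ R _ (@measurable_rV_cons R n) (mu \x nu)%E setT)//.
exact: measurableT_comp.
Qed.

Lemma integral_rVS (F : 'rV[R]_n.+1 -> \bar R) :
  (lebesgue_rV n.+1).-integrable setT F ->
  (\int[lebesgue_rV n.+1]_x F x =
   \int[mu]_t \int[nu]_y F (rV_cons (t : measurableTypeR R, y)))%E.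
Proof.
move=> iF; have iF' := integrable_rVS iF.
rewrite (@integral_pushforward _ _ _ _ R _ (@measurable_rV_cons R n) (mu \x nu)%E setT F)//.
- by rewrite preimage_setT -integral12_prod_meas1.
- exact: measurable_int iF.
Qed.

Lemma integral_rVS_swap (F : 'rV[R]_n.+1 -> \bar R) :
  (lebesgue_rV n.+1).-integrable setT F ->
  (\int[lebesgue_rV n.+1]_x F x =
   \int[nu]_y \int[mu]_t F (rV_cons (t : measurableTypeR R, y)))%E.
Proof.
move=> iF; have iF' := integrable_rVS iF.
rewrite (@integral_pushforward _ _ _ _ R _ (@measurable_rV_cons R n) (mu \x nu)%E setT F)//.
- by rewrite preimage_setT -integral21_prod_meas1.
- exact: measurable_int iF.
Qed.

Section cyl.
Variables (A : set (measurableTypeR R)) (E : set 'rV[R]_n).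
Hypotheses (mA : measurable A) (mE : measurable E).
Notation D := (rV_prod A E).

(** Fubini is applied on the whole space, so an integral over [D] is turned into that of the
    extension by 0, which factors into two nested extensions by 0. *)
Lemma patch_rV_prod (F : 'rV[R]_n.+1 -> \bar R) t y :
  (F \_ D) (rV_cons (t, y)) =
  ((fun t => ((fun y => F (rV_cons (t, y))) \_ E) y) \_ A) t.
Proof.
rewrite !patchE; have [tA|tA] := boolP (t \in A).
  have [yE|yE] := boolP (y \in E).
    rewrite mem_set//; move: tA yE; rewrite !inE => tA yE.
    by split; rewrite ?rV_cons0 ?rV_tail_cons.
  rewrite memNset//; move: tA yE; rewrite !notin_setE inE => tA yE.
  by move=> [_]; rewrite rV_tail_cons.
rewrite memNset//; move: tA; rewrite notin_setE => tA.
by move=> []; rewrite rV_cons0.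
Qed.

Lemma integral_patch_rV_prod (F : 'rV[R]_n.+1 -> \bar R) t :
  (\int[nu]_y (F \_ D) (rV_cons (t : measurableTypeR R, y)) =
   ((fun t => \int[nu]_(y in E) F (rV_cons (t, y))) \_ A) t)%E.
Proof.
rewrite patchE; have [tA|tA] := boolP (t \in A).
  rewrite [RHS]integral_mkcond; apply: eq_integral => y _.
  by rewrite patch_rV_prod patchE tA.
rewrite -[RHS](@integral0 _ _ _ nu setT); apply: eq_integral => y _.
by rewrite patch_rV_prod patchE (negbTE tA).
Qed.

Lemma ge0_integral_rV_prod (F : 'rV[R]_n.+1 -> \bar R) : measurable_fun D F ->
  (forall x, D x -> 0 <= F x)%E ->
  (\int[lebesgue_rV n.+1]_(x in D) F x =
   \int[mu]_(t in A) \int[nu]_(y in E) F (rV_cons (t : measurableTypeR R, y)))%E.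
Proof.
move=> mF F0; rewrite integral_mkcond ge0_integral_rVS.
- rewrite [RHS]integral_mkcond; apply: eq_integral => t _.
  exact: integral_patch_rV_prod.
- by apply/(measurable_restrictT _ _).1 => //; exact: measurable_rV_prod.
- by move=> x; rewrite patchE; case: ifPn => // /set_mem/F0.
Qed.

Lemma integral_rV_prod (F : 'rV[R]_n.+1 -> \bar R) :
  (lebesgue_rV n.+1).-integrable D F ->
  (\int[lebesgue_rV n.+1]_(x in D) F x =
   \int[mu]_(t in A) \int[nu]_(y in E) F (rV_cons (t : measurableTypeR R, y)))%E.
Proof.
move=> iF; rewrite integral_mkcond integral_rVS; last first.
  exact: (integrable_mkcond _ (measurable_rV_prod mA mE)).1 iF.
rewrite [RHS]integral_mkcond; apply: eq_integral => t _.
exact: integral_patch_rV_prod.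
Qed.

Lemma integral_rV_prod_swap (F : 'rV[R]_n.+1 -> \bar R) :
  (lebesgue_rV n.+1).-integrable D F ->
  (\int[lebesgue_rV n.+1]_(x in D) F x =
   \int[nu]_(y in E) \int[mu]_(t in A) F (rV_cons (t : measurableTypeR R, y)))%E.
Proof.
move=> iF; rewrite integral_mkcond integral_rVS_swap; last first.
  exact: (integrable_mkcond _ (measurable_rV_prod mA mE)).1 iF.
rewrite [RHS]integral_mkcond; apply: eq_integral => y _.
rewrite patchE; have [yE|yE] := boolP (y \in E).
  rewrite [RHS]integral_mkcond; apply: eq_integral => t _.
  by rewrite patch_rV_prod !patchE yE.
rewrite -[RHS](@integral0 _ _ _ mu setT); apply: eq_integral => t _.
by rewrite patch_rV_prod !patchE (negbTE yE); case: ifP.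
Qed.

(* Real-valued form; the inner integral is a junk value on a null set of [t]. *)
Lemma Rintegral_rV_prod (F : 'rV[R]_n.+1 -> R) :
  (lebesgue_rV n.+1).-integrable D (EFin \o F) ->
  \int[lebesgue_rV n.+1]_(x in D) F x =
  \int[mu]_(t in A) \int[nu]_(y in E) F (rV_cons (t : measurableTypeR R, y)).
Proof.
move=> iF; rewrite /Rintegral integral_rV_prod//; congr fine.
have iFD : (lebesgue_rV n.+1).-integrable setT ((EFin \o F) \_ D).
  exact: (integrable_mkcond _ (measurable_rV_prod mA mE)).1 iF.
have /= := @integrable_fubini_F _ _ _ _ _ _ _ _ (integrable_rVS iFD).
set G := fubini_F _ _ => iG.
have GE : G = ((fun t => \int[nu]_(y in E) (F (rV_cons (t, y)))%:E) \_ A)%E.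
  by apply/funext => t; exact: (integral_patch_rV_prod (EFin \o F) t).
rewrite GE in iG.
have {iG} := (integrable_mkcond _ mA).2 iG => iG.
apply: ae_eq_integral => //; first exact: measurable_int iG.
  by apply/measurable_EFinP/measurableT_comp => //; exact: measurable_int iG.
have := integrable_ae mA iG; apply: filterS => t /= + tA => /(_ tA) fint.
by rewrite fineK.
Qed.

Lemma Rintegral_rV_prod_swap (F : 'rV[R]_n.+1 -> R) :
  (lebesgue_rV n.+1).-integrable D (EFin \o F) ->
  \int[lebesgue_rV n.+1]_(x in D) F x =
  \int[nu]_(y in E) \int[mu]_(t in A) F (rV_cons (t : measurableTypeR R, y)).
Proof.
move=> iF; rewrite /Rintegral integral_rV_prod_swap//; congr fine.
have iFD : (lebesgue_rV n.+1).-integrable setT ((EFin \o F) \_ D).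
  exact: (integrable_mkcond _ (measurable_rV_prod mA mE)).1 iF.
have iF' := integrable_rVS iFD.
have mG := measurable_fubini_G iF'; have fG := ae_integrable2 iF'.
move: mG; set G := fubini_G _ _ => mG.
have GE : G = ((fun y => \int[mu]_(t in A) (F (rV_cons (t, y)))%:E) \_ E)%E.
  apply/funext => y; rewrite patchE; have [yE|yE] := boolP (y \in E).
    rewrite [RHS]integral_mkcond; apply: eq_integral => t _ /=.
    by rewrite (patch_rV_prod (EFin \o F)) !patchE yE.
  rewrite -[RHS](@integral0 _ _ _ mu setT); apply: eq_integral => t _ /=.
  by rewrite (patch_rV_prod (EFin \o F)) !patchE (negbTE yE); case: ifP.
have mGE : measurable_fun E (fun y => \int[mu]_(t in A) (F (rV_cons (t, y)))%:E)%E.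
  by apply/(measurable_restrictT _ mE); rewrite -GE.
apply: ae_eq_integral => //.
  by apply/measurable_EFinP/measurableT_comp.
apply: filterS fG => y /(integrable_fin_num measurableT) Gy Ey.
have : G y \is a fin_num by exact: Gy.
by rewrite GE patchE mem_set// => Gfin; rewrite fineK.
Qed.

Lemma measurable_fun_coord0 (p : R -> R) : measurable_fun A p ->
  measurable_fun D (fun x => p (x ord0 ord0)).
Proof.
move=> mp; apply: (measurable_comp (F := A) mA _ mp) => //.
  by move=> _ [x [Ax _] <-].
by apply: measurable_funTS; exact: measurable_coord.
Qed.

Lemma measurable_fun_tail (h : 'rV[R]_n -> R) : measurable_fun E h ->
  measurable_fun D (fun x => h (rV_tail x)).
Proof.
move=> mh; apply: (measurable_comp (F := E) mE _ mh) => //.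
  by move=> _ [x [_ Ex] <-].
by apply: measurable_funTS; exact: measurable_rV_tail.
Qed.

Lemma measurable_tens p (h : 'rV[R]_n -> R) : measurable_fun A p ->
  measurable_fun E h -> measurable_fun D (tens p h).
Proof.
by move=> mp mh; apply: measurable_funM;
  [exact: measurable_fun_coord0|exact: measurable_fun_tail].
Qed.

Lemma tens_cons p (h : 'rV[R]_n -> R) t y :
  tens p h (rV_cons (t : measurableTypeR R, y)) = p t * h y.
Proof. by rewrite /tens rV_cons0 rV_tail_cons. Qed.

(** By Tonelli the integral of the absolute value factors into two finite integrals. *)
Lemma integrable_tens p (h : 'rV[R]_n -> R) : mu.-integrable A (EFin \o p) ->
  nu.-integrable E (EFin \o h) ->
  (lebesgue_rV n.+1).-integrable D (EFin \o tens p h).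
Proof.
move=> ip ih.
have mp : measurable_fun A p by apply/measurable_EFinP; exact: measurable_int ip.
have mh : measurable_fun E h by apply/measurable_EFinP; exact: measurable_int ih.
have mt := measurable_tens mp mh.
apply/integrableP; split; first exact/measurable_EFinP.
rewrite ge0_integral_rV_prod//; last first.
  by apply: measurableT_comp => //; exact/measurable_EFinP.
have /integrable_fin_num ih1 := integrable_abse ih.
have fh : (\int[nu]_(y in E) `|(h y)%:E| \is a fin_num)%E by exact: ih1.
under eq_integral.
  move=> t _.
  have -> : (\int[nu]_(y in E) `|(EFin \o tens p h) (rV_cons (t, y))| =
     `|(p t)%:E| * \int[nu]_(y in E) `|(h y)%:E|)%E.
    rewrite -ge0_integralZl//; last exact/measurableT_comp/measurable_EFinP.
    by apply: eq_integral => y _ /=; rewrite tens_cons normrM.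
  rewrite -(fineK fh).
  over.
rewrite /= ge0_integralZr//; last 2 first.
- by apply/measurable_EFinP; apply: measurableT_comp.
- by rewrite lee_fin fine_ge0// integral_ge0.
have := integrable_lty mA (integrable_abse ip) => /= pfin.
by rewrite lte_mul_pinfty ?integral_ge0// ?ltry// ge0_fin_numE ?integral_ge0.
Qed.

Lemma Rintegral_tens p (h : 'rV[R]_n -> R) : mu.-integrable A (EFin \o p) ->
  nu.-integrable E (EFin \o h) ->
  \int[lebesgue_rV n.+1]_(x in D) tens p h x =
  (\int[mu]_(t in A) p t) * \int[nu]_(y in E) h y.
Proof.
move=> ip ih; rewrite Rintegral_rV_prod//; last exact: integrable_tens.
rewrite -RintegralZr//; apply: eq_Rintegral => t _; rewrite -RintegralZl//.
by apply: eq_Rintegral => y _; rewrite tens_cons.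
Qed.

End cyl.
End fubini_rV.

(** * Smooth functions *)

Section smooth_rV.
Context {R : realType}.

(** Any class of differentiable functions stable under partial derivatives is an invariant for the
    induction on the list of derivatives. Each closure property of [smooth] is obtained by
    exhibiting such a class. *)
Lemma smooth_coind n (P : ('rV[R]_n -> R) -> Prop) :
  (forall f, P f -> (forall x, differentiable f x) /\
     forall i, P (partial i f)) -> forall f, P f -> smooth f.
Proof.
move=> H f Pf s x.
have : P (foldr (@partial R n) f s) by elim: s => //= i s /H[_]; exact.
by move=> /H[].
Qed.

Lemma smooth_diff n (f : 'rV[R]_n -> R) : smooth f -> forall x, differentiable f x.
Proof. by move=> sf x; exact: (sf [::] x). Qed.

Lemma smooth_partial n (f : 'rV[R]_n -> R) i : smooth f -> smooth (partial i f).
Proof. by move=> sf s x; have := sf (rcons s i) x; rewrite foldr_rcons. Qed.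

Lemma smooth_continuous n (f : 'rV[R]_n -> R) : smooth f -> continuous f.
Proof. by move=> sf x; apply: differentiable_continuous; exact: smooth_diff. Qed.

Lemma partialD n (f g : 'rV[R]_n -> R) i : (forall x, differentiable f x) ->
  (forall x, differentiable g x) ->
  partial i (fun x => f x + g x) = fun x => partial i f x + partial i g x.
Proof.
move=> df dg; apply/funext => x.
by rewrite /partial (@deriveD _ _ _ f g)//; exact: diff_derivable.
Qed.

Lemma partialM n (f g : 'rV[R]_n -> R) i : (forall x, differentiable f x) ->
  (forall x, differentiable g x) ->
  partial i (fun x => f x * g x) =
  fun x => f x * partial i g x + partial i f x * g x.
Proof.
move=> df dg; apply/funext => x.
rewrite /partial (@deriveM _ _ f g); try exact: diff_derivable.
by rewrite /GRing.scale/= [g x * _]mulrC.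
Qed.

Lemma partial_cst n (c : R) (i : 'I_n) : partial i (fun=> c) = (fun=> 0) :> ('rV[R]_n -> R).
Proof. by apply/funext => x; rewrite /partial derive_cst. Qed.

Lemma smooth_cst n (c : R) : smooth (fun _ : 'rV[R]_n => c).
Proof.
apply: (@smooth_coind _ (fun f => exists c, f = fun=> c)); last by exists c.
move=> _ [{}c ->]; split=> [x|i]; first exact: differentiable_cst.
by exists 0; rewrite partial_cst.
Qed.

Lemma smoothD n (f g : 'rV[R]_n -> R) : smooth f -> smooth g ->
  smooth (fun x => f x + g x).
Proof.
move=> sf sg.
apply: (@smooth_coind _ (fun h => exists f g, [/\ smooth f, smooth g &
  h = fun x => f x + g x])); last by exists f, g.
move=> _ [{sf}f [{sg}g [sf sg ->]]]; split=> [x|i].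
  by apply: (@differentiableD _ _ _ f g); exact: smooth_diff.
exists (partial i f), (partial i g); split; try exact: smooth_partial.
by rewrite partialD//; exact: smooth_diff.
Qed.

Lemma smooth_sum n I (r : seq I) (F : I -> 'rV[R]_n -> R) :
  (forall i, smooth (F i)) -> smooth (fun x => \sum_(i <- r) F i x).
Proof.
move=> sF; elim: r => [|i r IH].
  by under eq_fun do rewrite big_nil; exact: smooth_cst.
by under eq_fun do rewrite big_cons; exact: smoothD.
Qed.

Lemma smoothM n (f g : 'rV[R]_n -> R) : smooth f -> smooth g ->
  smooth (fun x => f x * g x).
Proof.
move=> sf sg.
(* Products alone are not stable under derivation; finite sums of products are, by the Leibniz
   rule. *)
pose P h := exists s : seq (('rV[R]_n -> R) * ('rV[R]_n -> R)),
  (forall k, smooth (nth (fun=> 0, fun=> 0) s k).1 /\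
     smooth (nth (fun=> 0, fun=> 0) s k).2) /\
  h = fun x => \sum_(k < size s) (nth (fun=> 0, fun=> 0) s k).1 x *
                                 (nth (fun=> 0, fun=> 0) s k).2 x.
suff HP : forall h, P h -> (forall x, differentiable h x) /\ forall i, P (partial i h).
  apply: (smooth_coind HP); exists [:: (f, g)]; split.
    by case=> [|k] //=; rewrite nth_nil; split; exact: smooth_cst.
  by apply/funext => x; rewrite big_ord1.
move=> _ [s [ss ->]]; elim: s ss => [|[u v] s IH] ss.
  under eq_fun do rewrite big_ord0.
  split=> [x|i]; first exact: differentiable_cst.
  rewrite partial_cst; exists [::]; split; first by move=> k; rewrite nth_nil; split; exact: smooth_cst.
  by apply/funext => x; rewrite big_ord0.
have [su sv] := ss 0%N.
have {}ss : forall k, smooth (nth (fun=> 0, fun=> 0) s k).1 /\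
     smooth (nth (fun=> 0, fun=> 0) s k).2 by move=> k; exact: (ss k.+1).
have {IH}[dh Ph] := IH ss.
set h := fun x => _ in dh Ph *.
have -> : (fun x => \sum_(k < size ((u, v) :: s)) (nth (fun=> 0, fun=> 0) ((u, v) :: s) k).1 x *
   (nth (fun=> 0, fun=> 0) ((u, v) :: s) k).2 x) = fun x => (fun x => u x * v x) x + h x.
  by apply/funext => x; rewrite /= big_ord_recl.
have duv : forall x, differentiable (fun x => u x * v x) x.
  by move=> x; apply: (@differentiableM _ _ u v); exact: smooth_diff.
split=> [x|i]; first exact: (@differentiableD _ _ _ (fun x => u x * v x) h).
rewrite partialD// partialM//; try exact: smooth_diff.
have [s' [ss' s'E]] := Ph i.
exists [:: (u, partial i v), (partial i u, v) & s']; split.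
  by case=> [|[|k]] /=; [split=> //; exact: smooth_partial|split=> //; exact: smooth_partial|exact: ss'].
by apply/funext => x; rewrite s'E /= !big_ord_recl/= addrA.
Qed.

Lemma smoothZ n c (f : 'rV[R]_n -> R) : smooth f -> smooth (fun x => c * f x).
Proof. by move=> sf; apply: smoothM => //; exact: smooth_cst. Qed.

Lemma smooth_prod n I (r : seq I) (F : I -> 'rV[R]_n -> R) :
  (forall i, smooth (F i)) -> smooth (fun x => \prod_(i <- r) F i x).
Proof.
move=> sF; elim: r => [|i r IH].
  by under eq_fun do rewrite big_nil; exact: smooth_cst.
by under eq_fun do rewrite big_cons; exact: smoothM.
Qed.

(* An inductive wrapper, so that unification does not unfold it. *)
Variant smooth1 (p : R -> R) : Prop :=
  Smooth1 of forall k x, derivable (derive1n k p) x 1.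

Lemma smooth1_coind (P : (R -> R) -> Prop) :
  (forall f, P f -> (forall x, derivable f x 1) /\ P (derive1 f)) ->
  forall f, P f -> smooth1 f.
Proof.
move=> H f Pf; split=> k x.
have : P (derive1n k f) by elim: k => //= k /H[_].
by move=> /H[].
Qed.

Lemma smooth1_derivable p : smooth1 p -> forall x, derivable p x 1.
Proof. by move=> [sp] x; exact: (sp 0%N x). Qed.

Lemma smooth1_derive p : smooth1 p -> smooth1 (derive1 p).
Proof. by move=> [sp]; split=> k x; have := sp k.+1 x; rewrite derive1Sn. Qed.

Lemma smooth1_continuous p : smooth1 p -> continuous p.
Proof.
move=> sp x; apply: differentiable_continuous; apply/derivable1_diffP.
exact: smooth1_derivable.
Qed.

Lemma smooth1_cst c : smooth1 (fun=> c).
Proof.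
apply: (@smooth1_coind (fun f => exists c, f = fun=> c)); last by exists c.
move=> _ [{}c ->]; split=> [x|]; first exact: derivable_cst.
by exists 0; apply/funext => x; rewrite derive1_cst.
Qed.

Lemma smooth1_id : smooth1 id.
Proof.
apply: (@smooth1_coind (fun f => f = id \/ smooth1 f)); last by left.
move=> f [->|sf].
  split=> [x|]; first exact: derivable_id.
  right; rewrite (_ : derive1 id = fun=> 1); last by apply/funext => x; rewrite derive1_id.
  exact: smooth1_cst.
by split; [exact: smooth1_derivable|right; exact: smooth1_derive].
Qed.

Lemma derive1D (p q : R -> R) : (forall x, derivable p x 1) -> (forall x, derivable q x 1) ->
  derive1 (fun x => p x + q x) = fun x : R => (derive1 p) x + (derive1 q) x :> R.
Proof.
by move=> dp dq; apply/funext => x; rewrite !derive1E (@deriveD _ _ _ p q).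
Qed.

Lemma derive1M (p q : R -> R) : (forall x, derivable p x 1) -> (forall x, derivable q x 1) ->
  derive1 (fun x => p x * q x) = fun x : R => p x * (derive1 q) x + (derive1 p) x * q x :> R.
Proof.
move=> dp dq; apply/funext => x; rewrite !derive1E (@deriveM _ _ p q)//.
by rewrite /GRing.scale/= [q x * _]mulrC.
Qed.

Lemma smooth1D p q : smooth1 p -> smooth1 q -> smooth1 (fun x => p x + q x).
Proof.
move=> sp sq.
apply: (@smooth1_coind (fun h => exists f g, [/\ smooth1 f, smooth1 g &
  h = fun x => f x + g x])); last by exists p, q.
move=> _ [{sp}p [{sq}q [sp sq ->]]]; split=> [x|].
  by apply: (@derivableD _ _ _ p q); exact: smooth1_derivable.
exists (derive1 p), (derive1 q); split; try exact: smooth1_derive.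
by rewrite (derive1D (smooth1_derivable sp) (smooth1_derivable sq)).
Qed.

Lemma smooth1M p q : smooth1 p -> smooth1 q -> smooth1 (fun x => p x * q x).
Proof.
move=> sp sq.
pose P h := exists s : seq ((R -> R) * (R -> R)),
  (forall k, smooth1 (nth (fun=> 0, fun=> 0) s k).1 /\
     smooth1 (nth (fun=> 0, fun=> 0) s k).2) /\
  h = fun x => \sum_(k < size s) (nth (fun=> 0, fun=> 0) s k).1 x *
                                 (nth (fun=> 0, fun=> 0) s k).2 x.
suff HP : forall h, P h -> (forall x, derivable h x 1) /\ P (derive1 h).
  apply: (smooth1_coind HP); exists [:: (p, q)]; split.
    by case=> [|k] //=; rewrite nth_nil; split; exact: smooth1_cst.
  by apply/funext => x; rewrite big_ord1.
move=> _ [s [ss ->]]; elim: s ss => [|[u v] s IH] ss.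
  under eq_fun do rewrite big_ord0.
  split=> [x|]; first exact: derivable_cst.
  exists [::]; split; first by move=> k; rewrite nth_nil; split; exact: smooth1_cst.
  by apply/funext => x; rewrite big_ord0 derive1_cst.
have [su sv] := ss 0%N.
have {}ss : forall k, smooth1 (nth (fun=> 0, fun=> 0) s k).1 /\
     smooth1 (nth (fun=> 0, fun=> 0) s k).2 by move=> k; exact: (ss k.+1).
have {IH}[dh Ph] := IH ss.
set h := fun x => _ in dh Ph *.
have -> : (fun x => \sum_(k < size ((u, v) :: s)) (nth (fun=> 0, fun=> 0) ((u, v) :: s) k).1 x *
   (nth (fun=> 0, fun=> 0) ((u, v) :: s) k).2 x) = fun x => (fun x => u x * v x) x + h x.
  by apply/funext => x; rewrite /= big_ord_recl.
have duv : forall x, derivable (fun x => u x * v x) x 1.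
  by move=> x; apply: (@derivableM _ _ u v); exact: smooth1_derivable.
split=> [x|]; first exact: (@derivableD _ _ _ (fun x => u x * v x) h).
rewrite (derive1D duv dh) (derive1M (smooth1_derivable su) (smooth1_derivable sv)).
have [s' [ss' s'E]] := Ph.
exists [:: (u, (derive1 v)), ((derive1 u), v) & s']; split.
  case=> [|[|k]] /=; last exact: ss'.
    by split; [exact: su|exact: smooth1_derive sv].
  by split; [exact: smooth1_derive su|exact: sv].
by apply/funext => x; rewrite s'E /= !big_ord_recl/= addrA.
Qed.

Lemma smooth1Z c p : smooth1 p -> smooth1 (fun x => c * p x).
Proof. by move=> sp; apply: smooth1M => //; exact: smooth1_cst. Qed.

Lemma smooth1B p q : smooth1 p -> smooth1 q -> smooth1 (fun x => p x - q x).
Proof.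
by move=> sp sq; have := smooth1D sp (smooth1Z (-1) sq); under eq_fun do rewrite mulN1r.
Qed.

Lemma derive1Z c p : smooth1 p -> derive1 (fun x => c * p x) = fun x => c * derive1 p x.
Proof.
move=> sp; rewrite (derive1M (smooth1_derivable (smooth1_cst c)) (smooth1_derivable sp)).
by apply/funext => x; rewrite derive1_cst mul0r addr0.
Qed.

Lemma derive1B p q : smooth1 p -> smooth1 q ->
  derive1 (fun x => p x - q x) = fun x => derive1 p x - derive1 q x.
Proof.
move=> /smooth1_derivable dp /smooth1_derivable dq.
by apply/funext => x; rewrite !derive1E (@deriveB _ _ _ p q).
Qed.

Lemma smooth1X p k : smooth1 p -> smooth1 (fun x => p x ^+ k).
Proof.
move=> sp; elim: k => [|k IH].
  by under eq_fun do rewrite expr0; exact: smooth1_cst.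
by under eq_fun do rewrite exprS; exact: smooth1M.
Qed.

Lemma derive1_compE (p q : R -> R) : (forall x, derivable p x 1) ->
  (forall x, derivable q x 1) ->
  derive1 (fun x => q (p x)) = fun x => (derive1 q) (p x) * (derive1 p) x.
Proof.
by move=> dp dq; apply/funext => x; rewrite (@derive1_comp _ p q).
Qed.

Lemma smooth1_comp p q : smooth1 p -> smooth1 q -> smooth1 (fun x => q (p x)).
Proof.
move=> sp sq.
(* The invariant class consists of the finite sums of (u o p) v: the derivative of u o p brings out
   the factor p', which is absorbed in v. *)
pose P h := exists s : seq ((R -> R) * (R -> R)),
  (forall k, smooth1 (nth (fun=> 0, fun=> 0) s k).1 /\
     smooth1 (nth (fun=> 0, fun=> 0) s k).2) /\
  h = fun x => \sum_(k < size s) (nth (fun=> 0, fun=> 0) s k).1 (p x) *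
                                 (nth (fun=> 0, fun=> 0) s k).2 x.
suff HP : forall h, P h -> (forall x, derivable h x 1) /\ P (derive1 h).
  apply: (smooth1_coind HP); exists [:: (q, fun=> 1)]; split.
    by case=> [|k] //=; rewrite ?nth_nil; split=> //; exact: smooth1_cst.
  by apply/funext => x; rewrite big_ord1/= mulr1.
move=> _ [s [ss ->]]; elim: s ss => [|[u v] s IH] ss.
  under eq_fun do rewrite big_ord0.
  split=> [x|]; first exact: derivable_cst.
  exists [::]; split; first by move=> k; rewrite nth_nil; split; exact: smooth1_cst.
  by apply/funext => x; rewrite big_ord0 derive1_cst.
have [/= su sv] := ss 0%N.
have {}ss : forall k, smooth1 (nth (fun=> 0, fun=> 0) s k).1 /\
     smooth1 (nth (fun=> 0, fun=> 0) s k).2 by move=> k; exact: (ss k.+1).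
have {IH}[dh Ph] := IH ss.
set h := fun x => _ in dh Ph *.
have -> : (fun x => \sum_(k < size ((u, v) :: s)) (nth (fun=> 0, fun=> 0) ((u, v) :: s) k).1 (p x) *
   (nth (fun=> 0, fun=> 0) ((u, v) :: s) k).2 x) = fun x => (fun x => (fun x => u (p x)) x * v x) x + h x.
  by apply/funext => x; rewrite /= big_ord_recl.
have dup : forall x, derivable (fun x => u (p x)) x 1.
  move=> x; apply/derivable1_diffP; apply: (@differentiable_comp _ _ _ _ p u);
    apply/derivable1_diffP; exact: smooth1_derivable.
have duv : forall x, derivable (fun x => (fun x => u (p x)) x * v x) x 1.
  by move=> x; apply: (@derivableM _ _ (fun x => u (p x)) v) => //; exact: smooth1_derivable.
split=> [x|]; first exact: (@derivableD _ _ _ (fun x => u (p x) * v x) h).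
rewrite (derive1D duv dh) (derive1M dup (smooth1_derivable sv)).
rewrite (derive1_compE (smooth1_derivable sp) (smooth1_derivable su)).
have [s' [ss' s'E]] := Ph.
exists [:: (u, (derive1 v)), ((derive1 u), fun x => (derive1 p) x * v x) & s']; split.
  case=> [|[|k]] /=; last exact: ss'.
    by split; [exact: su|exact: smooth1_derive sv].
  by split; [exact: smooth1_derive su|apply: smooth1M sv; exact: smooth1_derive sp].
by apply/funext => x; rewrite s'E /= !big_ord_recl/= addrA mulrA.
Qed.

End smooth_rV.

(** * Derivatives of functions of the first coordinate, of the tail, and along slices and lines *)

Section slices.
Context {R : realType}.

(** The two difference quotients are the same function of h. One lemma thus covers coordinates,
    tails, slices and lines. *)
Lemma derive_comp_affine (V W : normedModType R) (L : V -> W) (f : W -> R) x v w :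
  (forall h, L (h *: v + x) = h *: w + L x) ->
  'D_v (fun z => f (L z)) x = 'D_w f (L x).
Proof.
move=> Lh; rewrite /derive.
by under eq_fun do rewrite /= Lh.
Qed.

(** In finite dimension the map is a finite sum of coordinates times constant vectors. *)
Lemma differentiable_linear_rV m n (L : 'rV[R]_m -> 'rV[R]_n) :
  (forall a x y, L (a *: x + y) = a *: L x + L y) -> forall x, differentiable L x.
Proof.
move=> HL x.
have L0 : L 0 = 0 by have := HL 1 0 0; rewrite !scale1r addr0 => /eqP; rewrite -subr_eq0 opprD addNKr oppr_eq0 => /eqP.
have LE : L = \sum_(i < m) (fun x : 'rV[R]_m => x ord0 i *: L (delta_mx ord0 i)) :> ('rV[R]_m -> 'rV[R]_n).
  apply/funext => y; rewrite fct_sumE {1}[y]row_sum_delta.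
  elim/big_rec2: _ => [//|i u v _ <-]; exact: HL.
rewrite LE; apply: differentiable_sum => i.
apply: (@differentiableZl _ _ _ (fun y : 'rV[R]_m => y ord0 i)).
exact: differentiable_coord.
Qed.

Lemma rV_tailP n (a : R) (x y : 'rV[R]_n.+1) :
  rV_tail (a *: x + y) = a *: rV_tail x + rV_tail y.
Proof. by apply/rowP => i; rewrite !mxE. Qed.

Lemma rV_tail_delta0 n : rV_tail (delta_mx ord0 ord0 : 'rV[R]_n.+1) = 0.
Proof. by apply/rowP => i; rewrite !mxE. Qed.

Lemma rV_tail_deltaS n (j : 'I_n) :
  rV_tail (delta_mx ord0 (lift ord0 j) : 'rV[R]_n.+1) = delta_mx ord0 j.
Proof. by apply/rowP => i; rewrite !mxE (inj_eq lift_inj). Qed.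

(** Moving the tail in the direction v is an affine motion of the whole vector, in the form that
    [derive_comp_affine] expects; [rV_cons_addl] is the analogue for the first coordinate. *)
Lemma rV_cons_addr n (t : R) (h : R) (v y : 'rV[R]_n) :
  rV_cons (t : measurableTypeR R, h *: v + y) =
  h *: rV_cons (0 : measurableTypeR R, v) + rV_cons (t : measurableTypeR R, y).
Proof.
apply/rowP => i; have [j ->|->] := unliftP ord0 i.
  by rewrite !mxE liftK/= !mxE.
by rewrite !mxE unlift_none/= mulr0 add0r.
Qed.

Lemma rV_cons_addl n (t : R) (h : R) (v : R) (y : 'rV[R]_n) :
  rV_cons (h * v + t : measurableTypeR R, y) =
  h *: (v *: delta_mx ord0 ord0) + rV_cons (t : measurableTypeR R, y).
Proof.
apply/rowP => i; have [j ->|->] := unliftP ord0 i.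
  by rewrite !mxE liftK/= !mulr0 add0r.
by rewrite !mxE unlift_none/= mulr1.
Qed.

Lemma rV_cons0_delta n (j : 'I_n) :
  rV_cons (0 : measurableTypeR R, delta_mx ord0 j) = delta_mx ord0 (lift ord0 j).
Proof.
apply/rowP => i; have [k ->|->] := unliftP ord0 i.
  by rewrite rV_consS !mxE (inj_eq lift_inj).
by rewrite rV_cons0 mxE.
Qed.

Lemma differentiable_tail n (x : 'rV[R]_n.+1) : differentiable (@rV_tail R n) x.
Proof. by apply: differentiable_linear_rV => a u v; rewrite rV_tailP. Qed.

Lemma differentiable_cons n (t : R) (y : 'rV[R]_n) :
  differentiable (fun y => rV_cons (t : measurableTypeR R, y)) y.
Proof.
rewrite (_ : (fun y => _) = (fun y => rV_cons (0 : measurableTypeR R, y)) +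
  (cst (rV_cons (t : measurableTypeR R, 0)))).
  apply: differentiableD; last exact: differentiable_cst.
  apply: differentiable_linear_rV => a u v.
  by rewrite rV_cons_addr.
apply/funext => z; rewrite fctE; have := rV_cons_addr t 1 z 0.
by rewrite !scale1r addr0.
Qed.

Lemma differentiable_consl n (y : 'rV[R]_n) (t : R) :
  differentiable (fun t : R => rV_cons (t : measurableTypeR R, y)) t.
Proof.
rewrite (_ : (fun t => _) = (fun t : R => t *: delta_mx ord0 ord0) +
  (cst (rV_cons (0 : measurableTypeR R, y)))).
  apply: differentiableD; last exact: differentiable_cst.
  by apply: (@differentiableZl _ _ _ id); exact/derivable1_diffP/derivable_id.
apply/funext => z; rewrite fctE; have := rV_cons_addl 0 z 1 y.
by rewrite scale1r mulr1 addr0.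
Qed.

Lemma partial_coord n (p : R -> R) (i j : 'I_n) :
  partial j (fun x : 'rV[R]_n => p (x ord0 i)) =
  fun x => if j == i then derive1 p (x ord0 i) else 0.
Proof.
apply/funext => x; rewrite /partial.
rewrite (@derive_comp_affine _ _ (fun x : 'rV[R]_n => x ord0 i) p x _ (j == i)%:R).
  by case: eqVneq => _; rewrite ?derive0// derive1E.
by move=> h; rewrite !mxE/= eq_sym.
Qed.

Lemma smooth_coord n (p : R -> R) (i : 'I_n) : smooth1 p ->
  smooth (fun x : 'rV[R]_n => p (x ord0 i)).
Proof.
move=> sp; apply: (@smooth_coind _ _ (fun f => exists q, smooth1 q /\
  f = fun x => q (x ord0 i))); last by exists p.
move=> _ [q [sq ->]]; split=> [x|j].
  apply: (@differentiable_comp _ _ _ _ (fun x : 'rV[R]_n => x ord0 i) q).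
    exact: differentiable_coord.
  by apply/derivable1_diffP; exact: smooth1_derivable sq _.
rewrite partial_coord; case: eqVneq => _.
  by exists (derive1 q); split => //; exact: smooth1_derive.
by exists (fun=> 0); split => //; exact: smooth1_cst.
Qed.

Lemma partial_tail0 n (h : 'rV[R]_n -> R) :
  partial ord0 (fun x => h (rV_tail x)) = fun=> 0.
Proof.
apply/funext => x; rewrite /partial.
rewrite (@derive_comp_affine _ _ (@rV_tail R n) h x _ 0) ?derive0//.
by move=> a; rewrite rV_tailP rV_tail_delta0.
Qed.

Lemma partial_tailS n (h : 'rV[R]_n -> R) j :
  partial (lift ord0 j) (fun x => h (rV_tail x)) = fun x => partial j h (rV_tail x).
Proof.
apply/funext => x; rewrite /partial.
rewrite (@derive_comp_affine _ _ (@rV_tail R n) h x _ (delta_mx ord0 j))//.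
by move=> a; rewrite rV_tailP rV_tail_deltaS.
Qed.

Lemma smooth_tail n (h : 'rV[R]_n -> R) : smooth h ->
  smooth (fun x => h (rV_tail x)).
Proof.
move=> sh; apply: (@smooth_coind _ _ (fun f => exists q, smooth q /\
  f = fun x => q (rV_tail x))); last by exists h.
move=> _ [q [sq ->]]; split=> [x|j].
  apply: (@differentiable_comp _ _ _ _ (@rV_tail R n) q).
    exact: differentiable_tail.
  exact: smooth_diff.
have [k ->|->] := unliftP ord0 j.
  by rewrite partial_tailS; exists (partial k q); split => //; exact: smooth_partial.
by rewrite partial_tail0; exists (fun=> 0); split => //; exact: smooth_cst.
Qed.

Lemma partial_slice n (phi : 'rV[R]_n.+1 -> R) (t : R) j :
  partial j (fun y => phi (rV_cons (t : measurableTypeR R, y))) =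
  fun y => partial (lift ord0 j) phi (rV_cons (t : measurableTypeR R, y)).
Proof.
apply/funext => y; rewrite /partial.
rewrite (@derive_comp_affine _ _ (fun y => rV_cons (t : measurableTypeR R, y)) phi
  y _ (delta_mx ord0 (lift ord0 j)))//.
by move=> a; rewrite rV_cons_addr rV_cons0_delta.
Qed.

Lemma smooth_slice n (phi : 'rV[R]_n.+1 -> R) (t : R) : smooth phi ->
  smooth (fun y => phi (rV_cons (t : measurableTypeR R, y))).
Proof.
move=> sh; apply: (@smooth_coind _ _ (fun f => exists q, smooth q /\
  f = fun y => q (rV_cons (t : measurableTypeR R, y)))); last by exists phi.
move=> _ [q [sq ->]]; split=> [x|j].
  apply: (@differentiable_comp _ _ _ _ (fun y => rV_cons (t : measurableTypeR R, y)) q).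
    exact: differentiable_cons.
  exact: smooth_diff.
by rewrite partial_slice; exists (partial (lift ord0 j) q); split => //; exact: smooth_partial.
Qed.

Lemma derive1_line n (phi : 'rV[R]_n.+1 -> R) (y : 'rV[R]_n) :
  derive1 (fun t : R => phi (rV_cons (t : measurableTypeR R, y))) =
  fun t => partial ord0 phi (rV_cons (t : measurableTypeR R, y)).
Proof.
apply/funext => t; rewrite derive1E /partial.
rewrite (@derive_comp_affine _ _ (fun t : R => rV_cons (t : measurableTypeR R, y)) phi
  t _ (delta_mx ord0 ord0))//.
by move=> a; rewrite rV_cons_addl scale1r.
Qed.

Lemma smooth1_line n (phi : 'rV[R]_n.+1 -> R) (y : 'rV[R]_n) : smooth phi ->
  smooth1 (fun t : R => phi (rV_cons (t : measurableTypeR R, y))).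
Proof.
move=> sh; apply: (@smooth1_coind _ (fun f => exists q, smooth q /\
  f = fun t : R => q (rV_cons (t : measurableTypeR R, y)))); last by exists phi.
move=> _ [q [sq ->]]; split=> [x|].
  apply/derivable1_diffP.
  apply: (@differentiable_comp _ _ _ _ (fun t : R => rV_cons (t : measurableTypeR R, y)) q).
    exact: differentiable_consl.
  exact: smooth_diff.
by rewrite derive1_line; exists (partial ord0 q); split => //; exact: smooth_partial.
Qed.

Lemma smooth_tens n p (h : 'rV[R]_n -> R) : smooth1 p -> smooth h ->
  smooth (tens p h).
Proof.
by move=> sp sh; apply: smoothM; [exact: smooth_coord|exact: smooth_tail].
Qed.

Lemma partial_tensS n p (h : 'rV[R]_n -> R) j : smooth1 p -> smooth h ->
  partial (lift ord0 j) (tens p h) = tens p (partial j h).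
Proof.
move=> sp sh; rewrite /tens partialM; last 2 first.
- by apply: smooth_diff; exact: smooth_coord.
- by apply: smooth_diff; exact: smooth_tail.
by rewrite partial_coord partial_tailS; apply/funext => x /=; rewrite mul0r addr0.
Qed.

End slices.

(** * Test functions *)

Section test_functions.
Context {R : realType}.
Notation mu := (@lebesgue_measure R).

(** The closure of the support is traded for any compact subset of [D] outside of which phi
    vanishes. Such a set is easy to exhibit for derivatives, products, slices and tensor
    products. *)
Lemma test_functionP n (D : set 'rV[R]_n) phi :
  test_function D phi <->
  smooth phi /\ exists K : set 'rV[R]_n, [/\ compact K, K `<=` D &
    forall x, ~ K x -> phi x = 0].
Proof.
split=> [[sphi cK KD]|[sphi [K [cK KD K0]]]].
  split=> //; exists (closure [set x | phi x != 0]); split => // x Kx.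
  by apply/eqP; apply: contra_notT Kx => phix; exact: subset_closure.
have clK : closure [set x | phi x != 0] `<=` K.
  rewrite closureE; apply: smallest_sub; first exact: compact_closed cK.
  by move=> x /= /eqP phix; apply: contrapT => /K0.
split=> //; last exact: subset_trans KD.
by apply: subclosed_compact cK clK; exact: closed_closure.
Qed.

Lemma test_smooth n (D : set 'rV[R]_n) phi : test_function D phi -> smooth phi.
Proof. by case. Qed.

Lemma test_out n (D : set 'rV[R]_n) phi x : test_function D phi -> ~ D x -> phi x = 0.
Proof. by move=> /test_functionP[_ [K [_ KD K0]]] Dx; apply: K0 => /KD. Qed.

Lemma test_sub n (D E : set 'rV[R]_n) phi : D `<=` E -> test_function D phi -> test_function E phi.
Proof. by move=> DE [? ? ?]; split => //; exact: subset_trans DE. Qed.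

Lemma test_partial n (D : set 'rV[R]_n) phi i : test_function D phi ->
  test_function D (partial i phi).
Proof.
move=> /test_functionP[sphi [K [cK KD K0]]]; apply/test_functionP.
split; first exact: smooth_partial.
exists K; split => // x Kx; rewrite /partial.
rewrite (@near_eq_derive _ _ _ _ (cst 0)) ?derive_cst//.
have oK : open (~` K) by apply: closed_openC; exact: compact_closed cK.
by apply: filterS (open_nbhs_nbhs (conj oK Kx)) => y /K0.
Qed.

Lemma testM n (D : set 'rV[R]_n) phi f : test_function D phi -> smooth f ->
  test_function D (fun x => f x * phi x).
Proof.
move=> /test_functionP[sphi [K [cK KD K0]]] sf; apply/test_functionP.
split; first exact: smoothM.
by exists K; split => // x /K0 ->; rewrite mulr0.
Qed.

Lemma testD n (D : set 'rV[R]_n) phi psi : test_function D phi -> test_function D psi ->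
  test_function D (fun x => phi x + psi x).
Proof.
move=> /test_functionP[sphi [K [cK KD K0]]] /test_functionP[spsi [L [cL LD L0]]].
apply/test_functionP; split; first exact: smoothD.
exists (K `|` L); split; first exact: compactU.
  by move=> x [/KD|/LD].
by move=> x /not_orP[/K0 -> /L0 ->]; rewrite addr0.
Qed.

Lemma test0 n (D : set 'rV[R]_n) : test_function D (fun=> 0).
Proof.
apply/test_functionP; split; first exact: smooth_cst.
by exists set0; split => //; exact: compact0.
Qed.

Lemma test_bounded n (D : set 'rV[R]_n) phi : test_function D phi ->
  exists2 M : R, 0 < M & forall x, `|phi x| <= M.
Proof.
move=> /test_functionP[sphi [K [cK KD K0]]].
have cphi : {within K, continuous phi}.
  by apply: continuous_subspaceT; exact: smooth_continuous.
have [M [Mr HM]] := compact_bounded (continuous_compact cphi cK).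
have M1 : M < `|M| + 1 by rewrite (le_lt_trans (ler_norm _))// ltrDl.
exists (`|M| + 1) => [|x]; first by rewrite ltr_wpDl.
have [Kx|Kx] := pselect (K x); last by rewrite K0// normr0 addr_ge0.
by apply: (HM _ M1); exists x.
Qed.

Lemma test_measurable n (D : set 'rV[R]_n) phi : test_function D phi ->
  measurable_fun setT phi.
Proof. by move=> [sphi _ _]; apply: continuous_measurable_rV; exact: smooth_continuous. Qed.

Lemma compact_measurable_rV n (K : set 'rV[R]_n) : compact K -> measurable K.
Proof.
move=> cK; rewrite -[K]setCK; apply: measurableC; apply: open_measurable_rV.
by apply: closed_openC; exact: compact_closed cK.
Qed.

Lemma smooth_compact_integrable n (K : set 'rV[R]_n) f : compact K ->
  continuous f -> (lebesgue_rV n).-integrable K (EFin \o f).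
Proof.
move=> cK cf; apply: measurable_bounded_integrable.
- exact: compact_measurable_rV.
- apply: lebesgue_rV_bounded; first exact: compact_measurable_rV.
  exact: compact_bounded.
- by apply: measurable_funTS; exact: continuous_measurable_rV.
- have := compact_bounded (continuous_compact (continuous_subspaceT cf) cK).
  by move=> [M [Mr HM]]; exists M; split => // N MN x Kx; apply: (HM _ MN); exists x.
Qed.

Lemma test_integrable n (D E : set 'rV[R]_n) phi : measurable E -> test_function D phi ->
  (lebesgue_rV n).-integrable E (EFin \o phi).
Proof.
move=> mE /test_functionP[sphi [K [cK KD K0]]].
apply: (integrableS measurableT) => //.
have /(integrable_mkcond _ (compact_measurable_rV cK)).1 :=
  smooth_compact_integrable cK (smooth_continuous sphi).
apply: eq_integrable => // x _; rewrite patchE /=.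
by case: ifPn => //; rewrite notin_setE => /K0 ->.
Qed.

Lemma test_L2 n (D E : set 'rV[R]_n) phi : measurable E -> test_function D phi ->
  L2 E phi.
Proof.
move=> mE tphi; split; first by apply: measurable_funTS; exact: test_measurable tphi.
have := test_integrable mE (testM tphi (test_smooth tphi)).
by apply: eq_integrable => // x _; rewrite /= expr2.
Qed.

Lemma test_tens n (A : set R) (E : set 'rV[R]_n) (K : set R) p h : smooth1 p ->
  compact K -> K `<=` A -> (forall t, ~ K t -> p t = 0) ->
  test_function E h -> test_function (rV_prod A E) (tens p h).
Proof.
move=> sp cK KA K0 /test_functionP[sh [L [cL LE L0]]]; apply/test_functionP.
split; first exact: smooth_tens.
pose f (z : R * 'rV[R]_n) : 'rV[R]_n.+1 := rV_cons (z.1 : measurableTypeR R, z.2).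
exists (rV_prod K L); split.
(* Compactness: [rV_prod K L] is the image of the product of two compact sets under the continuous
   map [rV_cons]. *)
- have -> : rV_prod K L = f @` (K `*` L).
    apply/seteqP; split=> [x [/= Kx Lx]|_ [[t y] [/= Kt Ly] <-]].
      exists (x ord0 ord0, rV_tail x) => //; exact: rV_cons_tail.
    by split; rewrite /f ?rV_cons0 ?rV_tail_cons.
  apply: continuous_compact; last exact: compact_setX.
  apply: continuous_subspaceT => z.
  have -> : f = (fun z => z.1 *: delta_mx ord0 ord0 + rV_cons (0 : measurableTypeR R, z.2)).
    apply/funext => -[t y]; rewrite /f /=; have := rV_cons_addl 0 t 1 y.
    by rewrite scale1r mulr1 addr0.
  apply: (@cvgD _ _ _ _ _ (fun z : R * 'rV[R]_n => z.1 *: delta_mx ord0 ord0)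
    (fun z => rV_cons (0 : measurableTypeR R, z.2))).
    by apply: cvgZr_tmp; exact: cvg_fst.
  apply: (@continuous_comp _ _ _ snd (fun y => rV_cons (0 : measurableTypeR R, y))).
    exact: cvg_snd.
  exact/differentiable_continuous/differentiable_cons.
- by move=> x [/KA ? /LE ?].
- move=> x /not_andP[/K0|/L0]; rewrite /tens => ->; by rewrite ?mul0r ?mulr0.
Qed.

Lemma continuous_tail n : continuous (@rV_tail R n).
Proof. by move=> x; apply: differentiable_continuous; exact: differentiable_tail. Qed.

Lemma test_slice n (A : set R) (E : set 'rV[R]_n) phi t :
  test_function (rV_prod A E) phi ->
  test_function E (fun y => phi (rV_cons (t : measurableTypeR R, y))).
Proof.
move=> /test_functionP[sphi [K [cK KD K0]]]; apply/test_functionP.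
split; first exact: smooth_slice.
exists (@rV_tail R n @` K); split.
- by apply: continuous_compact => //; apply: continuous_subspaceT; exact: continuous_tail.
- by move=> _ [x /KD[_ Ex] <-].
- move=> y Ky; apply: K0 => K0; apply: Ky.
  by exists (rV_cons (t : measurableTypeR R, y)) => //; rewrite rV_tail_cons.
Qed.

(** The projection of the support on the first axis gives one compact set that is valid for all
    lines at once. *)
Lemma test_line n (A : set R) (E : set 'rV[R]_n) phi :
  test_function (rV_prod A E) phi ->
  exists K : set R, [/\ compact K, K `<=` A &
    forall t y, ~ K t -> phi (rV_cons (t : measurableTypeR R, y)) = 0].
Proof.
move=> /test_functionP[sphi [K [cK KD K0]]].
exists ((fun x : 'rV[R]_n.+1 => x ord0 ord0) @` K); split.
- by apply: continuous_compact => //; apply: continuous_subspaceT; exact: coord_continuous.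
- by move=> _ [x /KD[Ax _] <-].
- move=> t y Ky; apply: K0 => K0; apply: Ky.
  by exists (rV_cons (t : measurableTypeR R, y)) => //; rewrite rV_cons0.
Qed.

Lemma FTC2_smooth1 q (a b : R) : a < b -> smooth1 q ->
  \int[mu]_(t in `[a, b]) derive1 q t = q b - q a.
Proof.
move=> ab sq; rewrite /Rintegral (@continuous_FTC2 _ _ q a b)//.
- by apply: continuous_subspaceT; apply: smooth1_continuous; exact: smooth1_derive.
- split=> [x _||]; first exact: smooth1_derivable.
    by apply: cvg_at_right_filter; exact: smooth1_continuous.
  by apply: cvg_at_left_filter; exact: smooth1_continuous.
Qed.

Lemma continuous_integrable_itv (f : R -> R) (a b : R) : continuous f ->
  mu.-integrable `[a, b] (EFin \o f).
Proof.
move=> cf; apply: continuous_compact_integrable; first exact: segment_compact.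
exact: continuous_subspaceT.
Qed.

Lemma Rintegral_oo_cc (f : R -> R) (a b : R) : continuous f ->
  \int[mu]_(t in `]a, b[) f t = \int[mu]_(t in `[a, b]) f t.
Proof.
move=> cf; have fi := continuous_integrable_itv a b cf.
rewrite Rintegral_itv_bndo_bndc; last first.
  by apply: integrableS fi => //; apply: subset_itv_oo_cc.
rewrite Rintegral_itv_obnd_cbnd//.
by apply: integrableS fi => //; apply: subset_itv_oc_cc.
Qed.

Lemma integral_derive1_test q (a b : R) (K : set R) : a < b -> smooth1 q ->
  K `<=` `]a, b[%classic -> (forall t, ~ K t -> q t = 0) ->
  \int[mu]_(t in `]a, b[) derive1 q t = 0.
Proof.
move=> ab sq Kab K0; rewrite Rintegral_oo_cc; last first.
  by apply: smooth1_continuous; exact: smooth1_derive.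
rewrite FTC2_smooth1// !K0 ?subrr// => /Kab; rewrite /= in_itv/= ltxx ?andbF//.
Qed.

Lemma rV_prodTT n : rV_prod [set: R] [set: 'rV[R]_n] = setT.
Proof. by apply/seteqP; split. Qed.

Lemma Rintegral_out d (T : measurableType d) (m : {measure set T -> \bar R})
    (E : set T) (f : T -> R) : (forall x, ~ E x -> f x = 0) ->
  \int[m]_x f x = \int[m]_(x in E) f x.
Proof.
move=> f0; rewrite [RHS]Rintegral_mkcond; apply: eq_Rintegral => x _.
by rewrite patchE; case: ifPn => //; rewrite notin_setE => /f0.
Qed.

(** Induction on the dimension by Fubini. A derivative in a tail direction is one of a slice and
    falls under the induction hypothesis; a derivative in the first direction is integrated along
    lines by the fundamental theorem of calculus. *)
Lemma integral_partial_testT n (i : 'I_n) (phi : 'rV[R]_n -> R) :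
  test_function setT phi -> \int[lebesgue_rV n]_x partial i phi x = 0.
Proof.
elim: n i phi => [[]//|n IH] i phi tphi.
have ti := test_integrable measurableT (test_partial i tphi).
have [j ij|i0] := unliftP ord0 i.
  rewrite -rV_prodTT in tphi ti *.
  rewrite Rintegral_rV_prod// (@eq_Rintegral _ _ _ _ _ (fun=> 0)).
    by rewrite Rintegral_cst ?mul0r.
  by move=> t _ /=; rewrite -[RHS](IH j _ (test_slice t tphi)) partial_slice ij.
have tphi' : test_function (rV_prod [set: R] setT) phi by rewrite rV_prodTT.
have [K [cK _ K0]] := test_line tphi'.
have [M [Mr HM]] := compact_bounded cK.
(* The compact set lies in |t| <= L, hence in the open interval of half-length L + 1, at whose ends
   the line function vanishes. *)
pose L := `|M| + 1; have L0 : 0 < L by rewrite ltr_wpDl.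
have ML : M < L by rewrite (le_lt_trans (ler_norm _))// ltrDl.
have KL : K `<=` `](- (L + 1)), L + 1[%classic.
  by move=> t /(HM _ ML); rewrite /= in_itv/= -ltr_norml => /le_lt_trans; apply; rewrite ltrDl.
transitivity (\int[lebesgue_rV n.+1]_(x in rV_prod `](- (L + 1)), L + 1[%classic setT)
    partial i phi x).
  apply: Rintegral_out => x Lx.
  have <- : derive1 (fun t => phi (rV_cons (t : measurableTypeR R, rV_tail x))) (x ord0 ord0) = partial i phi x.
    by rewrite derive1_line rV_cons_tail i0.
  rewrite derive1E.
  rewrite (@near_eq_derive _ _ _ _ (cst 0)) ?derive_cst//.
  have oK : open (~` K) by apply: closed_openC; exact: compact_closed cK.
  have nKx : (~` K) (x ord0 ord0) by move=> /KL ?; apply: Lx.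
  by apply: filterS (open_nbhs_nbhs (conj oK nKx)) => t Kt; exact: K0.
rewrite Rintegral_rV_prod_swap//; last by apply: integrableS ti => //; exact: measurable_rV_prod.
rewrite (@eq_Rintegral _ _ _ _ _ (fun=> 0)).
  by rewrite Rintegral_cst ?mul0r.
move=> y _; rewrite i0.
have := @integral_derive1_test (fun t => phi (rV_cons (t : measurableTypeR R, y)))
  (- (L + 1)) (L + 1) K.
rewrite derive1_line; apply => //.
- by rewrite gtrN// addr_gt0.
- by apply: smooth1_line; exact: test_smooth tphi.
- by move=> t; exact: K0.
Qed.

Lemma integral_partial_test n (D : set 'rV[R]_n) (i : 'I_n) (phi : 'rV[R]_n -> R) :
  test_function D phi -> \int[lebesgue_rV n]_(x in D) partial i phi x = 0.
Proof.
move=> tphi; transitivity (\int[lebesgue_rV n]_x partial i phi x).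
  by apply/esym/Rintegral_out => x Dx; exact: test_out (test_partial i tphi) Dx.
by apply: integral_partial_testT; exact: test_sub tphi.
Qed.

(** The product f phi is a test function, and the integral of its partial derivative is 0. *)
Lemma smooth_weak_partial n (D : set 'rV[R]_n) (i : 'I_n) (f : 'rV[R]_n -> R) :
  measurable D -> smooth f -> weak_partial D i f (partial i f).
Proof.
move=> mD sf phi tphi; apply/eqP; rewrite -addr_eq0; apply/eqP.
rewrite -RintegralD//.
- rewrite -[RHS](integral_partial_test i (testM tphi sf)); apply: eq_Rintegral => x _.
  by rewrite partialM//; apply: smooth_diff => //; exact: test_smooth tphi.
- exact: test_integrable mD (testM (test_partial i tphi) sf).
- exact: test_integrable mD (testM tphi (smooth_partial i sf)).
Qed.

Lemma test_sobolevH1 n (D : set 'rV[R]_n) phi : measurable D -> test_function D phi ->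
  sobolevH1 D phi.
Proof.
move=> mD tphi; split; first exact: test_L2 tphi.
move=> i; exists (partial i phi); split.
  exact: test_L2 (test_partial i tphi).
by apply: smooth_weak_partial => //; exact: test_smooth tphi.
Qed.

End test_functions.

(** * The fundamental lemma of the calculus of variations *)

Section bump.
Context {R : realType}.

Lemma horner_le (p : {poly R}) (s : R) : 1 <= s ->
  `|p.[s]| <= (\sum_(i < size p) `|p`_i|) * s ^+ size p.
Proof.
move=> s1; rewrite horner_coef (le_trans (ler_norm_sum _ _ _))// mulr_suml.
apply: ler_sum => i _; rewrite normrM ler_wpM2l// ger0_norm; last first.
  by rewrite exprn_ge0// (le_trans _ s1).
by apply: ler_weXn2l => //; exact: ltnW.
Qed.

(* The functions p(1/t) exp(-1/t), extended by 0, form a class stable under derivation. *)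
Definition flat (p : {poly R}) (t : R) : R :=
  if 0 < t then p.[t^-1] * expR (- t^-1) else 0.

Lemma flat_le0 p t : t <= 0 -> flat p t = 0.
Proof. by rewrite /flat; case: ltP. Qed.

(** The exponential series gives exp(-s) <= k! / s^k at s = 1/t, which beats the polynomial growth
    of p(s). The quadratic rate is what makes the derivative at 0 vanish. *)
Lemma flat_le (p : {poly R}) : exists2 C, 0 <= C &
  forall t, `|t| <= 1 -> `|flat p t| <= C * t ^+ 2.
Proof.
(* The exponent d + 1 exceeds [size p] by 2: after cancelling s^([size p]), the factor t^2
   remains. *)
pose d := (size p).+1.
pose A : R := \sum_(i < size p) `|p`_i|.
have A0 : 0 <= A by exact: sumr_ge0.
exists (A * (d.+1)`!%:R) => [|t t1]; first by rewrite mulr_ge0.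
rewrite /flat; case: ltP => [t0|_]; last by rewrite normr0 mulr_ge0 ?sqr_ge0// mulr_ge0.
have s1 : 1 <= t^-1 by rewrite invf_ge1// (le_trans (ler_norm _) t1).
have s0 : 0 <= t^-1 by rewrite invr_ge0 ltW.
rewrite normrM (ger0_norm (expR_ge0 _)) expRN.
have ed : (t^-1) ^+ d.+1 / (d.+1)`!%:R <= expR t^-1.
  by apply: le_trans (expR_ge1Dxn d s0); rewrite lerDr.
have t'0 : 0 < t^-1 by rewrite invr_gt0.
have f0 : 0 < (d.+1)`!%:R :> R by rewrite ltr0n fact_gt0.
have dp : 0 < (t^-1) ^+ d.+1 / (d.+1)`!%:R by rewrite divr_gt0// exprn_gt0.
apply: le_trans (_ : A * (t^-1) ^+ size p * ((t^-1) ^+ d.+1 / (d.+1)`!%:R)^-1 <= _).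
  apply: ler_pM; [exact: normr_ge0|by rewrite invr_ge0 expR_ge0|exact: horner_le|].
  by rewrite lef_pV2// posrE ?expR_gt0.
rewrite invf_div /d -(addn2 (size p)) exprD !exprVn -!mulrA ler_wpM2l//.
rewrite invfM !invrK mulrCA ler_wpM2l//.
by rewrite mulKf// expf_neq0// lt0r_neq0.
Qed.

(** For t > 0 the derivative of p(1/t) exp(-1/t) is t^(-2) (p - p')(1/t) exp(-1/t). At 0 the
    difference quotient is O(t) by [flat_le], and the right-hand side is 0 there by convention. *)
Lemma flat_derive (p : {poly R}) t :
  is_derive t (1 : R) (flat p) (flat (('X ^+ 2) * (p - p^`()%R)) t).
Proof.
have [t0|t0|->] := ltgtP t 0.
- rewrite flat_le0; last exact: ltW.
  apply: (@near_eq_is_derive _ _ _ (cst 0)).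
    near=> y; rewrite flat_le0//; apply: ltW; near: y; exact: lt_nbhsl.
- pose f (t : R) : R := p.[t^-1] * expR (- t^-1).
  apply: (@near_eq_is_derive _ _ _ f).
    near=> y; rewrite /flat ifT//; near: y; exact: lt_nbhsr.
  have tn0 : t != 0 by rewrite gt_eqF.
  have dV : is_derive t (1 : R) (fun t : R => t^-1) (- t ^- 2).
    split; first exact: (@derivableV _ _ (@id R)).
    by rewrite (@deriveV _ _ (@id R))// derive_id /GRing.scale/= mulr1.
  have dp : is_derive t (1 : R) (fun t => p.[t^-1]) (- t ^- 2 * (p^`()%R).[t^-1]).
    have := @is_derive1_comp _ (horner p) (fun t : R => t^-1) t (p^`()%R).[t^-1] (- t ^- 2) _ dV.
    rewrite mulrC; apply.
  have de : is_derive t (1 : R) (fun t => expR (- t^-1)) (t ^- 2 * expR (- t^-1)).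
    have dN := is_deriveN dV.
    have := @is_derive1_comp _ expR (- (fun t : R => t^-1)) t _ _ (is_derive_expR _) dN.
    by rewrite mulrC opprK.
  have := is_deriveM dp de.
  rewrite /flat t0 /GRing.scale /= hornerM hornerXn hornerD hornerN.
  move=> h; apply: is_derive_eq h _; rewrite exprVn; ring.
- rewrite flat_le0//.
  have [C C0 HC] := flat_le p.
  have H : h^-1 *: (flat p (h *: 1 + 0) - flat p 0) @[h --> (0 : R)^'] --> (0 : R).
    apply/cvgrPdist_le => e e0; near=> h.
    rewrite (flat_le0 p (lexx 0)) subr0 addr0 sub0r normrN /GRing.scale/= mulr1.
    have h0 : h != 0 by near: h; exact: nbhs_dnbhs_neq.
    have h1 : `|h| <= 1.
      by near: h; apply: cvg_within; exact: (@nbhs0_le _ R).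
    rewrite normrM normfV ler_pdivrMl ?normr_gt0//.
    apply: (le_trans (HC _ h1)).
    rewrite -(real_normK (num_real h)) expr2 mulrCA ler_wpM2l//.
    apply: (@le_trans _ _ ((C + 1) * `|h|)); first by rewrite ler_wpM2r// lerDl.
    rewrite -ler_pdivlMl ?ltr_wpDl//.
    near: h; apply: cvg_within; apply: (@nbhs0_le _ R).
    by rewrite mulr_gt0// invr_gt0 ltr_wpDl.
  by split; [apply/cvg_ex; exists 0|exact: cvg_lim H].
Unshelve. all: by end_near.
Qed.

Lemma smooth1_flat p : smooth1 (flat p).
Proof.
apply: (@smooth1_coind _ (fun f => exists p, f = flat p)); last by exists p.
move=> _ [{}p ->]; split=> [x|]; first by have [] := flat_derive p x.
exists (('X ^+ 2) * (p - p^`()%R)); apply/funext => x.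
by rewrite derive1E; have [_] := flat_derive p x.
Qed.

(** The function exp(-1/t), extended by 0. It has no plateau and only tends to 1 at infinity;
    accordingly the cutoffs below rescale its argument by a factor k that tends to infinity. *)
Definition theta : R -> R := flat 1.

Lemma thetaE t : theta t = if 0 < t then expR (- t^-1) else 0.
Proof. by rewrite /theta /flat hornerC; case: ifP; rewrite ?mul1r. Qed.

Lemma theta_ge0 t : 0 <= theta t.
Proof. by rewrite thetaE; case: ifP => // _; exact: expR_ge0. Qed.

Lemma theta_le1 t : theta t <= 1.
Proof.
rewrite thetaE; case: ifPn => // t0.
by rewrite -expR0 ler_expR oppr_le0 invr_ge0 ltW.
Qed.

Lemma theta_le0 t : t <= 0 -> theta t = 0.
Proof. exact: flat_le0. Qed.

Lemma smooth1_theta : smooth1 theta.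
Proof. exact: smooth1_flat. Qed.

Lemma cvg_theta_natmul t : 0 < t -> theta (k%:R * t) @[k --> \oo] --> (1 : R).
Proof.
move=> t0; rewrite -cvg_shiftS /=.
have -> : (fun k : nat => theta (k.+1%:R * t)) = fun k => expR (- (harmonic k * t^-1)).
  apply/funext => k; rewrite thetaE mulr_gt0// ?ltr0n// invfM.
  by rewrite /harmonic.
rewrite -expR0; apply: continuous_cvg; first exact: continuous_expR.
rewrite -oppr0 -(mul0r t^-1); apply: cvgN; apply: cvgM; [exact: cvg_harmonic|exact: cvg_cst].
Qed.

Section box_bump.
Variables (n : nat) (a b : 'rV[R]_n).

(** Smooth approximation of the indicator function of the open box, to which it converges pointwise
    as k tends to infinity. *)
Definition box_bump (k : nat) (x : 'rV[R]_n) : R :=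
  \prod_(i < n) (theta (k%:R * (x ord0 i - a ord0 i)) *
                 theta (k%:R * (b ord0 i - x ord0 i))).

Lemma smooth_box_bump k : smooth (box_bump k).
Proof.
apply: smooth_prod => i; apply: smoothM.
  apply: (@smooth_coord _ _ (fun t => theta (k%:R * (t - a ord0 i)))).
  apply: (@smooth1_comp _ (fun t => k%:R * (t - a ord0 i))); last exact: smooth1_theta.
  by apply: smooth1Z; apply: smooth1D; [exact: smooth1_id|exact: smooth1_cst].
apply: (@smooth_coord _ _ (fun t => theta (k%:R * (b ord0 i - t)))).
apply: (@smooth1_comp _ (fun t => k%:R * (b ord0 i - t))); last exact: smooth1_theta.
apply: smooth1Z; apply: smooth1D; first exact: smooth1_cst.
rewrite (_ : -%R = fun t : R => -1 * t); last by apply/funext => t; rewrite mulN1r.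
by apply: smooth1Z; exact: smooth1_id.
Qed.

Lemma box_bump_ge0_le1 k x : 0 <= box_bump k x <= 1.
Proof.
apply: (big_ind (fun z : R => 0 <= z <= 1)); first by rewrite ler01 lexx.
  by move=> u v /andP[? ?] /andP[? ?]; rewrite mulr_ge0//= mulr_ile1.
by move=> i _; rewrite mulr_ge0 ?theta_ge0//= mulr_ile1 ?theta_ge0 ?theta_le1.
Qed.

Lemma box_bump_out k x : ~ box a b x -> box_bump k x = 0.
Proof.
move=> /existsNP[i] /negP; rewrite negb_and -!leNgt => H.
rewrite /box_bump (bigD1 i)//=; case/orP: H => H.
  by rewrite theta_le0 ?mul0r// mulr_ge0_le0// subr_le0.
by rewrite (@theta_le0 (_ * (b _ _ - _))) ?mulr0 ?mul0r// mulr_ge0_le0// subr_le0.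
Qed.

Lemma cvg_box_bump x : box a b x -> box_bump k x @[k --> \oo] --> (1 : R).
Proof.
move=> abx; have -> : (1 : R) = \prod_(i < n) 1 by rewrite big1.
rewrite /box_bump; apply: cvg_big => [|i _]; first exact: mul_continuous.
have /andP[ax xb] := abx i.
rewrite -subr_gt0 in ax; rewrite -subr_gt0 in xb.
by have := cvgM (cvg_theta_natmul ax) (cvg_theta_natmul xb); rewrite mulr1; exact.
Qed.

End box_bump.

End bump.

Section fundamental_lemma.
Context {R : realType} (n : nat).
Notation nu := (@lebesgue_rV R n).
Implicit Types (D : set 'rV[R]_n) (g : 'rV[R]_n -> R).

(** A generating pi-system, as the next three lemmas show, so that Dynkin's theorem applies. *)
Definition boxes : set (set 'rV[R]_n) := [set B | exists a b, B = box a b].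

Lemma setI_closed_boxes : setI_closed boxes.
Proof.
move=> _ _ [a [b ->]] [c [d ->]].
exists (\row_i Num.max (a ord0 i) (c ord0 i)), (\row_i Num.min (b ord0 i) (d ord0 i)).
apply/seteqP; split=> [x [H1 H2] i|x H].
  rewrite !mxE gt_max lt_min; have /andP[-> ->] := H1 i.
  by have /andP[-> ->] := H2 i.
by split=> i; have := H i; rewrite !mxE gt_max lt_min => /andP[/andP[? ?] /andP[? ?]]; apply/andP.
Qed.

Lemma coord_gt_boxes (i : 'I_n) (c : R) :
  [set x : 'rV[R]_n | c < x ord0 i] =
  \bigcup_(N : nat) box (\row_j if j == i then c else - N%:R) (const_mx N%:R).
Proof.
apply/seteqP; split=> [x /= cx|x [N _ /(_ i)]]; last first.
  by rewrite !mxE eqxx => /andP[].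
exists (Num.truncn `|x|).+1 => //= j; rewrite !mxE.
have xj : `|x ord0 j| <= `|x|.
  have -> : `|x| = mx_norm x by [].
  by rewrite mx_normrE; apply: le_trans (le_bigmax _ _ (ord0, j)).
have xN : `|x ord0 j| < (Num.truncn `|x|).+1%:R.
  by apply: (le_lt_trans xj); exact: truncnS_gt.
have := ltr_normlW xN; rewrite ltr_norml in xN; case/andP: xN => x1 x2 _.
by rewrite x2 andbT; case: eqVneq => [->|].
Qed.

Lemma measurable_boxesE : @measurable _ 'rV[R]_n = <<s boxes >>.
Proof.
apply/seteqP; split; last first.
  apply: smallest_sub; first exact: sigma_algebra_measurable.
  by move=> _ [a [b ->]]; exact: measurable_box.
apply: smallest_sub; first exact: smallest_sigma_algebra.
move=> A; rewrite -bigcup_seq/= => -[i _ [C mC <-]]; rewrite setTI.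
have mi : measurable_fun [set: g_sigma_algebraType boxes]
    (fun x : g_sigma_algebraType boxes => (x : 'rV[R]_n) ord0 i).
  apply: (measurability _ (RGenOInfty.measurableE R)).
  move=> _ [_ [c ->] <-]; rewrite setTI.
  rewrite (_ : _ @^-1` _ = [set x : 'rV[R]_n | c < x ord0 i]); last first.
    by apply/seteqP; split=> x /=; rewrite in_itv/= andbT.
  rewrite coord_gt_boxes; apply: bigcupT_measurable => N.
  by apply: sub_sigma_algebra; exists (\row_j if j == i then c else - N%:R), (const_mx N%:R).
by have := mi measurableT C mC; rewrite setTI.
Qed.

(** The measurable sets [A] for which g has zero integral over the trace of [A] on [B] form a Dynkin
    class containing the boxes. The trace is taken because g is integrable on [B] only. *)
Lemma integral_boxes_eq0 (B : set 'rV[R]_n) g : boxes B ->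
  nu.-integrable B (EFin \o g) ->
  (forall B', boxes B' -> B' `<=` B -> \int[nu]_(x in B') g x = 0) ->
  {ae nu, forall x, B x -> g x = 0}.
Proof.
move=> bB ig H.
have mB : measurable B by move: bB => [a [b ->]]; exact: measurable_box.
pose P (A : set 'rV[R]_n) := (\int[nu]_(x in A `&` B) (g x)%:E = 0)%E.
have iA A : measurable A -> nu.-integrable (A `&` B) (EFin \o g).
  by move=> mA; apply: integrableS ig => //; exact: measurableI.
have RP A : measurable A -> \int[nu]_(x in A `&` B) g x = 0 -> P A.
  move=> mA; rewrite /P /Rintegral => h0.
  by rewrite -[LHS]fineK ?h0//; apply: integrable_fin_num (iA _ mA); exact: measurableI.
have PB : (\int[nu]_(x in B) (g x)%:E = 0)%E.
  by have := RP B mB; rewrite /P setIid; apply; exact: H.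
have PA A : measurable A -> P A.
  rewrite measurable_boxesE.
  apply: (@dynkin_induction _ _ boxes P).
  - exact: measurable_boxesE.
  - exact: setI_closed_boxes.
  - by rewrite /P setTI.
  - move=> B' bB'; apply: RP.
      by move: bB' => [a [b ->]]; exact: measurable_box.
    by apply: H; [exact: setI_closed_boxes|exact: subIsetr].
  - move=> S mS PS; rewrite /P.
    have : (\int[nu]_(x in B) (g x)%:E = \int[nu]_(x in S `&` B) (g x)%:E +
        \int[nu]_(x in ~` S `&` B) (g x)%:E)%E.
      rewrite -integral_setU_EFin//.
      + by rewrite -setIUl setUv setTI.
      + exact: measurableI.
      + by apply: measurableI => //; exact: measurableC.
      + by rewrite -setIUl setUv setTI; apply/measurable_EFinP; exact: measurable_int ig.
      + by apply/disj_setPS => x [[? _] []].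
    by rewrite PB PS add0e => <-.
  - move=> F mF tF PF; rewrite /P setI_bigcupl integral_bigcup.
    + by apply: eseries0 => k _ _; exact: PF.
    + by apply: trivIset_setIr.
    + by move=> k; exact: measurableI.
    + by rewrite -setI_bigcupl; apply: iA; exact: bigcup_measurable.
have : ae_eq nu B (EFin \o g) (cst 0%E).
  apply: integral_ae_eq => // E EB mE; rewrite integral0.
  by have := PA E mE; rewrite /P setIidl.
by apply: filterS => x + Bx => /(_ Bx) [].
Qed.

(** The constant 1 is square integrable on a set of finite measure. *)
Lemma L2_integrable D (K : set 'rV[R]_n) g : measurable D -> L2 D g ->
  measurable K -> (nu K < +oo)%E -> K `<=` D -> nu.-integrable K (EFin \o g).
Proof.
move=> mD [mg ig] mK Kfin KD.
have sg : sqint nu K g by split; [exact: measurable_funS mg|exact: integrableS ig].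
have s1 : sqint nu K (fun=> 1 : R).
  by apply: (@sqint_bounded _ _ _ _ _ mK _ 1) => // x _; rewrite normr1.
have := sqint_integrableM mK s1 sg.
by apply: eq_integrable => // x _ /=; rewrite mul1r.
Qed.

Lemma fundamental_lemma D g : open D -> L2 D g ->
  (forall phi, test_function D phi -> \int[nu]_(x in D) (g x * phi x) = 0) ->
  ae_zero D g.
Proof.
move=> oD L2g H; have mD := open_measurable_rV oD.
(* It suffices to treat one rational box with a compact set between it and [D]: there are countably
   many, so the exceptional null sets may be united. *)
suff Hq (q : 'rV[rat]_n * 'rV[rat]_n) :
    (exists K : set 'rV[R]_n, [/\ compact K, rat_box q `<=` K & K `<=` D]) ->
    {ae nu, forall x, rat_box q x -> g x = 0}.
  have : {ae nu, forall x, forall k : nat, forall q, unpickle k = Some q ->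
    (exists K : set 'rV[R]_n, [/\ compact K, rat_box q `<=` K & K `<=` D]) -> rat_box q x -> g x = 0}.
    apply/ae_foralln => k; case: (unpickle k) => [q|]; last by apply: aeW => x q.
    have [Kq|Kq] := pselect (exists K : set 'rV[R]_n, [/\ compact K, rat_box q `<=` K & K `<=` D]).
      by apply: filterS (Hq q Kq) => x Hx p [<-] _.
    by apply: aeW => x p [<-].
  apply: filterS => x Hx Dx.
  have [q [qx qD KK]] := rat_box_nbhs oD Dx.
  by apply: (Hx (pickle q) q) => //; rewrite pickleK.
move=> [K [cK qK KD]].
have mK := compact_measurable_rV cK.
have Kfin : (nu K < +oo)%E by apply: lebesgue_rV_bounded => //; exact: compact_bounded.
have igK := L2_integrable mD L2g mK Kfin KD.
have bq : boxes (rat_box q) by exists (map_mx ratr q.1), (map_mx ratr q.2).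
have mq : measurable (rat_box q : set 'rV[R]_n) by exact: measurable_box.
apply: integral_boxes_eq0 => //; first exact: integrableS igK.
move=> _ [a [b ->]] abq.
have tb k : test_function D (box_bump a b k).
  apply/test_functionP; split; first exact: smooth_box_bump.
  exists K; split => // x Kx; apply: box_bump_out => /abq /qK //.
have mb := @measurable_box R n a b.
(* Testing against the bumps of a box gives 0 for every k; dominated convergence, with |g| as
   majorant, passes to the integral of g over the box. *)
pose gk k x := g x * box_bump a b k x.
have gk0 k : \int[nu]_(x in box a b) gk k x = 0.
  rewrite -[RHS](H _ (tb k)) Rintegral_mkcond [RHS]Rintegral_mkcond.
  apply: eq_Rintegral => x _; rewrite !patchE.
  have [/set_mem xb|] := boolP (x \in box a b).
    by rewrite mem_set//; apply: KD; apply: qK; exact: abq.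
  by rewrite notin_setE => xb; rewrite /gk box_bump_out// mulr0; case: ifP.
have igb : nu.-integrable (box a b) (EFin \o g).
  by apply: integrableS igK => // x /abq /qK.
have mgb : measurable_fun (box a b) g by apply/measurable_EFinP; exact: measurable_int igb.
have mgk k : measurable_fun (box a b) (EFin \o gk k).
  apply/measurable_EFinP/measurable_funM => //; apply: measurable_funTS.
  exact: test_measurable (tb k).
have gkg k x : (`|(gk k x)%:E| <= `|(g x)%:E|)%E.
  have /andP[h0 h1] := box_bump_ge0_le1 a b k x.
  by rewrite lee_fin normrM ler_piMr// ger0_norm.
have gk_cvg x : box a b x -> (EFin \o gk k) x @[k --> \oo] --> (EFin \o g) x.
  move=> abx; apply/fine_cvgP; split; first exact: nearW.
  by have := cvgM (cvg_cst (g x)) (cvg_box_bump abx); rewrite mulr1; exact.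
have [_ _] := dominated_convergence mb mgk (measurable_int _ igb)
  (aeW _ gk_cvg) (integrable_abse igb) (aeW _ (fun x k _ => gkg k x)).
have -> : [sequence (\int[nu]_(x in box a b) (EFin \o gk k) x)%E]_k = cst 0%E.
  apply/funext => k; rewrite /= -[LHS]fineK.
    by congr EFin; exact: gk0.
  apply: integrable_fin_num => //.
  exact: (le_integrable mb (mgk k) (fun x _ => gkg k x) igb).
by move=> /(cvg_unique _ (cvg_cst 0%E)) => g0; rewrite /Rintegral -g0.
Qed.

End fundamental_lemma.

(** * The spaces H^1 and H^1_0 *)

Lemma Rintegral_sum d (T : measurableType d) (R : realType)
    (m : {measure set T -> \bar R}) (D : set T) I (r : seq I) (F : I -> T -> R) :
  measurable D -> (forall i, m.-integrable D (EFin \o F i)) ->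
  \int[m]_(x in D) (\sum_(i <- r) F i x) = \sum_(i <- r) \int[m]_(x in D) F i x.
Proof.
move=> mD iF.
have iS (s : seq I) : m.-integrable D (EFin \o (fun x => \sum_(i <- s) F i x)).
  have := @integrable_sum _ _ _ m D mD I s xpredT (fun i => EFin \o F i) (fun i _ => iF i).
  by apply: eq_integrable => // x _; rewrite /= sumEFin.
elim: r => [|i r IH].
  rewrite big_nil (@eq_Rintegral _ _ _ _ _ (fun=> 0)) ?Rintegral_cst ?mul0r//.
  by move=> x _; rewrite big_nil.
rewrite big_cons -IH -RintegralD//.
by apply: eq_Rintegral => x _; rewrite big_cons.
Qed.

Section H1_calculus.
Context {R : realType} (n : nat) (D : set 'rV[R]_n).
Hypothesis oD : open D.
Notation nu := (@lebesgue_rV R n).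
Notation ip := (ip nu D).
Implicit Types (u v w g : 'rV[R]_n -> R).

Definition wpart u (i : 'I_n) : 'rV[R]_n -> R := fun x => wgrad D u x ord0 i.

Definition dform u v : R := \int[nu]_(x in D) dotv (wgrad D u x) (wgrad D v x).

Let mD : measurable D := open_measurable_rV oD.

Lemma weak_partial_unique i u g g' : L2 D g -> L2 D g' ->
  weak_partial D i u g -> weak_partial D i u g' ->
  {ae nu, forall x, D x -> g x = g' x}.
Proof.
move=> Lg Lg' wg wg'.
have : ae_zero D (fun x => g x - g' x).
  apply: fundamental_lemma => //; first exact: (sqintB mD Lg Lg').
  move=> phi tphi; have Lphi := test_L2 mD tphi.
  transitivity (\int[nu]_(x in D) (g x * phi x - g' x * phi x)).
    by apply: eq_Rintegral => x _; rewrite mulrBl.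
  rewrite RintegralB//; try exact: (sqint_integrableM mD _ Lphi).
  by rewrite -[X in X - _]opprK -wg// -[X in _ - X]opprK -wg'// subrr.
by apply: filterS => x H /H /eqP; rewrite subr_eq0 => /eqP.
Qed.

Lemma H1_L2 u : sobolevH1 D u -> L2 D u.
Proof. by case. Qed.

(** [xget] returns a member of its set as soon as there is one, and membership in H^1 provides
    it. *)
Lemma wpartP u i : sobolevH1 D u -> L2 D (wpart u i) /\ weak_partial D i u (wpart u i).
Proof.
move=> [_ /(_ i)[g Hg]]; rewrite /wpart.
rewrite (_ : (fun x => _) = xget (fun=> 0) [set g | L2 D g /\ weak_partial D i u g]).
  exact: (@xgetPex _ (fun=> 0) [set g | L2 D g /\ weak_partial D i u g] (ex_intro _ g Hg)).
by apply/funext => x; rewrite /wgrad mxE.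
Qed.

Lemma wpart_L2 u i : sobolevH1 D u -> L2 D (wpart u i).
Proof. by move=> /(wpartP i)[]. Qed.

Lemma wpart_unique u i g : sobolevH1 D u -> L2 D g -> weak_partial D i u g ->
  {ae nu, forall x, D x -> wpart u i x = g x}.
Proof. by move=> /(wpartP i)[Lw ww] Lg wg; exact: (weak_partial_unique Lw Lg ww wg). Qed.

Lemma weak_partialD i u v g h : L2 D u -> L2 D v -> L2 D g -> L2 D h ->
  weak_partial D i u g -> weak_partial D i v h ->
  weak_partial D i (fun x => u x + v x) (fun x => g x + h x).
Proof.
move=> Lu Lv Lg Lh wg wh phi tphi; have Lphi := test_L2 mD tphi.
have Ldphi := test_L2 mD (test_partial i tphi).
by have := ipDl mD Lu Lv Ldphi; have := ipDl mD Lg Lh Lphi;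
  rewrite /ip => -> ->; rewrite wg// wh// opprD.
Qed.

Lemma weak_partialZ i c u g : L2 D u -> L2 D g ->
  weak_partial D i u g -> weak_partial D i (fun x => c * u x) (fun x => c * g x).
Proof.
move=> Lu Lg wg phi tphi; have Lphi := test_L2 mD tphi.
have Ldphi := test_L2 mD (test_partial i tphi).
by have := ipZl mD c Lu Ldphi; have := ipZl mD c Lg Lphi;
  rewrite /ip => -> ->; rewrite wg// mulrN.
Qed.

Lemma H1D u v : sobolevH1 D u -> sobolevH1 D v -> sobolevH1 D (fun x => u x + v x).
Proof.
move=> Hu Hv; split; first exact: (sqintD mD (H1_L2 Hu) (H1_L2 Hv)).
move=> i; have [Lu wu] := wpartP i Hu; have [Lv wv] := wpartP i Hv.
exists (fun x => wpart u i x + wpart v i x); split; first exact: (sqintD mD).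
exact: weak_partialD (H1_L2 Hu) (H1_L2 Hv) Lu Lv wu wv.
Qed.

Lemma H1Z c u : sobolevH1 D u -> sobolevH1 D (fun x => c * u x).
Proof.
move=> Hu; split; first exact: (sqintZ mD c (H1_L2 Hu)).
move=> i; have [Lu wu] := wpartP i Hu.
exists (fun x => c * wpart u i x); split; first exact: (sqintZ mD).
exact: weak_partialZ (H1_L2 Hu) Lu wu.
Qed.

Lemma H1B u v : sobolevH1 D u -> sobolevH1 D v -> sobolevH1 D (fun x => u x - v x).
Proof. by move=> Hu Hv; have := H1D Hu (H1Z (-1) Hv); under eq_fun do rewrite mulN1r. Qed.

Lemma wpartD u v i : sobolevH1 D u -> sobolevH1 D v ->
  {ae nu, forall x, D x -> wpart (fun x => u x + v x) i x = wpart u i x + wpart v i x}.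
Proof.
move=> Hu Hv; have [Lu wu] := wpartP i Hu; have [Lv wv] := wpartP i Hv.
apply: wpart_unique; [exact: H1D|exact: (sqintD mD)|].
exact: weak_partialD (H1_L2 Hu) (H1_L2 Hv) Lu Lv wu wv.
Qed.

Lemma wpartZ c u i : sobolevH1 D u ->
  {ae nu, forall x, D x -> wpart (fun x => c * u x) i x = c * wpart u i x}.
Proof.
move=> Hu; have [Lu wu] := wpartP i Hu.
apply: wpart_unique; [exact: H1Z|exact: (sqintZ mD)|].
exact: weak_partialZ (H1_L2 Hu) Lu wu.
Qed.

Lemma dformE u v : sobolevH1 D u -> sobolevH1 D v ->
  dform u v = \sum_i ip (wpart u i) (wpart v i).
Proof.
move=> Hu Hv; rewrite /dform /dotv Rintegral_sum// => i.
exact: (sqint_integrableM mD (wpart_L2 i Hu) (wpart_L2 i Hv)).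
Qed.

Lemma dformC u v : dform u v = dform v u.
Proof. by apply: eq_Rintegral => x _; apply: eq_bigr => i _; rewrite mulrC. Qed.

Lemma dformDl u v w : sobolevH1 D u -> sobolevH1 D v -> sobolevH1 D w ->
  dform (fun x => u x + v x) w = dform u w + dform v w.
Proof.
move=> Hu Hv Hw; have Huv := H1D Hu Hv; rewrite !dformE// -big_split/=.
apply: eq_bigr => i _.
have [Lu _] := wpartP i Hu; have [Lv _] := wpartP i Hv.
have [Luv _] := wpartP i Huv; have [Lw _] := wpartP i Hw.
rewrite -(ipDl mD Lu Lv Lw); apply: (ae_eq_ip mD Luv.1 _ Lw.1).
  exact: measurable_funD Lu.1 Lv.1.
exact: wpartD.
Qed.

Lemma dformZl c u w : sobolevH1 D u -> sobolevH1 D w ->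
  dform (fun x => c * u x) w = c * dform u w.
Proof.
move=> Hu Hw; have Hcu := H1Z c Hu; rewrite !dformE// mulr_sumr.
apply: eq_bigr => i _.
have [Lu _] := wpartP i Hu; have [Lw _] := wpartP i Hw.
have [Lcu _] := wpartP i Hcu.
rewrite -(ipZl mD c Lu Lw); apply: (ae_eq_ip mD Lcu.1 _ Lw.1).
  by apply: measurable_funM => //; exact: Lu.1.
exact: wpartZ.
Qed.

Lemma dform_ge0 u : 0 <= dform u u.
Proof.
by apply: Rintegral_ge0 => x _; apply: sumr_ge0 => i _; rewrite -expr2 sqr_ge0.
Qed.

(** A function that is 0 almost everywhere has 0 as a weak derivative. Hence null vectors of the L^2
    product lie in the kernel of the Dirichlet form, which the diagonalisation requires. *)
Lemma H1_ip0_dform0 u w : sobolevH1 D u -> sobolevH1 D w -> ip u u = 0 -> dform u w = 0.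
Proof.
move=> Hu Hw u0; have uae := ip_eq0_ae mD (H1_L2 Hu) u0.
rewrite dformE// big1// => i _.
have [Lw _] := wpartP i Hw; have [Lu _] := wpartP i Hu.
rewrite -(ip0l nu mD (wpart w i)); apply: (ae_eq_ip mD Lu.1 _ Lw.1) => //.
apply: (wpart_unique (g := fun=> 0) Hu); first exact: sqint0.
move=> phi tphi; rewrite -/(ip _ _) -/(ip (fun=> 0) _) ip0l// oppr0.
have Ldphi := test_L2 mD (test_partial i tphi).
rewrite -[RHS](ip0l nu mD (partial i phi)).
by apply: (ae_eq_ip mD _ _ Ldphi.1) => //; exact: (H1_L2 Hu).1.
Qed.

Lemma L2norm_sq u : L2norm D u ^+ 2 = ip u u.
Proof.
rewrite /L2norm sqr_sqrtr; first by apply: eq_Rintegral => x _; rewrite expr2.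
by apply: Rintegral_ge0 => x _; rewrite sqr_ge0.
Qed.

Lemma L2norm_wgrad_sq u : L2norm_field D (wgrad D u) ^+ 2 = dform u u.
Proof. by rewrite /L2norm_field sqr_sqrtr// dform_ge0. Qed.

Lemma smooth_wpart phi i : test_function D phi ->
  {ae nu, forall x, D x -> wpart phi i x = partial i phi x}.
Proof.
move=> tphi; apply: wpart_unique; first exact: test_sobolevH1.
  exact: test_L2 (test_partial i tphi).
by apply: smooth_weak_partial => //; exact: test_smooth tphi.
Qed.

(** The squared H^1 norm. Working with squares avoids roots; the triangle inequality then carries
    factors 2. *)
Definition H1sq u : R := ip u u + dform u u.

Lemma H1sq_ge0 u : 0 <= H1sq u.
Proof. by rewrite addr_ge0 ?dform_ge0 ?ip_ge0. Qed.

Lemma dform_polar u v t : sobolevH1 D u -> sobolevH1 D v ->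
  dform (fun x => u x + t * v x) (fun x => u x + t * v x) =
  dform u u + 2 * t * dform u v + t ^+ 2 * dform v v.
Proof.
move=> Hu Hv; have Htv := H1Z t Hv; have Hutv := H1D Hu Htv.
rewrite (dformDl Hu Htv Hutv) (dformZl t Hv Hutv) (dformC u) (dformC v).
rewrite (dformDl Hu Htv Hu) (dformDl Hu Htv Hv) (dformZl t Hv Hu) (dformZl t Hv Hv).
rewrite (dformC v u).
move: (dform u u) (dform u v) (dform v v) => a b c; ring.
Qed.

Lemma dform_triangle2 u v : sobolevH1 D u -> sobolevH1 D v ->
  dform (fun x => u x + v x) (fun x => u x + v x) <= 2 * dform u u + 2 * dform v v.
Proof.
move=> Hu Hv; have := dform_ge0 (fun x => u x + -1 * v x).
rewrite (dform_polar (-1) Hu Hv).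
have := dform_polar 1 Hu Hv; under eq_fun do rewrite mul1r; move=> ->.
move: (dform u u) (dform u v) (dform v v) => a b c; lra.
Qed.

Lemma H1sq_triangle u v : sobolevH1 D u -> sobolevH1 D v ->
  H1sq (fun x => u x + v x) <= 2 * H1sq u + 2 * H1sq v.
Proof.
move=> Hu Hv.
have := lerD (ip_triangle2 mD (H1_L2 Hu) (H1_L2 Hv)) (dform_triangle2 Hu Hv).
rewrite /H1sq; move: (ip u u) (ip v v) (dform u u) (dform v v) => a b c d h.
by apply: (le_trans h); lra.
Qed.

Lemma H1sqZ c u : sobolevH1 D u -> H1sq (fun x => c * u x) = c ^+ 2 * H1sq u.
Proof.
move=> Hu; have Hcu := H1Z c Hu; have Lu := H1_L2 Hu; have Lcu := H1_L2 Hcu.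
rewrite /H1sq (dformZl c Hu Hcu) dformC (dformZl c Hu Hu).
rewrite (ipZl mD c Lu Lcu) ipC (ipZl mD c Lu Lu).
by rewrite !mulrA -expr2 mulrDr.
Qed.

(** [sobolevH10] measures convergence with the classical partial derivatives of the test function;
    these agree almost everywhere with the weak ones. *)
Lemma H1sq_test u phi : sobolevH1 D u -> test_function D phi ->
  H1sq (fun x => phi x - u x) = L2norm D (fun x => phi x - u x) ^+ 2 +
    L2norm_field D (fun x => \row_i partial i phi x - wgrad D u x) ^+ 2.
Proof.
move=> Hu tphi; have Hphi := test_sobolevH1 mD tphi.
rewrite L2norm_sq /H1sq; congr (_ + _).
rewrite /L2norm_field sqr_sqrtr; last first.
  by apply: Rintegral_ge0 => x _; apply: sumr_ge0 => i _; rewrite -expr2 sqr_ge0.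
have Hpu := H1B Hphi Hu.
rewrite dformE// /dotv.
transitivity (\sum_i ip (fun x => partial i phi x - wpart u i x) (fun x => partial i phi x - wpart u i x)).
  apply: eq_bigr => i _.
  have [Lw _] := wpartP i Hpu; have [Lu _] := wpartP i Hu.
  have Lp := test_L2 mD (test_partial i tphi).
  have Lpu := sqintB mD Lp Lu.
  have e : {ae nu, forall x, D x -> wpart (fun x => phi x - u x) i x = partial i phi x - wpart u i x}.
    have h1 := smooth_wpart i tphi; have h2 := wpartZ (-1) i Hu.
    have h3 := wpartD i Hphi (H1Z (-1) Hu).
    apply: filterS3 h1 h2 h3 => x h1 h2 h3 Dx; rewrite -h1// -[in RHS]mulN1r -h2// -h3//.
    by congr wpart; apply/funext => y; rewrite mulN1r.
  rewrite (ae_eq_ip mD Lw.1 Lpu.1 Lw.1 e) ipC.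
  by rewrite (ae_eq_ip mD Lw.1 Lpu.1 Lpu.1 e).
rewrite -Rintegral_sum//; last first.
  move=> i; have [Lu _] := wpartP i Hu; have Lp := test_L2 mD (test_partial i tphi).
  have Lpu := sqintB mD Lp Lu; exact: (sqint_integrableM mD Lpu Lpu).
apply: eq_Rintegral => x _; apply: eq_bigr => i _.
have -> : (\row_i0 partial i0 phi x - wgrad D u x) ord0 i = partial i phi x - wpart u i x.
  by rewrite mxE; congr (_ + _); rewrite mxE.
by [].
Qed.

(** The sequential definition in epsilon form. For the converse the test functions are chosen at
    distances bounded by the null sequence [harmonic]. *)
Lemma H10P u : sobolevH10 D u <-> sobolevH1 D u /\
  forall e : R, 0 < e -> exists2 phi, test_function D phi & H1sq (fun x => phi x - u x) < e.
Proof.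
split=> [[Hu [phi [tphi c1 c2]]]|[Hu H]].
  split=> // e e0.
  pose A k := L2norm D (fun x => phi k x - u x).
  pose B k := L2norm_field D (fun x => \row_i partial i (phi k) x - wgrad D u x).
  have c : A k ^+ 2 + B k ^+ 2 @[k --> \oo] --> (0 : R).
    have -> : (fun k => A k ^+ 2 + B k ^+ 2) = (fun k => A k * A k + B k * B k).
      by apply/funext => k; rewrite !expr2.
    by have := cvgD (cvgM c1 c1) (cvgM c2 c2); rewrite mulr0 addr0; exact.
  have /cvgrPdist_lt/(_ _ e0)[N _ /(_ N (leqnn N))/=] := c.
  rewrite sub0r normrN -H1sq_test// ger0_norm ?H1sq_ge0// => h.
  by exists (phi N).
split=> //.
have /choice[phi Hphi] : forall k : nat, exists phi, test_function D phi /\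
    H1sq (fun x => phi x - u x) < harmonic k.
  by move=> k; have [|phi tphi hphi] := H (harmonic k); [exact: harmonic_gt0|exists phi].
exists phi.
have tphi k : test_function D (phi k) by have [] := Hphi k.
have small k := (H1sq_test Hu (tphi k)).
have sq0 (f : nat -> R) : (forall k, 0 <= f k) -> (forall k, f k ^+ 2 < harmonic k) ->
    f k @[k --> \oo] --> (0 : R).
  move=> f0 fh; apply/cvgrPdist_lt => e e0.
  have e2 : 0 < e ^+ 2 by rewrite exprn_gt0.
  have /cvgrPdist_lt/(_ _ e2) := @cvg_harmonic R.
  apply: filterS => k; rewrite !sub0r !normrN !ger0_norm ?harmonic_ge0// => hk.
  by have := lt_trans (fh k) hk; rewrite ltr_pXn2r ?nnegrE ?f0 ?ltW.
split=> //; apply: sq0 => k; try exact: sqrtr_ge0.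
  have [_] := Hphi k; rewrite small; apply: le_lt_trans; rewrite lerDl sqr_ge0//.
have [_] := Hphi k; rewrite small; apply: le_lt_trans; rewrite lerDr sqr_ge0//.
Qed.

Lemma H10_H1 u : sobolevH10 D u -> sobolevH1 D u.
Proof. by case. Qed.

Lemma test_H10 phi : test_function D phi -> sobolevH10 D phi.
Proof.
move=> tphi; apply/H10P; split; first exact: test_sobolevH1.
move=> e e0; exists phi => //.
have H0 := test_sobolevH1 mD (test0 D).
have -> : (fun x => phi x - phi x) = (fun x => 0 * phi x).
  by apply/funext => x; rewrite subrr mul0r.
by rewrite H1sqZ ?expr0n ?mul0r//; exact: test_sobolevH1.
Qed.

Lemma H10D u v : sobolevH10 D u -> sobolevH10 D v -> sobolevH10 D (fun x => u x + v x).
Proof.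
move=> /H10P[Hu Au] /H10P[Hv Av]; apply/H10P; split; first exact: H1D.
move=> e e0; have e4 : 0 < e / 4 by rewrite divr_gt0.
have [p tp hp] := Au _ e4; have [q tq hq] := Av _ e4.
exists (fun x => p x + q x); first exact: testD.
have Hp := test_sobolevH1 mD tp; have Hq := test_sobolevH1 mD tq.
have -> : (fun x => p x + q x - (u x + v x)) = (fun x => (p x - u x) + (q x - v x)).
  by apply/funext => x; ring.
apply: (le_lt_trans (H1sq_triangle (H1B Hp Hu) (H1B Hq Hv))).
by move: (H1sq _) (H1sq _) hp hq => a b ha hb; lra.
Qed.

Lemma H10Z c u : sobolevH10 D u -> sobolevH10 D (fun x => c * u x).
Proof.
move=> /H10P[Hu Au]; apply/H10P; split; first exact: H1Z.
move=> e e0; have c0 : 0 < c ^+ 2 + 1 by rewrite ltr_wpDl ?sqr_ge0.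
have [p tp hp] := Au (e / (c ^+ 2 + 1)) (divr_gt0 e0 c0).
exists (fun x => c * p x); first by apply: testM => //; exact: smooth_cst.
have -> : (fun x => c * p x - c * u x) = (fun x => c * (p x - u x)).
  by apply/funext => x; ring.
have Hp := test_sobolevH1 mD tp.
rewrite H1sqZ; last exact: H1B.
move: hp; rewrite ltr_pdivlMr// => hp; apply: le_lt_trans hp.
by rewrite mulrC ler_wpM2l ?H1sq_ge0// lerDl.
Qed.

Lemma H10B u v : sobolevH10 D u -> sobolevH10 D v -> sobolevH10 D (fun x => u x - v x).
Proof. by move=> Hu Hv; have := H10D Hu (H10Z (-1) Hv); under eq_fun do rewrite mulN1r. Qed.

Lemma H10_0 : sobolevH10 D (fun=> 0).
Proof. by apply: test_H10; exact: test0. Qed.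

Lemma H10_sum I (r : seq I) (F : I -> 'rV[R]_n -> R) :
  (forall i, sobolevH10 D (F i)) -> sobolevH10 D (fun x => \sum_(i <- r) F i x).
Proof.
move=> HF; elim: r => [|i r IH].
  by under eq_fun do rewrite big_nil; exact: H10_0.
by under eq_fun do rewrite big_cons; exact: (H10D (HF i) IH).
Qed.

End H1_calculus.

(** * Tensor products *)

Section tensor.
Context {R : realType} (n : nat) (omega : set 'rV[R]_n) (L : R).
Hypothesis oomega : open omega.
Hypothesis L0 : 0 < L.
Notation mu := (@lebesgue_measure R).
Notation nu := (@lebesgue_rV R n).
Notation I := (`]-L, L[%classic : set R).
Notation Omega := (cylinder L omega).
Implicit Types (p q : R -> R) (h k : 'rV[R]_n -> R).

Lemma cylinderE : Omega = rV_prod I omega.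
Proof. by apply/seteqP; split=> x [/= h1 h2]; split => //; move: h1; rewrite /= in_itv. Qed.

Lemma open_cylinder : open Omega.
Proof.
rewrite cylinderE.
have -> : rV_prod I omega = (fun x : 'rV[R]_n.+1 => x ord0 ord0) @^-1` I `&` @rV_tail R n @^-1` omega.
  by [].
apply: openI.
  by apply: open_comp => [x _|]; [exact: coord_continuous|exact: interval_open].
by apply: open_comp => // x _; exact: continuous_tail.
Qed.

Let mI : measurable (I : set (measurableTypeR R)) := measurable_itv _.
Let mo : measurable omega := open_measurable_rV oomega.
Let mO : measurable Omega := open_measurable_rV open_cylinder.

Lemma continuous_integrable_oo p : continuous p -> mu.-integrable I (EFin \o p).
Proof.
move=> cp; have := continuous_integrable_itv (- L) L cp.
by apply: integrableS => //; apply: subset_itv_oo_cc.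
Qed.

Lemma continuous_mulR p q : continuous p -> continuous q -> continuous (fun t => p t * q t).
Proof. by move=> cp cq t; apply: cvgM; [exact: cp|exact: cq]. Qed.

Lemma continuous_measurableI p : continuous p -> measurable_fun I p.
Proof. by move=> cp; apply: measurable_funTS; exact: continuous_measurable_fun. Qed.

Lemma sqint_I p : continuous p -> sqint mu I p.
Proof.
move=> cp; split; first exact: continuous_measurableI.
have := continuous_integrable_oo (continuous_mulR cp cp).
by apply: eq_integrable => // x _; rewrite /= expr2.
Qed.

Lemma tens_L2 p h : continuous p -> L2 omega h -> L2 Omega (tens p h).
Proof.
move=> cp [mh h2]; rewrite cylinderE; split.
  by apply: measurable_tens => //; exact: continuous_measurableI.
have := integrable_tens mI mo (sqint_I cp).2 h2.
apply: (eq_integrable (measurable_rV_prod mI mo)) => x _.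
by rewrite /= /tens exprMn.
Qed.

Lemma ip_tens p q h k : continuous p -> continuous q -> L2 omega h -> L2 omega k ->
  ip (lebesgue_rV n.+1) Omega (tens p h) (tens q k) = ip mu I p q * ip nu omega h k.
Proof.
move=> cp cq Lh Lk; rewrite /ip cylinderE -Rintegral_tens//.
- by apply: eq_Rintegral => x _; rewrite /tens; ring.
- exact: continuous_integrable_oo (continuous_mulR cp cq).
- exact: (sqint_integrableM mo Lh Lk).
Qed.

(** Fubini with the first coordinate outside: for fixed t the slice of phi is a test function on
    omega, and p(t) is a constant factor. *)
Lemma tens_weak_partialS p h g j : continuous p -> L2 omega h -> L2 omega g ->
  weak_partial omega j h g -> weak_partial Omega (lift ord0 j) (tens p h) (tens p g).
Proof.
move=> cp Lh Lg wg phi tphi.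
have iph : (lebesgue_rV n.+1).-integrable Omega
    (EFin \o (fun x => tens p h x * partial (lift ord0 j) phi x)).
  apply: (sqint_integrableM mO (tens_L2 cp Lh)).
  exact: (test_L2 mO (test_partial _ tphi)).
have ipg : (lebesgue_rV n.+1).-integrable Omega (EFin \o (fun x => tens p g x * phi x)).
  exact: (sqint_integrableM mO (tens_L2 cp Lg) (test_L2 mO tphi)).
apply/eqP; rewrite -addr_eq0 -RintegralD//; apply/eqP.
have iD := integrableD mO iph ipg.
rewrite cylinderE in tphi iph ipg iD *.
rewrite Rintegral_rV_prod// (@eq_Rintegral _ _ _ _ _ (fun=> 0)).
  by rewrite Rintegral_cst ?mul0r.
move=> t _; have ts := test_slice t tphi.
pose phit y := phi (rV_cons (t : measurableTypeR R, y)).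
have i1 := sqint_integrableM mo Lh (test_L2 mo (test_partial j ts)).
have i2 := sqint_integrableM mo Lg (test_L2 mo ts).
have i12 := integrableD mo i1 i2.
transitivity (p t * \int[nu]_(y in omega) (h y * partial j phit y + g y * phit y)).
  rewrite -RintegralZl//.
  by apply: eq_Rintegral => y _; rewrite !tens_cons /phit partial_slice; ring.
by rewrite RintegralD// (wg _ ts) addNr mulr0.
Qed.

(** Fubini with the tail outside: for fixed y the function t -> p(t) phi(t, y) has compact support
    in the interval, so its derivative has zero integral whatever the values of p at the ends. *)
Lemma tens_weak_partial0 p h : smooth1 p -> L2 omega h ->
  weak_partial Omega ord0 (tens p h) (tens (derive1 p) h).
Proof.
move=> sp Lh phi tphi.
have cp := smooth1_continuous sp; have cp' := smooth1_continuous (smooth1_derive sp).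
have i1 : (lebesgue_rV n.+1).-integrable Omega
    (EFin \o (fun x => tens p h x * partial ord0 phi x)).
  apply: (sqint_integrableM mO (tens_L2 cp Lh)).
  exact: (test_L2 mO (test_partial _ tphi)).
have i2 : (lebesgue_rV n.+1).-integrable Omega (EFin \o (fun x => tens (derive1 p) h x * phi x)).
  exact: (sqint_integrableM mO (tens_L2 cp' Lh) (test_L2 mO tphi)).
apply/eqP; rewrite -addr_eq0 -RintegralD//; apply/eqP.
have iD := integrableD mO i1 i2.
rewrite cylinderE in tphi i1 i2 iD *.
rewrite Rintegral_rV_prod_swap// (@eq_Rintegral _ _ _ _ _ (fun=> 0)).
  by rewrite Rintegral_cst ?mul0r.
move=> y _.
have [K [cK KI K0]] := test_line tphi.
pose q t := p t * phi (rV_cons (t : measurableTypeR R, y)).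
have sline := smooth1_line y (test_smooth tphi).
have sq : smooth1 q by apply: smooth1M.
have q' : derive1 q = fun t => p t * partial ord0 phi (rV_cons (t : measurableTypeR R, y)) +
   derive1 p t * phi (rV_cons (t : measurableTypeR R, y)).
  by rewrite (derive1M (smooth1_derivable sp) (smooth1_derivable sline)) derive1_line.
transitivity (h y * \int[mu]_(t in I) derive1 q t).
  rewrite -RintegralZl//; last first.
    by apply: continuous_integrable_oo; apply: smooth1_continuous; exact: smooth1_derive.
  by apply: eq_Rintegral => t _; rewrite !tens_cons q'; ring.
rewrite (integral_derive1_test _ sq KI) ?mulr0//; first by rewrite gtrN.
by move=> t Kt; rewrite /q K0// mulr0.
Qed.

Lemma tens_H1 p h : smooth1 p -> sobolevH1 omega h -> sobolevH1 Omega (tens p h).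
Proof.
move=> sp Hh; have Lh := H1_L2 Hh; have cp := smooth1_continuous sp.
split; first exact: tens_L2.
move=> i; have [j ->|->] := unliftP ord0 i.
  have [Lw ww] := wpartP j Hh.
  exists (tens p (wpart omega h j)); split; first exact: tens_L2.
  exact: tens_weak_partialS.
exists (tens (derive1 p) h); split; last exact: tens_weak_partial0.
by apply: tens_L2 => //; apply: smooth1_continuous; exact: smooth1_derive.
Qed.

Lemma wpart_tens0 p h : smooth1 p -> sobolevH1 omega h ->
  {ae lebesgue_rV n.+1, forall x, Omega x ->
    wpart Omega (tens p h) ord0 x = tens (derive1 p) h x}.
Proof.
move=> sp Hh; apply: (wpart_unique open_cylinder); first exact: tens_H1.
  apply: tens_L2; last exact: H1_L2.
  by apply: smooth1_continuous; exact: smooth1_derive.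
by apply: tens_weak_partial0 => //; exact: H1_L2.
Qed.

Lemma wpart_tensS p h j : smooth1 p -> sobolevH1 omega h ->
  {ae lebesgue_rV n.+1, forall x, Omega x ->
    wpart Omega (tens p h) (lift ord0 j) x = tens p (wpart omega h j) x}.
Proof.
move=> sp Hh; have [Lw ww] := wpartP j Hh; have cp := smooth1_continuous sp.
apply: (wpart_unique open_cylinder); [exact: tens_H1|exact: tens_L2|].
by apply: tens_weak_partialS => //; exact: H1_L2.
Qed.

(** The first component of the gradient gives the term with p' and q', the others add up to the term
    with [dform omega]. Every computation on the cylinder is reduced by this formula to
    one-dimensional integrals and the two forms on omega. *)
Lemma dform_tens p q h k : smooth1 p -> smooth1 q -> sobolevH1 omega h -> sobolevH1 omega k ->
  dform Omega (tens p h) (tens q k) =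
  ip mu I (derive1 p) (derive1 q) * ip nu omega h k + ip mu I p q * dform omega h k.
Proof.
move=> sp sq Hh Hk.
have cp := smooth1_continuous sp; have cp' := smooth1_continuous (smooth1_derive sp).
have cq := smooth1_continuous sq; have cq' := smooth1_continuous (smooth1_derive sq).
have Hp := tens_H1 sp Hh; have Hq := tens_H1 sq Hk.
have Lh := H1_L2 Hh; have Lk := H1_L2 Hk.
rewrite (dformE open_cylinder Hp Hq) (dformE oomega Hh Hk) big_ord_recl mulr_sumr.
have aux i f g : L2 Omega f -> L2 Omega g ->
    {ae lebesgue_rV n.+1, forall x, Omega x -> wpart Omega (tens p h) i x = f x} ->
    {ae lebesgue_rV n.+1, forall x, Omega x -> wpart Omega (tens q k) i x = g x} ->
    ip (lebesgue_rV n.+1) Omega (wpart Omega (tens p h) i) (wpart Omega (tens q k) i) =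
    ip (lebesgue_rV n.+1) Omega f g.
  move=> Lf Lg ef eg; have [Lp _] := wpartP i Hp; have [Lq _] := wpartP i Hq.
  rewrite (ae_eq_ip mO Lp.1 Lf.1 Lq.1 ef) ipC.
  by rewrite (ae_eq_ip mO Lq.1 Lg.1 Lf.1 eg) ipC.
congr (_ + _).
  rewrite (aux ord0 _ _ (tens_L2 cp' Lh) (tens_L2 cq' Lk) (wpart_tens0 sp Hh) (wpart_tens0 sq Hk)).
  exact: ip_tens.
apply: eq_bigr => j _.
have [Lwh _] := wpartP j Hh; have [Lwk _] := wpartP j Hk.
rewrite (aux (lift ord0 j) _ _ (tens_L2 cp Lwh) (tens_L2 cq Lwk) (wpart_tensS j sp Hh) (wpart_tensS j sq Hk)).
exact: ip_tens.
Qed.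

End tensor.

(** * Cutting off a function of one variable near the ends of an interval *)

Section theta_derive.
Context {R : realType}.
Implicit Types s : R.

Lemma theta_derive s : derive1 theta s = flat ('X ^+ 2 : {poly R}) s.
Proof.
rewrite derive1E; have [_ ->] := flat_derive (1 : {poly R}) s.
by rewrite derivC subr0 mulr1.
Qed.

Lemma theta_derive_le s : 0 < s -> `|derive1 theta s| <= (s ^+ 2)^-1.
Proof.
move=> s0; rewrite theta_derive /flat s0 hornerXn normrM ger0_norm; last first.
  by rewrite exprn_ge0// invr_ge0 ltW.
rewrite ger0_norm ?expR_ge0// exprVn ler_piMr// ?invr_ge0 ?sqr_ge0//.
by rewrite -expR0 ler_expR oppr_le0 invr_ge0 ltW.
Qed.

(** In the derivative of the cutoff, with s = (k + 1) rho - 1, the large factor k + 1 comes together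
    with p = O(rho), hence as s + 1; this weighted derivative is what has to stay bounded. *)
Lemma theta_derive_bound : exists2 C : R, 0 <= C &
  forall s, -1 < s -> `|(s + 1) * derive1 theta s| <= C.
Proof.
have [C C0 HC] := flat_le ('X ^+ 2 : {poly R}).
(* For 0 < s <= 1 the factor s + 1 is at most 2 and [flat_le] gives C; for s > 1 the product is at
   most (s + 1) / s^2 <= 2. *)
exists (2 * C + 2) => [|s s1]; first by rewrite addr_ge0// mulr_ge0.
have [s0|s0] := leP s 0.
  by rewrite theta_derive flat_le0// mulr0 normr0 addr_ge0// mulr_ge0.
rewrite normrM gtr0_norm ?addr_gt0//.
have [sle|sgt] := leP s 1.
  apply: (@le_trans _ _ (2 * C)); last by rewrite lerDl.
  apply: ler_pM => //; [by rewrite addr_ge0// ltW|by rewrite lerD2r in sle *; lra|].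
  rewrite theta_derive; apply: le_trans (HC s _) _; first by rewrite gtr0_norm.
  by rewrite ler_piMr// expr_le1// ltW.
apply: (@le_trans _ _ 2); last by rewrite lerDr mulr_ge0.
apply: le_trans (ler_wpM2l _ (theta_derive_le s0)) _; first by rewrite addr_ge0// ltW.
by rewrite ler_pdivrMr ?exprn_gt0//; nra.
Qed.

Lemma theta_sub1 s : 0 < s -> `|theta s - 1| <= s^-1.
Proof.
move=> s0; rewrite distrC ger0_norm ?subr_ge0 ?theta_le1// lerBlDl thetaE s0.
by rewrite -lerBlDr; have := expR_ge1Dx (- s^-1).
Qed.

End theta_derive.

Section boundary_cutoff.
Context {R : realType} (L : R).
Hypothesis L0 : 0 < L.
Notation mu := (@lebesgue_measure R).
Notation I := (`]-L, L[%classic : set R).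

(** A smooth substitute for the distance to the ends of the interval. *)
Definition rho (t : R) : R := L ^+ 2 - t ^+ 2.

Lemma rho_gt0 t : (0 < rho t) = (t \in `]-L, L[).
Proof.
rewrite in_itv/= -ltr_norml /rho subr_gt0 -(real_normK (num_real t)).
by rewrite ltr_pXn2r ?nnegrE// ltW.
Qed.

Lemma smooth1_rho : smooth1 rho.
Proof.
by apply: smooth1B; [exact: smooth1_cst|apply: smooth1X; exact: smooth1_id].
Qed.

Lemma rho_derive t : derive1 rho t = - (2 * t).
Proof.
rewrite derive1E /rho (_ : (fun t => L ^+ 2 - t ^+ 2) = cst (L ^+ 2) - (@id R) ^+ 2)//.
rewrite deriveB// derive_cst sub0r deriveX// derive_id/= expr1 /GRing.scale/= mulr1.
by rewrite mulr_natl.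
Qed.

(** The shift by -1 makes the cutoff vanish where rho <= 1 / (k + 1), so that its support is a
    compact subset of the open interval. *)
Definition cutoff (p : R -> R) (k : nat) (t : R) : R := p t * theta (k.+1%:R * rho t - 1).

Section cutoff_convergence.
Variables (p : R -> R).
Hypothesis sp : smooth1 p.

Lemma smooth1_cutoff k : smooth1 (cutoff p k).
Proof.
apply: smooth1M => //; apply: (@smooth1_comp _ (fun t => k.+1%:R * rho t - 1)); last exact: smooth1_theta.
by apply: smooth1D; [apply: smooth1Z; exact: smooth1_rho|exact: smooth1_cst].
Qed.

Lemma cutoff_support k : exists K : set R, [/\ compact K, K `<=` I &
  forall t, ~ K t -> cutoff p k t = 0].
Proof.
pose K := [set t : R | k.+1%:R^-1 <= rho t].
have KI : K `<=` I.
  by move=> t Kt; rewrite /= -rho_gt0; apply: lt_le_trans Kt; rewrite invr_gt0 ltr0n.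
exists K; split => //.
- apply: (subclosed_compact _ (@segment_compact _ (- L) L)).
    have -> : K = rho @^-1` [set y | k.+1%:R^-1 <= y] by [].
    apply: closed_comp => [x _|]; last exact: closed_ge.
    by apply: smooth1_continuous; exact: smooth1_rho.
  by move=> t /KI; apply: subset_itv_oo_cc.
- move=> t /negP; rewrite -ltNge => Kt; rewrite /cutoff theta_le0 ?mulr0//.
  by rewrite subr_le0 mulrC -ler_pdivlMr ?ltr0n// mul1r ltW.
Qed.

Lemma cutoff_derive k t : derive1 (cutoff p k) t =
  derive1 p t * theta (k.+1%:R * rho t - 1) +
  p t * (derive1 theta (k.+1%:R * rho t - 1) * (k.+1%:R * - (2 * t))).
Proof.
have sr : smooth1 (fun t => k.+1%:R * rho t - 1).
  by apply: smooth1D; [apply: smooth1Z; exact: smooth1_rho|exact: smooth1_cst].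
rewrite /cutoff (derive1M (smooth1_derivable sp)); last first.
  by apply: smooth1_derivable; exact: (smooth1_comp sr smooth1_theta).
rewrite (derive1_compE (smooth1_derivable sr) (smooth1_derivable smooth1_theta)) addrC.
congr (_ + _ * (_ * _)).
have sk : smooth1 (fun t => k.+1%:R * rho t) by apply: smooth1Z; exact: smooth1_rho.
rewrite (@derive1D _ (fun t => k.+1%:R * rho t) (fun=> -1)); last 2 first.
- exact: smooth1_derivable.
- by move=> x; exact: derivable_cst.
rewrite derive1_cst addr0 (@derive1M _ (fun=> k.+1%:R) rho); last 2 first.
- by move=> x; exact: derivable_cst.
- by apply: smooth1_derivable; exact: smooth1_rho.
by rewrite derive1_cst mul0r addr0 rho_derive.
Qed.

Hypotheses (pL : p L = 0) (pNL : p (- L) = 0).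

Lemma smooth_bounded q : smooth1 q -> exists2 M : R, 0 <= M & forall t, t \in `[-L, L] -> `|q t| <= M.
Proof.
move=> sq; have cq : {within `[-L, L], continuous (fun t => `|q t|)}.
  by apply: continuous_subspaceT => t; apply: cvg_norm; exact: smooth1_continuous.
have LL : - L <= L by rewrite ge0_cp// ltW.
have [c cI Hc] := EVT_max LL cq.
by exists `|q c|.
Qed.

(** The mean value theorem from each end bounds |p| by M (L - t) and by M (L + t). The larger of the
    two distances is at least L, which yields the product of both with constant M / L. *)
Lemma le_rho : exists2 M : R, 0 <= M & forall t, t \in `]-L, L[ -> `|p t| <= M * rho t.
Proof.
have [M M0 HM] := smooth_bounded (smooth1_derive sp).
have isd t : is_derive t (1 : R) p (derive1 p t).
  by rewrite derive1E; apply: derivableP; exact: smooth1_derivable.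
have cp (a b : R) : {within `[a, b], continuous p}.
  by apply: continuous_subspaceT; exact: smooth1_continuous.
exists (M / L) => [|t]; first by rewrite divr_ge0// ltW.
rewrite in_itv/= => /andP[t1 t2].
have [c1 c1I e1] := MVT t2 (fun x _ => isd x) (cp _ _).
have [c2 c2I e2] := MVT t1 (fun x _ => isd x) (cp _ _).
have b1 : `|p t| <= M * (L - t).
  move: e1; rewrite pL sub0r => /(congr1 Num.norm); rewrite normrN normrM => ->.
  have h : `|derive1 p c1| <= M.
    by apply: HM; move: c1I; rewrite !in_itv/= => /andP[? ?]; apply/andP; split; lra.
  have Lt : 0 < L - t by rewrite subr_gt0.
  by rewrite (gtr0_norm Lt) ler_wpM2r// ltW.
have b2 : `|p t| <= M * (L + t).
  move: e2; rewrite pNL subr0 opprK => /(congr1 Num.norm); rewrite normrM => ->.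
  have h : `|derive1 p c2| <= M.
    by apply: HM; move: c2I; rewrite !in_itv/= => /andP[? ?]; apply/andP; split; lra.
  have Lt : 0 < L + t by lra.
  by rewrite addrC (gtr0_norm Lt) ler_wpM2r// ltW.
rewrite mulrAC ler_pdivlMr// /rho subr_sqr.
have M1 : 0 <= M * (L - t) by rewrite mulr_ge0// subr_ge0 ltW.
have M2 : 0 <= M * (L + t) by rewrite mulr_ge0//; lra.
have [tge|tlt] := leP 0 t.
  apply: le_trans (ler_wpM2r (ltW L0) b1) _.
  by rewrite mulrA ler_wpM2l// lerDl.
apply: le_trans (ler_wpM2r (ltW L0) b2) _.
by rewrite (mulrC (L - t)) mulrA ler_wpM2l//; lra.
Qed.

(** Two regimes for p (theta(s) - 1) and its derivative: a uniform bound, which serves as majorant,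
    and a decay in 1/s, which gives pointwise convergence since s tends to infinity with k. *)
Lemma cutoff_sub_le : exists2 A : R, 0 < A &
  forall k t, t \in `]-L, L[ ->
    let s := k.+1%:R * rho t - 1 in
    [/\ `|cutoff p k t - p t| <= A, `|derive1 (cutoff p k) t - derive1 p t| <= A,
      1 <= s -> `|cutoff p k t - p t| <= A * s^-1 &
      1 <= s -> `|derive1 (cutoff p k) t - derive1 p t| <= A * s^-1].
Proof.
have [M M0 HM] := le_rho.
have [B B0 HB] := smooth_bounded sp.
have [B' B'0 HB'] := smooth_bounded (smooth1_derive sp).
have [C C0 HC] := @theta_derive_bound R.
have D0 : 0 <= 2 * L * M by rewrite !mulr_ge0// ltW.
have DC0 : 0 <= 2 * L * M * C by rewrite mulr_ge0.
(* One constant for all four bounds: B and B' bound p and p', the products with 2 L M bound the term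
   containing the derivative of [theta], and 1 ensures positivity. *)
exists (1 + B + B' + 2 * L * M * C + 2 * L * M * 2) => [|k t tI s]; first by lra.
have tI' : t \in `[-L, L] by move: tI; rewrite !in_itv/= => /andP[/ltW -> /ltW ->].
have s1 : -1 < s by rewrite /s ltrBrDl subrr mulr_gt0 ?ltr0n// rho_gt0.
have e1 : cutoff p k t - p t = p t * (theta s - 1) by rewrite /cutoff -/s; ring.
have e2 : derive1 (cutoff p k) t - derive1 p t =
    derive1 p t * (theta s - 1) + p t * (derive1 theta s * (k.+1%:R * - (2 * t))).
  by rewrite cutoff_derive -/s; ring.
have t1 : `|theta s - 1| <= 1.
  by have := theta_ge0 s; have := theta_le1 s; rewrite ler_norml => ? ?; apply/andP; split; lra.
have tL : `|t| <= L by move: tI'; rewrite in_itv/= ler_norml.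
have krho : k.+1%:R * rho t = s + 1 by rewrite /s subrK.
have s10 : 0 <= s + 1 by lra.
have e3 : `|p t * (derive1 theta s * (k.+1%:R * - (2 * t)))| <=
    2 * L * M * ((s + 1) * `|derive1 theta s|).
  rewrite -krho !normrM normrN normrM (ger0_norm (ler0n _ k.+1)) (ger0_norm (ler0n _ 2)).
  have h1 := HM t tI.
  have h2 : `|p t| * `|t| <= M * rho t * L by apply: ler_pM.
  have q0 : 0 <= k.+1%:R * 2 * `|derive1 theta s| by rewrite !mulr_ge0.
  have := ler_wpM2r q0 h2.
  by congr (_ <= _); ring.
have e4 : (s + 1) * `|derive1 theta s| <= C.
  by rewrite -(ger0_norm s10) -normrM; exact: HC.
have t2 : 1 <= s -> `|theta s - 1| <= s^-1.
  by move=> sge; apply: theta_sub1; exact: lt_le_trans sge.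
have e5 : 1 <= s -> (s + 1) * `|derive1 theta s| <= 2 * s^-1.
  move=> sge; have s0 : 0 < s by exact: lt_le_trans sge.
  apply: le_trans (ler_wpM2l s10 (theta_derive_le s0)) _.
  by rewrite ler_pdivrMr ?exprn_gt0// expr2 mulrA divfK ?gt_eqF//; lra.
have Bt := HB t tI'; have B't := HB' t tI'.
split.
- rewrite e1 normrM; apply: le_trans (ler_pM _ _ Bt t1) _ => //.
  by rewrite mulr1; lra.
- rewrite e2; apply: le_trans (ler_normD _ _) _; rewrite normrM.
  have h1 := ler_pM (normr_ge0 _) (normr_ge0 _) B't t1.
  have h2 := le_trans e3 (ler_wpM2l D0 e4).
  by rewrite mulr1 in h1; lra.
- move=> sge; have s0 : 0 <= s^-1 by rewrite invr_ge0; lra.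
  rewrite e1 normrM; apply: le_trans (ler_pM _ _ Bt (t2 sge)) _ => //.
  by rewrite ler_wpM2r//; lra.
- move=> sge; have s0 : 0 <= s^-1 by rewrite invr_ge0; lra.
  rewrite e2; apply: le_trans (ler_normD _ _) _; rewrite normrM.
  have h1 := ler_pM (normr_ge0 _) (normr_ge0 _) B't (t2 sge).
  have h2 := le_trans e3 (ler_wpM2l D0 (e5 sge)).
  apply: le_trans (lerD h1 h2) _.
  rewrite [X in _ + X]mulrA -mulrDl ler_wpM2r//; lra.
Qed.

(** Dominated convergence on the interval, with the constant majorant A^2. *)
Lemma ip_cvg0 (f : nat -> R -> R) (A : R) : 0 < A -> (forall k, continuous (f k)) ->
  (forall k t, t \in `]-L, L[ -> `|f k t| <= A) ->
  (forall k t, t \in `]-L, L[ -> let s := k.+1%:R * rho t - 1 in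
     1 <= s -> `|f k t| <= A * s^-1) ->
  ip mu I (f k) (f k) @[k --> \oo] --> (0 : R).
Proof.
move=> A0 cf fA fs.
have mI : measurable (I : set (measurableTypeR R)) by exact: measurable_itv.
pose g k t := (f k t * f k t)%:E.
have cff k : continuous (fun t => f k t * f k t) by exact: (continuous_mulR (cf k) (cf k)).
have ig k : mu.-integrable I (g k) by exact: (continuous_integrable_oo L (cff k)).
have mg k : measurable_fun I (g k) by exact: measurable_int (ig k).
have f0 t : I t -> f k t @[k --> \oo] --> (0 : R).
  move=> It; apply/cvgrPdist_le => e e0.
  have rt : 0 < rho t by rewrite rho_gt0.
  near=> k; rewrite sub0r normrN.
  (* This threshold makes s at least A / e + 1, so that s >= 1 and A / s < e. *)
  have hk : (A / e + 2) / rho t <= k%:R by near: k; exact: nbhs_infty_ger.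
  have sk : A / e + 1 <= k.+1%:R * rho t - 1.
    rewrite lerBrDr -addrA (_ : 1 + 1 = 2)// -ler_pdivrMr//.
    by apply: le_trans hk _; rewrite ler_nat.
  have Ae : 0 < A / e by exact: divr_gt0.
  apply: le_trans (fs k t It _) _; first by lra.
  rewrite ler_pdivrMr; last by lra.
  rewrite -ler_pdivrMl// mulrC; lra.
have g0 t : I t -> g k t @[k --> \oo] --> 0%E.
  move=> It; apply/fine_cvgP; split; first exact: nearW.
  by have := cvgM (f0 t It) (f0 t It); rewrite mulr0; exact.
have gA k t : I t -> (`|g k t| <= (A * A)%:E)%E.
  by move=> It; rewrite lee_fin normrM ler_pM// fA.
have iA : mu.-integrable I (EFin \o (cst (A * A) : R -> R)).
  by apply: continuous_integrable_oo => t; exact: cvg_cst.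
have mc0 : measurable_fun I (cst 0%E : R -> \bar R) by exact: measurable_cst.
have h1 : {ae mu, forall t, I t -> g ^~ t @ \oo --> (cst 0%E : R -> \bar R) t}.
  by apply: aeW => t; exact: g0.
have h2 : {ae mu, forall t k, I t -> (`|g k t| <= (EFin \o (cst (A * A)%R : R -> R)) t)%E}.
  by apply: aeW => t k; exact: gA.
have [_ _] := dominated_convergence mI mg mc0 h1 iA h2.
rewrite integral0 => /fine_cvgP[_].
by apply.
Unshelve. all: by end_near. Qed.

Definition H1sq_itv (q : R -> R) : R := ip mu I q q + ip mu I (derive1 q) (derive1 q).

Lemma cutoff_cvg : H1sq_itv (fun t => cutoff p k t - p t) @[k --> \oo] --> (0 : R).
Proof.
have [A A0 HA] := cutoff_sub_le.
have sd k : smooth1 (fun t => cutoff p k t - p t).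
  by apply: smooth1B => //; exact: smooth1_cutoff.
have dE k : derive1 (fun t => cutoff p k t - p t) = fun t => derive1 (cutoff p k) t - derive1 p t.
  by apply: derive1B => //; exact: smooth1_cutoff.
rewrite /H1sq_itv -[0]addr0; apply: cvgD.
  apply: (ip_cvg0 A0) => [k|k t tI|k t tI s]; first exact: smooth1_continuous.
    by have [] := HA k t tI.
  by have [_ _ + _] := HA k t tI.
apply: (ip_cvg0 A0) => [k|k t tI|k t tI s]; rewrite ?dE.
- by rewrite -dE; apply: smooth1_continuous; exact: smooth1_derive.
- by have [] := HA k t tI.
- by have [_ _ _ +] := HA k t tI.
Qed.

End cutoff_convergence.
End boundary_cutoff.

Lemma quarter_sum (R : realFieldType) (a b e : R) :
  a < e / 4 -> b < e / 4 -> 2 * a + 2 * b < e.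
Proof. by move=> ? ?; lra. Qed.

(** * Tensor products in H^1_0 of the cylinder *)

Section tensor_H10.
Context {R : realType} (n : nat) (omega : set 'rV[R]_n) (L : R).
Hypothesis oomega : open omega.
Hypothesis L0 : 0 < L.
Notation mu := (@lebesgue_measure R).
Notation nu := (@lebesgue_rV R n).
Notation I := (`]-L, L[%classic : set R).
Notation Omega := (cylinder L omega).
Implicit Types (p q : R -> R) (h k : 'rV[R]_n -> R).

Lemma H1sq_tens q h : smooth1 q -> sobolevH1 omega h ->
  H1sq Omega (tens q h) <= H1sq_itv L q * H1sq omega h.
Proof.
move=> sq Hh; have cq := smooth1_continuous sq; have Lh := H1_L2 Hh.
rewrite /H1sq (ip_tens L oomega cq cq Lh Lh) (dform_tens oomega L0 sq sq Hh Hh) /H1sq_itv.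
have h1 := dform_ge0 omega h; have h2 := ip_ge0 mu I q.
have h3 := ip_ge0 mu I (derive1 q); have h4 := ip_ge0 nu omega h.
move: (dform omega h h) (ip mu I q q) (ip mu I (derive1 q) (derive1 q)) (ip nu omega h h) h1 h2 h3 h4.
by move=> a b c d a0 b0 c0 d0; nra.
Qed.

Lemma H1sq_itv_ge0 q : 0 <= H1sq_itv L q.
Proof. by rewrite addr_ge0 ?ip_ge0. Qed.

(** The approximant is (cutoff of p) (x) phi, with error cutoff (x) (phi - h) plus (cutoff - p) (x)
    h. The index of the cutoff is fixed before phi, because the tolerance for phi depends on the
    norm of the cutoff. *)
Lemma tens_H10 p h : smooth1 p -> p L = 0 -> p (- L) = 0 -> sobolevH10 omega h ->
  sobolevH10 Omega (tens p h).
Proof.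
move=> sp pL pNL /(H10P oomega)[Hh Ah].
have Hph := tens_H1 oomega L0 sp Hh.
apply/(H10P (open_cylinder (L := L) oomega)); split => // e e0.
pose A := 4 * (H1sq omega h + 1).
have A0 : 0 < A by rewrite mulr_gt0// ltr_wpDl// H1sq_ge0.
have /cvgrPdist_lt/(_ _ (divr_gt0 e0 A0))[k _ /(_ k (leqnn k))/=] := cutoff_cvg L0 sp pL pNL.
rewrite sub0r normrN ger0_norm ?H1sq_itv_ge0// => hk.
set q := fun t => _ in hk.
have spk := smooth1_cutoff L sp k.
have sq : smooth1 q.
  exact: smooth1B spk sp.
pose B := 4 * (H1sq_itv L (cutoff L p k) + 1).
have B0 : 0 < B by rewrite mulr_gt0// ltr_wpDl// H1sq_itv_ge0.
have [phi tphi hphi] := Ah _ (divr_gt0 e0 B0).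
have [K [cK KI K0]] := cutoff_support L0 p k.
exists (tens (cutoff L p k) phi).
  by rewrite cylinderE; exact: (test_tens spk cK KI K0 tphi).
have mo := open_measurable_rV oomega.
have Hphi := test_sobolevH1 mo tphi.
have Hd := H1B oomega Hphi Hh.
have -> : (fun x => tens (cutoff L p k) phi x - tens p h x) =
    (fun x => tens (cutoff L p k) (fun y => phi y - h y) x + tens q h x).
  by apply/funext => x; rewrite /tens /q; ring.
have h1 := H1sq_triangle (open_cylinder (L := L) oomega) (tens_H1 oomega L0 spk Hd) (tens_H1 oomega L0 sq Hh).
have h2 := H1sq_tens spk Hd; have h3 := H1sq_tens sq Hh.
apply: (le_lt_trans h1).
have {}h2 := le_trans h2 (ler_wpM2l (H1sq_itv_ge0 _) (ltW hphi)).
have {}h3 := le_trans h3 (ler_wpM2r (H1sq_ge0 _ _) (ltW hk)).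
have e1 : H1sq_itv L (cutoff L p k) * (e / B) < e / 4.
  rewrite mulrA ltr_pdivrMr// mulrC /B mulrA divfK// ltr_pM2l//.
  by rewrite ltrDl.
have e2 : e / A * H1sq omega h < e / 4.
  rewrite mulrAC ltr_pdivrMr// /A mulrA divfK// ltr_pM2l//.
  by rewrite ltrDl.
exact: quarter_sum (le_lt_trans h2 e1) (le_lt_trans h3 e2).
Qed.

End tensor_H10.

(** * Density of tensor products *)

Section bernstein.
Context {R : realType}.
Implicit Types (s : R) (f g : nat -> R).

(* The Bernstein polynomial of degree [N] with control values [f], in the form
   of de Casteljau's recursion. *)
Fixpoint bern (N : nat) f s : R :=
  if N is N'.+1 then s * bern N' (f \o S) s + (1 - s) * bern N' f s else f 0%N.

Lemma eq_bern N f g s : (forall i, (i <= N)%N -> f i = g i) -> bern N f s = bern N g s.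
Proof.
elim: N f g => [|N IH] f g fg /=; first exact: fg.
congr (_ * _ + _ * _); apply: IH => i iN; last by apply: fg; exact: leqW.
exact: fg.
Qed.

Lemma bern_sum I (r : seq I) (c : I -> R) (g : I -> nat -> R) N s :
  bern N (fun j => \sum_(i <- r) c i * g i j) s = \sum_(i <- r) c i * bern N (g i) s.
Proof.
elim: N g => [//|N IH] g /=; rewrite (IH g) [X in s * X](IH (fun i => g i \o S)).
by rewrite !mulr_sumr -big_split/=; apply: eq_bigr => i _; ring.
Qed.

Lemma bernB N f g s : bern N (fun i => f i - g i) s = bern N f s - bern N g s.
Proof.
elim: N f g => [//|N IH] f g /=.
by rewrite (IH f g) [X in s * X](IH (f \o S) (g \o S)); ring.
Qed.

Lemma bern_affine N f a b s : bern N (fun i => a + b * f i) s = a + b * bern N f s.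
Proof.
elim: N f => [//|N IH] f /=.
by rewrite (IH f) (IH (f \o S) : bern N ((fun i => a + b * f i) \o S) s = _); ring.
Qed.

Lemma bernZ N f b s : bern N (fun i => b * f i) s = b * bern N f s.
Proof.
have := bern_affine N f 0 b s; rewrite add0r => <-.
by apply: eq_bern => i _; rewrite add0r.
Qed.

Lemma le_bern N f g s : 0 <= s <= 1 -> (forall i, (i <= N)%N -> f i <= g i) ->
  bern N f s <= bern N g s.
Proof.
move=> /andP[s0 s1]; elim: N f g => [|N IH] f g fg /=; first exact: fg.
apply: lerD; apply: ler_wpM2l => //; rewrite ?subr_ge0//; apply: IH => i iN.
  exact: fg.
by apply: fg; exact: leqW.
Qed.

Lemma norm_bern N f s : 0 <= s <= 1 -> `|bern N f s| <= bern N (fun i => `|f i|) s.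
Proof.
move=> s01; rewrite ler_norml -mulN1r -[X in X <= _]add0r -bern_affine.
apply/andP; split; apply: le_bern => // i _; last exact: ler_norm.
by rewrite add0r mulN1r lerNl -normrN ler_norm.
Qed.

(** The second moment of a binomial variable: squared mean plus variance N s (1 - s). *)
Lemma bern_sq N c s :
  bern N (fun i => (i%:R + c) ^+ 2) s = (c + N%:R * s) ^+ 2 + N%:R * s * (1 - s).
Proof.
elim: N c => [|N IH] c /=; first by ring.
rewrite IH [X in s * X](_ : _ = bern N (fun i => (i%:R + (c + 1)) ^+ 2) s).
  by rewrite IH -natr1; ring.
by apply: eq_bern => i _ /=; rewrite -natr1; ring.
Qed.

Lemma smooth1_bern N f : smooth1 (bern N f).
Proof.
elim: N f => [|N IH] f /=; first exact: smooth1_cst.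
apply: smooth1D; apply: smooth1M => //; first exact: smooth1_id.
by apply: smooth1B; [exact: smooth1_cst|exact: smooth1_id].
Qed.

(** Induction through the derivative of de Casteljau's recursion, with linearity in the control
    values. The forward differences become difference quotients of phi once the interval is
    rescaled. *)
Lemma bern_derive N f s :
  derive1 (bern N.+1 f) s = N.+1%:R * bern N (fun i => f i.+1 - f i) s.
Proof.
have db M g t : derivable (bern M g) t 1 by exact: smooth1_derivable (smooth1_bern M g) t.
have aux M g t : is_derive t (1 : R) (bern M g) (derive1 (bern M g) t).
  by rewrite derive1E; apply: derivableP.
have rec M g t : derive1 (bern M.+1 g) t =
    bern M (g \o S) t - bern M g t + t * derive1 (bern M (g \o S)) t + (1 - t) * derive1 (bern M g) t.
  rewrite [in LHS]derive1E.
  have h := is_deriveD (is_deriveM (is_derive_id t (1:R)) (aux M (g \o S) t))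
    (is_deriveM (is_deriveB (is_derive_cst (1:R) t (1:R)) (is_derive_id t (1:R))) (aux M g t)).
  have [_ e] := h.
  transitivity (t * derive1 (bern M (g \o S)) t + bern M (g \o S) t * 1 +
    ((1 - t) * derive1 (bern M g) t + bern M g t * (0 - 1))); first exact: e.
  by ring.
elim: N f => [|N IH] f.
  have d0 g : derive1 (bern 0 g) s = 0 by exact: (derive1_cst (g 0%N) s).
  by rewrite rec !d0 /=; ring.
rewrite rec !IH /=.
rewrite (_ : (fun i => f i.+1 - f i) \o S = fun i => (f \o S) i.+1 - (f \o S) i)//.
have e : bern N.+1 (f \o S) s - bern N.+1 f s = bern N.+1 (fun i => f i.+1 - f i) s.
  by rewrite -bernB.
move: e => /= ->.
rewrite /comp; have -> : N.+2%:R = N.+1%:R + 1 :> R by rewrite natr1.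
by ring.
Qed.

(** A Chebyshev argument. The degree [M] is [N] for the approximant and [N] - 1 for its derivative,
    while the nodes remain i / N; the term 1 / N in the hypothesis allows for a control value taken
    at a point between two nodes. *)
Lemma bern_error N M (F : nat -> R) G K eta s : 0 <= s <= 1 -> (0 < N)%N -> 0 < eta ->
  0 <= K -> (M <= N <= M.+1)%N ->
  (forall i, (i <= M)%N -> `|F i - G| <= K * (`|i%:R / N%:R - s| + N%:R^-1)) ->
  `|bern M F s - G| <= K * (eta + (N%:R * eta)^-1 + N%:R^-1).
Proof.
move=> s01 N0 eta0 K0 /andP[MN NM] HF.
have N0' : 0 < N%:R :> R by rewrite ltr0n.
have -> : bern M F s - G = bern M (fun i => F i - G) s.
  have := bern_affine M F (- G) 1 s; rewrite mul1r addrC => <-.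
  by apply: eq_bern => i _; rewrite mul1r addrC.
apply: le_trans (norm_bern _ _ s01) _.
pose c : R := - (N%:R * s).
(* The distance z = |i/N - s| is replaced by eta + z^2 / eta, whose Bernstein mean is explicit. *)
apply: (@le_trans _ _ (bern M (fun i => (K * (eta + N%:R^-1)) +
    (K / (eta * N%:R ^+ 2)) * (i%:R + c) ^+ 2) s)).
  apply: le_bern => // i iM; apply: le_trans (HF i iM) _.
  have -> : K * (eta + N%:R^-1) + K / (eta * N%:R ^+ 2) * (i%:R + c) ^+ 2 =
      K * (eta + N%:R^-1 + (i%:R / N%:R - s) ^+ 2 / eta).
    by rewrite /c; field; rewrite !gt_eqF.
  apply: ler_wpM2l => //; rewrite addrAC lerD2r.
  set z := _ - s; rewrite -(real_normK (num_real z)).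
  have : 0 <= (`|z| - eta) ^+ 2 by exact: sqr_ge0.
  have z0 : 0 <= `|z| by []; move: z0; move: `|z| => {}z z0 h.
  by rewrite -(ler_pM2r eta0) mulrDl divfK ?gt_eqF//; nra.
rewrite bern_affine bern_sq.
(* With c = -N s the squared mean is 0 if M = N and s^2 <= 1 if M = N - 1, and the variance is at
   most M. *)
have key : (c + M%:R * s) ^+ 2 + M%:R * s * (1 - s) <= N%:R.
  rewrite (_ : c + M%:R * s = - ((N - M)%:R * s)); last by rewrite /c natrB//; ring.
  case/andP: s01 => s0 s1.
  have M0 : 0 <= M%:R :> R by [].
  have h1 : M%:R * s * (1 - s) <= M%:R.
    by rewrite -mulrA ler_piMr// mulr_ile1// ?subr_ge0// lerBlDr lerDl.
  have [NMe|NM'] := eqVneq N M.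
    by rewrite NMe subnn mul0r oppr0 expr0n add0r.
  have -> : N = M.+1 by apply/eqP; rewrite eqn_leq NM ltn_neqAle eq_sym NM' MN.
  rewrite subSnn mul1r sqrrN -natr1.
  have h2 : s ^+ 2 <= 1 by rewrite expr_le1.
  by rewrite addrC lerD.
have K1 : 0 <= K / (eta * N%:R ^+ 2).
  by rewrite divr_ge0// mulr_ge0 ?sqr_ge0// ltW.
apply: (le_trans (lerD (lexx _) (ler_wpM2l K1 key))).
rewrite le_eqVlt; apply/orP; left; apply/eqP.
by field; rewrite !gt_eqF.
Qed.

Lemma bern0 N f : bern N f 0 = f 0%N.
Proof. by elim: N f => //= N IH f; rewrite mul0r add0r subr0 mul1r IH. Qed.

Lemma bern1 N f : bern N f 1 = f N.
Proof. by elim: N f => //= N IH f; rewrite subrr mul0r addr0 mul1r IH. Qed.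

Lemma bern_delta N f s :
  bern N f s = \sum_(i < N.+1) f i * bern N (fun j => (j == i)%:R) s.
Proof.
rewrite -bern_sum; apply: eq_bern => j jN.
rewrite (bigD1 (inord j))//= inordK// eqxx mulr1 big1 ?addr0//.
move=> i ij; rewrite (_ : (j == i) = false) ?mulr0//.
by apply/negbTE; apply: contra ij => /eqP ->; rewrite inord_val.
Qed.

End bernstein.

Section density.
Context {R : realType} (n : nat) (omega : set 'rV[R]_n) (L : R).
Hypothesis oomega : open omega.
Hypothesis bomega : bounded_set omega.
Hypothesis L0 : 0 < L.
Notation Omega := (cylinder L omega).
Notation cons t y := (rV_cons (t : measurableTypeR R, y)).

Lemma partial_sum I (r : seq I) (F : I -> 'rV[R]_n.+1 -> R) j : (forall i, smooth (F i)) ->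
  partial j (fun x => \sum_(i <- r) F i x) = fun x => \sum_(i <- r) partial j (F i) x.
Proof.
move=> sF; elim: r => [|i r IH].
  under eq_fun do rewrite big_nil.
  by rewrite partial_cst; apply/funext => x; rewrite big_nil.
under eq_fun do rewrite big_cons.
rewrite partialD; [|exact: smooth_diff|by apply: smooth_diff; exact: smooth_sum].
by rewrite IH; apply/funext => x; rewrite big_cons.
Qed.

Lemma is_derive_line (psi : 'rV[R]_n.+1 -> R) y z : smooth psi ->
  is_derive z (1 : R) (fun t : R => psi (cons t y)) (partial ord0 psi (cons z y)).
Proof.
move=> spsi; have := congr1 (fun F => F z) (derive1_line psi y); rewrite /= => <-.
rewrite derive1E; apply: derivableP; exact: (smooth1_derivable (smooth1_line y spsi)).
Qed.

Lemma test_lipschitz (psi : 'rV[R]_n.+1 -> R) : test_function Omega psi ->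
  exists2 M : R, 0 <= M & forall y t t', `|psi (cons t y) - psi (cons t' y)| <= M * `|t - t'|.
Proof.
move=> tpsi; have [M M0 HM] := test_bounded (test_partial ord0 tpsi).
exists M => [|y]; first exact: ltW.
suff H t t' : t <= t' -> `|psi (cons t' y) - psi (cons t y)| <= M * (t' - t).
  move=> t t'; have [tt'|/ltW tt'] := leP t t'.
    by rewrite distrC (distrC t) [`|t' - t|]ger0_norm ?subr_ge0//; exact: H.
  by rewrite [`|t - t'|]ger0_norm ?subr_ge0//; exact: H.
move=> tt'; have sl := smooth1_line y (test_smooth tpsi).
have [z _ ->] := MVT_segment tt' (fun z _ => is_derive_line y z (test_smooth tpsi))
  (continuous_subspaceT (smooth1_continuous sl)).
by rewrite normrM [`|t' - t|]ger0_norm ?subr_ge0// ler_wpM2r// subr_ge0.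
Qed.

Lemma bounded_cylinder : bounded_set Omega.
Proof.
have [M M0 HM] := bounded_rVP bomega.
exists (M + L); split; first exact: num_real.
move=> K MK x [/= xL ox]; apply: le_trans (ltW MK).
have -> : `|x| = mx_norm x by [].
rewrite mx_normrE; apply: bigmax_le; first by rewrite addr_ge0// ltW.
move=> [i j] _ /=; rewrite (ord1 i).
have [k ->|->] := unliftP ord0 j.
  have := HM _ k ox; rewrite mxE => h; apply: ltW; apply: lt_le_trans h _.
  by rewrite lerDl ltW.
rewrite -ltr_norml in xL; apply: ltW; apply: lt_le_trans xL _.
by rewrite lerDr ltW.
Qed.

Section approx.
Variables (phi : 'rV[R]_n.+1 -> R) (N' : nat).
Hypothesis tphi : test_function Omega phi.
Let N := N'.+1.
Let rescale (t : R) : R := (t + L) / (2 * L).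
Let node (i : nat) : R := - L + 2 * L * (i%:R / N%:R).

(* The i-th Bernstein basis polynomial; the two end terms are dropped, since [phi] vanishes
   at both ends of the cylinder. *)
Definition bern_coef (i : 'I_N.+1) (t : R) : R :=
  if (0 < i < N)%N then bern N (fun j => (j == i)%:R) (rescale t) else 0.

Definition bern_slice (i : 'I_N.+1) (y : 'rV[R]_n) : R := phi (cons (node i) y).

Let L2gt0 : 0 < 2 * L. Proof. by rewrite mulr_gt0. Qed.
Let N0 : 0 < N%:R :> R. Proof. by rewrite ltr0n. Qed.

Let smooth1_shift : smooth1 (fun t => t + L).
Proof. by apply: smooth1D; [exact: smooth1_id|exact: smooth1_cst]. Qed.

Let rescaleE : rescale = fun t => (2 * L)^-1 * (t + L).
Proof. by apply/funext => t; rewrite mulrC. Qed.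

Lemma smooth1_rescale : smooth1 rescale.
Proof. by rewrite rescaleE; exact: smooth1Z smooth1_shift. Qed.

Lemma rescale_derive t : derive1 rescale t = (2 * L)^-1.
Proof.
rewrite rescaleE (derive1Z _ smooth1_shift).
rewrite (derive1D (smooth1_derivable smooth1_id) (smooth1_derivable (smooth1_cst L))).
by rewrite derive1_id derive1_cst addr0 mulr1.
Qed.

Lemma smooth1_bern_coef i : smooth1 (bern_coef i).
Proof.
rewrite /bern_coef; case: (0 < i < N)%N; last exact: smooth1_cst.
exact: smooth1_comp smooth1_rescale (smooth1_bern _ _).
Qed.

Lemma bern_coefL i : bern_coef i L = 0.
Proof.
rewrite /bern_coef; case: ifPn => // /andP[_ iN].
rewrite /rescale (_ : (L + L) / _ = 1) ?bern1; last by field; rewrite gt_eqF.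
by rewrite gtn_eqF.
Qed.

Lemma bern_coefNL i : bern_coef i (- L) = 0.
Proof.
rewrite /bern_coef; case: ifPn => // /andP[i0 _].
by rewrite /rescale addNr mul0r bern0 ltn_eqF.
Qed.

Lemma tphi_prod psi : test_function Omega psi -> test_function (rV_prod `]-L, L[%classic omega) psi.
Proof. by rewrite cylinderE. Qed.

Lemma test_bern_slice i : test_function omega (bern_slice i).
Proof. exact: test_slice (tphi_prod tphi). Qed.

Lemma test_ends psi y t : test_function Omega psi -> (t == L) || (t == - L) -> psi (cons t y) = 0.
Proof.
move=> tpsi tL; apply: (test_out tpsi) => -[/= + _]; rewrite rV_cons0/=.
by case/orP: tL => /eqP ->; rewrite ltxx ?andbF.
Qed.

(** The omitted end terms would carry the value of psi at the ends of the cylinder, which is 0. A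
    general psi is allowed because the identity is used for phi and for its tail derivatives. *)
Lemma bern_coef_sum psi t y : test_function Omega psi ->
  \sum_(i < N.+1) bern_coef i t * psi (cons (node i) y) =
  bern N (fun i => psi (cons (node i) y)) (rescale t).
Proof.
move=> tpsi; rewrite bern_delta; apply: eq_bigr => i _; rewrite mulrC /bern_coef.
case: ifPn => //; rewrite negb_and -leqNgt leqn0 -leqNgt => H.
rewrite test_ends ?mul0r//; apply/orP; case/orP: H => [/eqP ->|Ni].
  by right; rewrite /node mul0r mulr0 addr0.
left; have -> : (i : nat) = N by apply/eqP; rewrite eqn_leq Ni -ltnS ltn_ord.
apply/eqP; rewrite /node (_ : N%:R / N%:R = 1 :> R); last by rewrite divff ?gt_eqF.
by ring.
Qed.

Definition bern_approx (x : 'rV[R]_n.+1) : R :=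
  \sum_(i < N.+1) tens (bern_coef i) (bern_slice i) x.

Lemma smooth_bern_approx : smooth bern_approx.
Proof.
apply: smooth_sum => i; apply: smooth_tens; first exact: smooth1_bern_coef.
exact: test_smooth (test_bern_slice i).
Qed.

Lemma bern_approx_line t y :
  bern_approx (cons t y) = bern N (fun i => phi (cons (node i) y)) (rescale t).
Proof.
by rewrite -(bern_coef_sum t y tphi); apply: eq_bigr => i _; rewrite tens_cons.
Qed.

(** The factor (2 L)^-1 N is the inverse of the distance between consecutive nodes, so the control
    values are difference quotients of phi. *)
Lemma partial0_bern_approx t y : partial ord0 bern_approx (cons t y) =
  bern N' (fun i => (2 * L)^-1 * N%:R * (phi (cons (node i.+1) y) - phi (cons (node i) y))) (rescale t).
Proof.
have := congr1 (fun F => F t) (derive1_line bern_approx y); rewrite /= => <-.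
rewrite (_ : (fun t => _) = fun t => bern N (fun i => phi (cons (node i) y)) (rescale t)); last first.
  by apply/funext => t'; exact: bern_approx_line.
rewrite (derive1_compE (smooth1_derivable smooth1_rescale) (smooth1_derivable (smooth1_bern _ _))).
rewrite bern_derive rescale_derive.
by rewrite bernZ /N; ring.
Qed.

Lemma partialS_bern_approx j t y : partial (lift ord0 j) bern_approx (cons t y) =
  bern N (fun i => partial (lift ord0 j) phi (cons (node i) y)) (rescale t).
Proof.
rewrite -(bern_coef_sum t y (test_partial _ tphi)) /bern_approx partial_sum; last first.
  move=> i; apply: smooth_tens; first exact: smooth1_bern_coef.
  exact: test_smooth (test_bern_slice i).
apply: eq_bigr => i _.
rewrite partial_tensS; [|exact: smooth1_bern_coef|exact: test_smooth (test_bern_slice i)].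
by rewrite tens_cons /bern_slice partial_slice.
Qed.

(** Each partial derivative of the approximant is a Bernstein polynomial whose control values are
    close to partial derivatives of phi at the nodes; the factor 2 L comes from rescaling the
    interval to [0, 1]. *)
Lemma bern_approx_error (K eta : R) : 0 < eta -> 0 <= K ->
  (forall i y t t', `|partial i phi (cons t y) - partial i phi (cons t' y)| <= K * `|t - t'|) ->
  forall i x, Omega x -> `|partial i bern_approx x - partial i phi x| <=
    2 * L * K * (eta + (N%:R * eta)^-1 + N%:R^-1).
Proof.
move=> eta0 K0 HK i x [/= xL _].
rewrite -(rV_cons_tail x); set t := x ord0 ord0 in xL *; set y := rV_tail x.
have s01 : 0 <= rescale t <= 1.
  rewrite /rescale divr_ge0 ?(ltW L2gt0)//=; last by lra.
  by rewrite ler_pdivrMr// mul1r; lra.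
have LK0 : 0 <= 2 * L * K by rewrite mulr_ge0// ltW.
have tE : t = - L + 2 * L * rescale t by rewrite /rescale; field; rewrite gt_eqF.
have nodeE k : `|node k - t| = 2 * L * `|k%:R / N%:R - rescale t|.
  rewrite -[in RHS](gtr0_norm L2gt0) -normrM; congr (`|_|).
  by rewrite {1}tE /node; ring.
have [j ->|->] := unliftP ord0 i.
  rewrite partialS_bern_approx; apply: bern_error => //; first by rewrite leqnn leqnSn.
  move=> k _; apply: le_trans (HK _ _ _ _) _; rewrite nodeE mulrCA mulrA.
  by rewrite ler_wpM2l// lerDl invr_ge0 ltW.
rewrite partial0_bern_approx; apply: bern_error => //; first by rewrite leqnSn leqnn.
move=> k _.
have kk : node k < node k.+1.
  by rewrite /node ltrD2l ltr_pM2l// ltr_pM2r ?invr_gt0// ltr_nat.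
have sl := smooth1_line y (test_smooth tphi).
(* The difference quotient equals the derivative at a point z between two nodes; its distance to the
   left node accounts for the additional 1 / N. *)
have [z zI ez] := MVT kk (fun z _ => is_derive_line y z (test_smooth tphi))
  (continuous_subspaceT (smooth1_continuous sl)).
rewrite ez.
have -> : (2 * L)^-1 * N%:R * (partial ord0 phi (cons z y) * (node k.+1 - node k)) =
    partial ord0 phi (cons z y).
  by rewrite /node -natr1; field; rewrite !gt_eqF.
apply: le_trans (HK _ _ _ _) _.
rewrite [2 * L * K]mulrC -mulrA ler_wpM2l//.
rewrite mulrDr -nodeE; apply: (@le_trans _ _ (`|z - node k| + `|node k - t|)).
  by rewrite -[z - t](subrKA (node k)) ler_normD.
rewrite addrC lerD2l gtr0_norm; last by move: zI; rewrite in_itv/= subr_gt0 => /andP[].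
have -> : 2 * L * N%:R^-1 = node k.+1 - node k by rewrite /node -natr1; field; rewrite gt_eqF.
by move: zI; rewrite in_itv/= lerD2r => /andP[_ /ltW].
Qed.

End approx.

Lemma dform_smooth_le (u : 'rV[R]_n.+1 -> R) (c : R) : sobolevH1 Omega u -> smooth u ->
  (forall i x, Omega x -> `|partial i u x| <= c) ->
  dform Omega u u <= n.+1%:R * (c ^+ 2 * fine (lebesgue_rV n.+1 Omega)).
Proof.
move=> Hu su Hc.
have oO : open Omega := open_cylinder oomega.
have mO := open_measurable_rV oO.
have fO : (lebesgue_rV n.+1 Omega < +oo)%E.
  exact: lebesgue_rV_bounded mO bounded_cylinder.
have mp i : measurable_fun Omega (partial i u).
  by apply: measurable_funTS; apply: continuous_measurable_rV; apply: smooth_continuous; exact: smooth_partial.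
have Lp i : L2 Omega (partial i u) by exact: (sqint_bounded mO fO (mp i) (Hc i)).
have wE i : {ae lebesgue_rV n.+1, forall x, Omega x -> wpart Omega u i x = partial i u x}.
  by apply: (wpart_unique oO Hu (Lp i)); exact: smooth_weak_partial.
rewrite (dformE oO Hu Hu).
have -> : n.+1%:R * (c ^+ 2 * fine (lebesgue_rV n.+1 Omega)) =
    \sum_(i < n.+1) (c ^+ 2 * fine (lebesgue_rV n.+1 Omega)).
  by rewrite sumr_const card_ord mulr_natl.
apply: ler_sum => i _; have [Lw _] := wpartP i Hu.
rewrite (ae_eq_ip mO Lw.1 (Lp i).1 Lw.1 (wE i)) ipC.
rewrite (ae_eq_ip mO Lw.1 (Lp i).1 (Lp i).1 (wE i)) /ip -Rintegral_cst//.
apply: le_Rintegral => //.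
- exact: (sqint_integrableM mO (Lp i) (Lp i)).
- apply: measurable_bounded_integrable => //.
  by exists `|c ^+ 2|; split => // M cM x _ /=; exact: ltW.
move=> x Ox; rewrite -expr2 -(real_normK (num_real (partial i u x))).
have c0 : 0 <= c by apply: le_trans (Hc i x Ox).
by rewrite ler_pXn2r ?nnegrE// Hc.
Qed.

Lemma tens_dense (phi : 'rV[R]_n.+1 -> R) (e : R) : test_function Omega phi -> 0 < e ->
  exists N : nat, exists p : 'I_N -> R -> R, exists h : 'I_N -> 'rV[R]_n -> R,
  [/\ forall i, smooth1 (p i), forall i, p i L = 0 /\ p i (- L) = 0,
      forall i, test_function omega (h i) &
      let Phi x := \sum_(i < N) tens (p i) (h i) x in
      dform Omega (fun x => Phi x - phi x) (fun x => Phi x - phi x) < e].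
Proof.
move=> tphi e0.
have oO : open Omega := open_cylinder oomega.
have mO := open_measurable_rV oO.
have /choice[M HM] : forall i, exists M : R, 0 <= M /\ forall y t t',
    `|partial i phi (cons t y) - partial i phi (cons t' y)| <= M * `|t - t'|.
  by move=> i; have [M M0 HM] := test_lipschitz (test_partial i tphi); exists M.
pose K := \sum_i M i.
have K0 : 0 <= K by apply: sumr_ge0 => i _; have [] := HM i.
have HK i y t t' : `|partial i phi (cons t y) - partial i phi (cons t' y)| <= K * `|t - t'|.
  have [_ h] := HM i; apply: le_trans (h y t t') _; apply: ler_wpM2r => //.
  rewrite /K (bigD1 i)//= lerDl; apply: sumr_ge0 => j _; by have [] := HM j.
pose V := fine (lebesgue_rV n.+1 Omega).
have V0 : 0 <= V by rewrite fine_ge0// measure_ge0.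
have nV : 0 <= n.+1%:R * V by rewrite mulr_ge0.
(* The bound c on the partial derivatives is also at most 1, so that c^2 <= c and a condition linear
   in c suffices. *)
have [c c0 [c1 cV]] : exists2 c : R, 0 < c & c <= 1 /\ n.+1%:R * V * c < e.
  exists (Num.min 1 (e / (n.+1%:R * V + 1))).
    by rewrite lt_min ltr01 divr_gt0// ltr_wpDl.
  split; first by rewrite ge_min lexx.
  apply: (@le_lt_trans _ _ (n.+1%:R * V * (e / (n.+1%:R * V + 1)))).
    by rewrite ler_wpM2l// ge_min lexx orbT.
  by rewrite mulrA ltr_pdivrMr ?ltr_wpDl// mulrC ltr_pM2l// ltrDl.
have LK0 : 0 <= 2 * L * K by rewrite !mulr_ge0// ltW.
(* With degree N = m^2 and eta = 1/m the three error terms are 1/m, 1/m and 1/m^2, hence at most 3/m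
   in total. *)
pose m := (Num.truncn (2 * L * K * 3 / c)).+1.
have m0 : 0 < m%:R :> R by rewrite ltr0n.
have m1 : 1 <= m%:R :> R by rewrite ler1n.
have mc : 2 * L * K * (3 / m%:R) <= c.
  rewrite mulrA ler_pdivrMr// [c * _]mulrC -ler_pdivrMr//; apply: ltW; exact: truncnS_gt.
pose N' := (m * m).-1.
have N'S : N'.+1 = (m * m)%N by rewrite /N' prednK// muln_gt0.
exists N'.+2, (@bern_coef N'), (@bern_slice phi N'); split.
- exact: smooth1_bern_coef.
- by move=> i; rewrite bern_coefL bern_coefNL.
- exact: test_bern_slice.
have sb := smooth_bern_approx N' tphi.
have Hb : sobolevH1 Omega (bern_approx phi N').
  apply: H10_H1; apply: (H10_sum oO) => i; apply: (tens_H10 oomega L0).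
  - exact: smooth1_bern_coef.
  - exact: bern_coefL.
  - exact: bern_coefNL.
  - by apply: (test_H10 oomega); exact: test_bern_slice.
have Hphi := test_sobolevH1 mO tphi.
have Hd := H1B oO Hb Hphi.
have smd : smooth (fun x => bern_approx phi N' x + -1 * phi x).
  by apply: smoothD => //; apply: smoothZ; exact: test_smooth tphi.
have dE i x : partial i (fun x => bern_approx phi N' x + -1 * phi x) x =
    partial i (bern_approx phi N') x - partial i phi x.
  rewrite partialD; [|exact: smooth_diff|by apply: smooth_diff; apply: smoothZ; exact: test_smooth tphi].
  rewrite partialM; [|by apply: smooth_diff; exact: smooth_cst|by apply: smooth_diff; exact: test_smooth tphi].
  by rewrite partial_cst mul0r addr0 mulN1r.
rewrite (_ : (fun x => _ - phi x) = (fun x => bern_approx phi N' x + -1 * phi x)) in Hd *; last first.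
  by apply/funext => x; rewrite mulN1r.
have bound i x : Omega x -> `|partial i (fun x => bern_approx phi N' x + -1 * phi x) x| <= c.
  move=> Ox; rewrite dE.
  have mi : 0 < m%:R^-1 :> R by rewrite invr_gt0.
  have := @bern_approx_error phi N' tphi K _ mi K0 HK i x Ox; move=> /le_trans; apply.
  apply: le_trans mc; apply: ler_wpM2l => //; rewrite N'S natrM.
  rewrite mulfK ?gt_eqF// [leRHS](_ : _ = m%:R^-1 + m%:R^-1 + m%:R^-1); last by ring.
  by rewrite lerD2l invfM ler_piMl ?invr_ge0 ?invf_le1// ltW.
move=> Phi; have -> : (fun x => Phi x - phi x) = (fun x => bern_approx phi N' x + -1 * phi x).
  by apply/funext => x; rewrite mulN1r.
apply: le_lt_trans (dform_smooth_le Hd smd bound) _.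
apply: le_lt_trans cV; rewrite -mulrA ler_wpM2l// mulrC ler_wpM2l//.
by rewrite expr2 ler_piMl// ltW.
Qed.

End density.

(** * Simultaneous diagonalisation of two quadratic forms *)

Section symmetric_matrix.
Import mathcomp.real_closed.complex.
Variable R : rcfType.

(** Over the complex numbers the matrix is hermitian, hence diagonalisable with real eigenvalues;
    two real matrices that are similar over the complex numbers are similar over the reals. *)
Lemma sym_diagonalizable r (A : 'M[R]_r) : A^T = A ->
  exists (P : 'M[R]_r) (d : 'rV[R]_r), P \in unitmx /\ P *m A = diag_mx d *m P.
Proof.
move=> Asym; pose f := real_complex R; pose A' := map_mx f A.
have A'real : A' \is a mxOver Num.real.
  by apply/mxOverP => i j; rewrite mxE complex_real.
have A'herm : A' \is hermsymmx.
  apply: realsym_hermsym A'real; apply/is_hermitianmxP.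
  by rewrite expr0 scale1r map_mx_id// /A' map_trmx Asym.
have sdreal := hermitian_spectral_diag_real A'herm.
have /orthomx_spectralP A'E := hermitian_normalmx A'herm.
have sim : similar_in unitmx A' (diag_mx (spectral_diag A')).
  exists (spectralmx A'); first exact: spectral_unit.
  apply/(similarP (spectral_unit _)).
  by rewrite {2}A'E !mulmxA mulmxV ?spectral_unit// mul1mx.
have diagreal : diag_mx (spectral_diag A') \is a mxOver Num.real.
  apply/mxOverP => i j; rewrite mxE.
  by case: eqP => _; rewrite ?mulr1n ?mulr0n ?real0//; move/mxOverP: sdreal; exact.
have [P /andP[Preal Punit] /(similarP Punit) PA] := real_similar sim A'real diagreal.
pose P0 : 'M[R]_r := map_mx (@complex.Re R) P.
pose d0 : 'rV[R]_r := map_mx (@complex.Re R) (spectral_diag A').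
have toC (z : R[i]) : z \is Num.real -> f (complex.Re z) = z.
  by move=> zr; rewrite /f RRe_real.
have PE : P = map_mx f P0.
  by apply/matrixP => i j; rewrite !mxE toC//; move/mxOverP: Preal; exact.
have dE : spectral_diag A' = map_mx f d0.
  by apply/matrixP => i j; rewrite !mxE toC//; move/mxOverP: sdreal; exact.
exists P0, d0; split; first by rewrite PE map_unitmx in Punit.
apply: (@map_mx_inj _ _ f); rewrite !map_mxM map_diag_mx -dE -PE; exact: PA.
Qed.

(** The matrix [P] is merely invertible, so eigenvectors for the same eigenvalue need not be
    orthogonal. All components of c with a common eigenvalue are therefore collected in a single
    v_k; the other v_k of that class are 0. *)
Lemma sym_eigen_decomp r (A : 'M[R]_r) (c : 'rV[R]_r) : A^T = A ->
  exists (v : 'I_r -> 'rV[R]_r) (d : 'I_r -> R),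
    [/\ c = \sum_k v k, forall k, v k *m A = d k *: v k &
        forall j k, j != k -> v j *m (v k)^T = 0].
Proof.
move=> Asym; have [P [d [Pu PA]]] := sym_diagonalizable Asym.
have rowPA k : row k P *m A = d ord0 k *: row k P.
  by rewrite -row_mul PA row_mul row_diag_mx -scalemxAl -rowE.
have ortho j k : d ord0 j != d ord0 k -> row j P *m (row k P)^T = 0.
  move=> djk; have e : row j P *m A *m (row k P)^T = row j P *m (row k P *m A)^T.
    by rewrite trmx_mul Asym mulmxA.
  move: e; rewrite !rowPA linearZ/= -scalemxAl -scalemxAr => /eqP.
  by rewrite -subr_eq0 -scalerBl scaler_eq0 subr_eq0 (negbTE djk) => /eqP.
pose a := c *m invmx P.
(* A canonical index in the class of equal eigenvalues; the default is never reached, since j itself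
   satisfies the condition. *)
pose rep j := odflt j [pick i | d ord0 i == d ord0 j].
have repE j : d ord0 (rep j) = d ord0 j.
  by rewrite /rep; case: pickP => [i /eqP|].
have rep_eq j j' : d ord0 j = d ord0 j' -> rep j = rep j'.
  move=> e; rewrite /rep.
  have -> : [pick i | d ord0 i == d ord0 j] = [pick i | d ord0 i == d ord0 j'] by rewrite e.
  by case: pickP => // /(_ j'); rewrite eqxx.
pose v k := \sum_(j | rep j == k) a ord0 j *: row j P.
exists v, (fun k => d ord0 k); split.
- rewrite -[c](mulmxKV Pu) -/a mulmx_sum_row.
  by rewrite (partition_big rep xpredT).
- move=> k; rewrite /v mulmx_suml scaler_sumr; apply: eq_bigr => j /eqP jk.
  by rewrite -scalemxAl rowPA !scalerA mulrC -jk repE.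
- move=> j k jk; rewrite /v linear_sum/= mulmx_suml big1// => i /eqP ij.
  rewrite mulmx_sumr big1// => l /eqP lk.
  rewrite linearZ/= -scalemxAl -scalemxAr ortho ?scaler0//.
  by apply: contra jk => /eqP e; rewrite -ij -lk (rep_eq _ _ e).
Qed.

End symmetric_matrix.

Section eigen_decomposition.
Context {R : realType} {T : Type}.
Implicit Types (u v w : T -> R).
Variables (H : (T -> R) -> Prop) (b a : (T -> R) -> (T -> R) -> R).
Hypothesis HD : forall u v, H u -> H v -> H (fun x => u x + v x).
Hypothesis HZ : forall c u, H u -> H (fun x => c * u x).
Hypothesis H0 : H (fun=> 0).
Hypothesis bC : forall u v, b u v = b v u.
Hypothesis bD : forall u v w, H u -> H v -> H w -> b (fun x => u x + v x) w = b u w + b v w.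
Hypothesis bZ : forall c u w, H u -> H w -> b (fun x => c * u x) w = c * b u w.
Hypothesis b_ge0 : forall u, 0 <= b u u.
Hypothesis aC : forall u v, a u v = a v u.
Hypothesis aD : forall u v w, H u -> H v -> H w -> a (fun x => u x + v x) w = a u w + a v w.
Hypothesis aZ : forall c u w, H u -> H w -> a (fun x => c * u x) w = c * a u w.
Hypothesis a_null : forall u w, H u -> H w -> b u u = 0 -> a u w = 0.

(** Cauchy-Schwarz for a form that is only semidefinite. *)
Lemma b_null u w : H u -> H w -> b u u = 0 -> b u w = 0.
Proof.
move=> Hu Hw u0.
have : b w u ^+ 2 <= b w w * b u u.
  apply: discriminant_le => // t; have Htu := HZ t Hu; have Hs := HD Hw Htu.
  have := b_ge0 (fun x => w x + t * u x).
  rewrite (bD Hw Htu Hs) (bZ t Hu Hs) (bC w) (bC u) (bD Hw Htu Hw) (bD Hw Htu Hu).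
  rewrite (bZ t Hu Hw) (bZ t Hu Hu) (bC u w) => h; apply: le_trans h _.
  by rewrite le_eqVlt; apply/orP; left; apply/eqP; ring.
rewrite u0 mulr0 => h; have : b w u ^+ 2 = 0 by apply: le_anti; rewrite h sqr_ge0.
by move/eqP; rewrite sqrf_eq0 bC => /eqP.
Qed.

Lemma b0l w : H w -> b (fun=> 0) w = 0.
Proof.
move=> Hw; rewrite -[RHS](mul0r (b (fun=> 0) w)) -(bZ 0 H0 Hw).
by congr (b _ w); apply/funext => x; rewrite mul0r.
Qed.

Lemma a0l w : H w -> a (fun=> 0) w = 0.
Proof.
move=> Hw; rewrite -[RHS](mul0r (a (fun=> 0) w)) -(aZ 0 H0 Hw).
by congr (a _ w); apply/funext => x; rewrite mul0r.
Qed.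

Lemma H_sum I (r : seq I) (c : I -> R) (e : I -> T -> R) : (forall i, H (e i)) ->
  H (fun x => \sum_(i <- r) c i * e i x).
Proof.
move=> He; elim: r => [|i r IH]; first by under eq_fun do rewrite big_nil.
by under eq_fun do rewrite big_cons; exact: HD (HZ _ (He i)) IH.
Qed.

Lemma b_sum I (r : seq I) (c : I -> R) (e : I -> T -> R) w : (forall i, H (e i)) -> H w ->
  b (fun x => \sum_(i <- r) c i * e i x) w = \sum_(i <- r) c i * b (e i) w.
Proof.
move=> He Hw; elim: r => [|i r IH].
  by rewrite big_nil -[RHS](b0l Hw); congr (b _ w); apply/funext => x; rewrite big_nil.
rewrite big_cons -IH -(bZ (c i) (He i) Hw) -bD//; [|exact: HZ|exact: H_sum].
by congr (b _ w); apply/funext => x; rewrite big_cons.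
Qed.

Lemma a_sum I (r : seq I) (c : I -> R) (e : I -> T -> R) w : (forall i, H (e i)) -> H w ->
  a (fun x => \sum_(i <- r) c i * e i x) w = \sum_(i <- r) c i * a (e i) w.
Proof.
move=> He Hw; elim: r => [|i r IH].
  by rewrite big_nil -[RHS](a0l Hw); congr (a _ w); apply/funext => x; rewrite big_nil.
rewrite big_cons -IH -(aZ (c i) (He i) Hw) -aD//; [|exact: HZ|exact: H_sum].
by congr (a _ w); apply/funext => x; rewrite big_cons.
Qed.

Definition proj r (e : 'I_r -> T -> R) u : T -> R :=
  fun x => \sum_(i < r) b u (e i) * e i x.

(** Written with [-1 *] so that the closure properties [HD] and [HZ] apply as they stand. *)
Definition resid r (e : 'I_r -> T -> R) u : T -> R :=
  fun x => u x + -1 * proj e u x.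

Lemma H_resid r (e : 'I_r -> T -> R) u : (forall i, H (e i)) -> H u -> H (resid e u).
Proof. by move=> He Hu; apply: HD => //; apply: HZ; exact: H_sum. Qed.

Lemma b_resid r (e : 'I_r -> T -> R) u w : (forall i, H (e i)) -> H u -> H w ->
  b (resid e u) w = b u w - \sum_(i < r) b u (e i) * b (e i) w.
Proof.
move=> He Hu Hw; have Hp := H_sum (index_enum 'I_r) (fun i => b u (e i)) He.
by rewrite /resid bD//; [rewrite bZ// mulN1r b_sum|exact: HZ].
Qed.

(** A vector is added, after normalisation, only if its residual has positive norm. As [b] may be
    degenerate, each h k equals its projection only up to a null vector. *)
Lemma gram_schmidt N (h : nat -> T -> R) : (forall k, H (h k)) ->
  exists r, exists e : 'I_r -> T -> R,
    [/\ forall i, H (e i), forall i j, b (e i) (e j) = (i == j)%:R &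
        forall k, (k < N)%N -> b (resid e (h k)) (resid e (h k)) = 0].
Proof.
move=> Hh; elim: N => [|N [r [e [He on nul]]]].
  by exists 0%N, (fun _ _ => 0); split => // -[].
pose x := resid e (h N); have Hx : H x by exact: H_resid.
have [x0|xn0] := eqVneq (b x x) 0.
  exists r, e; split => // k; rewrite ltnS leq_eqVlt => /predU1P[->//|]; exact: nul.
have xe i : b x (e i) = 0.
  rewrite b_resid// (bigD1 i)//= on eqxx mulr1 big1 ?addr0 ?subrr// => j ji.
  by rewrite on (negbTE ji) mulr0.
have bx0 : 0 < b x x by rewrite lt_def xn0 b_ge0.
pose s := Num.sqrt (b x x).
have s0 : 0 < s by rewrite sqrtr_gt0.
have ss : s ^+ 2 = b x x by rewrite sqr_sqrtr// ltW.
pose x' y := s^-1 * x y.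
have Hx' : H x' by exact: HZ.
have x'x' : b x' x' = 1.
  rewrite /x' bZ// bC bZ// -ss mulrA -expr2 -exprMn mulVf ?expr1n//.
  by rewrite gt_eqF.
have x'e i : b x' (e i) = 0 by rewrite /x' bZ// xe mulr0.
pose e' (i : 'I_r.+1) := oapp e x' (unlift ord0 i).
have e'0 : e' ord0 = x' by rewrite /e' unlift_none.
have e'S i : e' (lift ord0 i) = e i by rewrite /e' liftK.
have He' i : H (e' i).
  by have [j ->|->] := unliftP ord0 i; rewrite ?e'0 ?e'S.
exists r.+1, e'; split => //.
  move=> i j; have [i' ->|->] := unliftP ord0 i; have [j' ->|->] := unliftP ord0 j;
    rewrite ?e'0 ?e'S ?on ?x'x' ?x'e ?(inj_eq lift_inj)//.
  by rewrite bC x'e.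
have resE u : H u -> resid e' u = fun y => resid e u y + (- b u x') * x' y.
  move=> Hu; apply/funext => y; rewrite /resid /proj big_ord_recl e'0.
  under eq_bigr do rewrite e'S.
  by ring.
move=> k; rewrite ltnS leq_eqVlt => /predU1P[->|kN].
  have Hr := H_resid He' (Hh N).
  rewrite {1}resE// -/x.
  have -> : b (h N) x' = s.
    have e1 : b x x' = b (h N) x'.
      rewrite /x b_resid// big1 ?subr0// => i _; by rewrite (bC (e i)) x'e mulr0.
    rewrite -e1 bC /x' bZ// -ss expr2 mulKf//; by rewrite gt_eqF.
  have -> : (fun y => x y + - s * x' y) = (fun=> 0).
    apply/funext => y; rewrite /x' mulrA mulNr divff ?gt_eqF//.
    by rewrite mulN1r subrr.
  exact: b0l.
have Hrk := H_resid He (Hh k).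
(* The residual of an earlier h k is null, hence orthogonal to the new vector x', and x' is
   orthogonal to the old family: the residual of h k does not change. *)
have hx' : b (h k) x' = 0.
  have := b_resid He (Hh k) Hx'.
  rewrite (b_null Hrk Hx' (nul k kN)) big1 ?subr0 => [<-//|i _].
  by rewrite (bC (e i)) x'e mulr0.
rewrite resE// hx' oppr0.
by under eq_fun do rewrite mul0r addr0; exact: nul.
Qed.

(* The last clause says that [h 0] is the sum of the [v i], up to a vector in the kernel
   of [b]. *)
Lemma eigen_decomp N (h : nat -> T -> R) : (0 < N)%N -> (forall k, H (h k)) ->
  exists r, exists (v : 'I_r -> T -> R) (d : 'I_r -> R),
    [/\ forall i, H (v i),
        forall i j, i != j -> b (v i) (v j) = 0,
        forall i j, a (v i) (v j) = d i * b (v i) (v j),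
        forall i k, (k < N)%N -> a (v i) (h k) = d i * b (v i) (h k) &
        forall w, H w -> b (h 0%N) w = \sum_i b (v i) w /\ a (h 0%N) w = \sum_i a (v i) w].
Proof.
move=> N0 Hh; have [r [e [He on nul]]] := gram_schmidt N Hh.
(* In the [b]-orthonormal family the form [b] becomes the standard product of coordinate rows and
   [a] the symmetric matrix [A], so eigenvectors of [A] diagonalise both. *)
pose A : 'M[R]_r := \matrix_(i, j) a (e i) (e j).
pose c u : 'rV[R]_r := \row_i b u (e i).
pose lin (x : 'rV[R]_r) : T -> R := fun y => \sum_i x ord0 i * e i y.
have Hlin x : H (lin x) by exact: H_sum.
have be x j : b (lin x) (e j) = x ord0 j.
  rewrite b_sum// (bigD1 j)//= on eqxx mulr1 big1 ?addr0// => i ij.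
  by rewrite on (negbTE ij) mulr0.
have blin x y : b (lin x) (lin y) = (x *m y^T) ord0 ord0.
  rewrite bC b_sum// mxE; apply: eq_bigr => j _; rewrite bC be mxE.
  by rewrite mulrC.
have ae x j : a (lin x) (e j) = (x *m A) ord0 j.
  by rewrite a_sum// mxE; apply: eq_bigr => i _; rewrite mxE.
have alin x y : a (lin x) (lin y) = (x *m A *m y^T) ord0 ord0.
  rewrite aC a_sum// mxE; apply: eq_bigr => j _; rewrite aC ae mxE.
  by rewrite mulrC [in RHS]mxE.
have Asym : A^T = A by apply/matrixP => i j; rewrite !mxE aC.
have [x [d [cE xA xo]]] := sym_eigen_decomp (c (h 0%N)) Asym.
have projE u : proj e u = lin (c u).
  by apply/funext => y; apply: eq_bigr => i _; rewrite mxE.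
have uE u : u = fun y => lin (c u) y + resid e u y.
  by apply/funext => y; rewrite /resid projE; ring.
(* Neither form sees the difference between h k and its projection on the span. *)
have bnul k w : (k < N)%N -> H w -> b (h k) w = b (lin (c (h k))) w.
  move=> kN Hw; have Hr := H_resid He (Hh k).
  by rewrite {1}(uE (h k)) bD// (b_null Hr Hw (nul k kN)) addr0.
have anul k w : (k < N)%N -> H w -> a (h k) w = a (lin (c (h k))) w.
  move=> kN Hw; have Hr := H_resid He (Hh k).
  by rewrite {1}(uE (h k)) aD// (a_null Hr Hw (nul k kN)) addr0.
exists r, (fun i => lin (x i)), d.
have al i y : a (lin (x i)) (lin y) = d i * b (lin (x i)) (lin y).
  by rewrite alin blin xA -scalemxAl mxE.
split => //.
- by move=> i j ij; rewrite blin xo// mxE.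
- by move=> i k kN; rewrite aC anul// aC al bC -bnul// bC.
- move=> w Hw; rewrite bnul// anul//.
  have -> : lin (c (h 0%N)) = fun y => \sum_i 1 * lin (x i) y.
    apply/funext => y; rewrite cE /lin.
    under eq_bigr do rewrite summxE mulr_suml.
    by rewrite exchange_big/=; apply: eq_bigr => i _; rewrite mul1r.
  rewrite b_sum// a_sum//; split; apply: eq_bigr => i _; by rewrite mul1r.
Qed.

End eigen_decomposition.

(** * The Poincare inequality *)

Section poincare.
Context {R : realType} (n : nat) (D : set 'rV[R]_n.+1).
Hypotheses (oD : open D) (bD : bounded_set D).
Notation nu := (@lebesgue_rV R n.+1).
Notation ip := (ip nu D).
Let mD : measurable D := open_measurable_rV oD.

(* Integrate the derivative of [x_0 * phi ^ 2]. *)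
Lemma poincare_test : exists2 C : R, 0 < C & forall phi, test_function D phi ->
  ip phi phi <= C * ip (partial ord0 phi) (partial ord0 phi).
Proof.
have [M M0 HM] := bounded_rVP bD.
(* Integrating the derivative gives |phi|^2 = -2 (phi, x_0 d_0 phi). As |x_0| < M on [D],
   Cauchy-Schwarz yields |phi|^4 <= 4 M^2 |phi|^2 |d_0 phi|^2. *)
exists (4 * M ^+ 2) => [|phi tphi]; first by rewrite mulr_gt0// exprn_gt0.
have sphi := test_smooth tphi.
have Lphi := test_L2 mD tphi.
have Ld := test_L2 mD (test_partial ord0 tphi).
pose x0 (x : 'rV[R]_n.+1) : R := x ord0 ord0.
have sx0 : smooth x0 by apply: (smooth_coord (p := id)); exact: smooth1_id.
have Lxd : L2 D (fun x => x0 x * partial ord0 phi x).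
  apply: (sqintM_bounded mD (M := M) Ld).
    by apply: measurable_funTS; exact: measurable_coord.
  by move=> x Dx; apply: ltW; exact: HM.
have t2 : test_function D (fun x => x0 x * (phi x * phi x)).
  by apply: testM => //; exact: testM.
have := integral_partial_test ord0 t2.
have -> : partial ord0 (fun x => x0 x * (phi x * phi x)) =
    fun x => 2 * (phi x * (x0 x * partial ord0 phi x)) + phi x * phi x.
  rewrite partialM; [|exact: smooth_diff|by apply: smooth_diff; exact: smoothM].
  rewrite partialM; [|exact: smooth_diff|exact: smooth_diff].
  have -> : partial ord0 x0 = fun=> 1.
    rewrite /x0 (partial_coord (fun t => t)) eqxx; apply/funext => x.
    exact: derive1_id.
  by apply/funext => x; ring.
rewrite RintegralD//; last 2 first.
- by apply: (@eq_integrable _ _ _ _ _ _ _ _ _ (integrableZl mD 2 (sqint_integrableM mD Lphi Lxd))).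
- exact: (sqint_integrableM mD Lphi Lphi).
rewrite RintegralZl//; last exact: (sqint_integrableM mD Lphi Lxd).
rewrite -/(ip _ _) -/(ip phi phi) => e.
have cs := ip_CS mD Lphi Lxd.
have xd : ip (fun x => x0 x * partial ord0 phi x) (fun x => x0 x * partial ord0 phi x) <=
    M ^+ 2 * ip (partial ord0 phi) (partial ord0 phi).
  rewrite /ip -RintegralZl//; last exact: (sqint_integrableM mD Ld Ld).
  apply: le_Rintegral => //.
  - exact: (sqint_integrableM mD Lxd Lxd).
  - by have := integrableZl mD (M ^+ 2) (sqint_integrableM mD Ld Ld).
  move=> x Dx; rewrite -!expr2 exprMn ler_wpM2r ?sqr_ge0//.
  rewrite -(real_normK (num_real (x0 x))) ler_pXn2r ?nnegrE//; last exact: ltW.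
  by apply: ltW; exact: HM.
have p0 := ip_ge0 nu D phi.
have d0 := ip_ge0 nu D (partial ord0 phi).
move: xd cs e p0 d0; set X := ip _ _; set Y := ip phi _; set P := ip phi phi; set Q := ip _ _.
move: X Y P Q => X Y P Q xd cs e p0 d0; clear -xd cs e p0 d0 M0.
have Y2 : P ^+ 2 = 4 * Y ^+ 2.
  have -> : P = - (2 * Y) by lra.
  by ring.
have PX : P ^+ 2 <= P * (4 * (M ^+ 2 * Q)).
  by rewrite Y2 [leRHS]mulrCA ler_pM2l//; apply: le_trans cs _; apply: ler_wpM2l.
have [->|P0] := eqVneq P 0; first by rewrite mulr_ge0// mulr_ge0// sqr_ge0.
by rewrite -mulrA; move: PX; rewrite expr2 ler_pM2l// lt_def P0.
Qed.

Lemma poincare : exists2 C : R, 0 < C & forall v, sobolevH10 D v ->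
  ip v v <= C * dform D v v.
Proof.
have [C C0 HC] := poincare_test.
exists (4 * C) => [|v Hv]; first by rewrite mulr_gt0.
have Hv1 := H10_H1 Hv; have /(H10P oD)[_ Av] := Hv.
apply/ler_addgt0Pr => e e0.
(* Passing from v to phi and back costs two factors 2: with X the squared H^1 distance, |v|^2 <= 4 C
   a(v, v) + (4 C + 2) X. *)
have e1 : 0 < e / (4 * C + 2) by rewrite divr_gt0// addr_gt0// mulr_gt0.
have [phi tphi hphi] := Av _ e1.
have Hphi := test_sobolevH1 mD tphi.
have Hmp := H1B oD Hphi Hv1; have Hpm := H1Z oD (-1) Hmp.
have h1 : ip v v <= 2 * ip phi phi + 2 * H1sq D (fun x => phi x - v x).
  have Lphi := H1_L2 Hphi; have Lpm := H1_L2 Hpm.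
  have := ip_triangle2 mD Lphi Lpm.
  have -> : (fun x => phi x + -1 * (phi x - v x)) = v by apply/funext => x; ring.
  move/le_trans; apply; rewrite lerD2l ler_wpM2l//.
  have := H1sqZ oD (-1) Hmp; rewrite sqrrN expr1n mul1r => <-.
  by rewrite /H1sq lerDl dform_ge0.
have h2 : dform D phi phi <= 2 * dform D v v + 2 * H1sq D (fun x => phi x - v x).
  have := dform_triangle2 oD Hv1 Hmp.
  have -> : (fun x => v x + (phi x - v x)) = phi by apply/funext => x; ring.
  move/le_trans; apply; rewrite lerD2l ler_wpM2l//.
  by rewrite /H1sq lerDr ip_ge0.
have h3 : ip phi phi <= C * dform D phi phi.
  apply: le_trans (HC _ tphi) _; rewrite ler_pM2l// (dformE oD Hphi Hphi) big_ord_recl.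
  have [Lw _] := wpartP ord0 Hphi; have Lp := test_L2 mD (test_partial ord0 tphi).
  have wE := smooth_wpart oD ord0 tphi.
  rewrite (ae_eq_ip mD Lw.1 Lp.1 Lw.1 wE) ipC.
  rewrite (ae_eq_ip mD Lw.1 Lp.1 Lp.1 wE) lerDl.
  by apply: sumr_ge0 => i _; exact: ip_ge0.
have h4 : (4 * C + 2) * H1sq D (fun x => phi x - v x) <= e.
  by rewrite mulrC -ler_pdivlMr ?addr_gt0 ?mulr_gt0// ltW.
move: h1 h2 h3 h4; move: (H1sq D _) (ip v v) (ip phi phi) (dform D phi phi) (dform D v v).
move=> X a b c d; clear -C0 => h1 h2 h3 h4.
have h5 : C * c <= C * (2 * d + 2 * X) by rewrite ler_pM2l.
lra.
Qed.

Lemma L2norm_gt0 v : sobolevH1 D v -> ~ ae_zero D v -> 0 < L2norm D v.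
Proof.
move=> Hv vn0; rewrite lt_def sqrtr_ge0 andbT; apply/eqP => v0; apply: vn0.
by apply: (ip_eq0_ae mD (H1_L2 Hv)); rewrite -L2norm_sq v0 expr0n.
Qed.

(** For v of zero norm, where the quotient is a default value, both sides are 0. *)
Lemma rayleigh_sq v : sobolevH1 D v -> rayleigh D v ^+ 2 * ip v v = dform D v v.
Proof.
move=> Hv; have [v0|vn0] := eqVneq (ip v v) 0.
  by rewrite v0 mulr0 (H1_ip0_dform0 oD Hv Hv v0).
rewrite /rayleigh exprMn exprVn L2norm_sq L2norm_wgrad_sq.
by rewrite divfK.
Qed.

Lemma rayleigh_ge0 v : 0 <= rayleigh D v.
Proof. by rewrite divr_ge0 ?sqrtr_ge0. Qed.

Lemma lambda1_le_rayleigh v : sobolevH10 D v -> ~ ae_zero D v -> lambda1 D <= rayleigh D v.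
Proof.
move=> Hv vn0; apply: ge_inf; last by exists v.
by exists 0 => _ [u _ <-]; exact: rayleigh_ge0.
Qed.

(** The Poincare constant bounds every quotient from below by C^(-1/2); the witness v makes the set
    of quotients nonempty, so that its infimum is a genuine one. *)
Lemma lambda1_gt0 v : sobolevH10 D v -> ~ ae_zero D v -> 0 < lambda1 D.
Proof.
move=> Hv vn0; have [C C0 HC] := poincare.
have sC : 0 < Num.sqrt C by rewrite sqrtr_gt0.
apply: (@lt_le_trans _ _ (Num.sqrt C)^-1); first by rewrite invr_gt0.
apply: lb_le_inf; first by exists (rayleigh D v), v.
move=> _ [u [Hu un0] <-]; have Hu1 := H10_H1 Hu.
have n0 := L2norm_gt0 Hu1 un0.
rewrite /rayleigh ler_pdivlMr// -(@ler_pXn2r _ 2) ?nnegrE ?sqrtr_ge0//; last first.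
  by rewrite mulr_ge0 ?invr_ge0// ltW.
rewrite exprMn exprVn sqr_sqrtr; last exact: ltW.
by rewrite L2norm_sq L2norm_wgrad_sq ler_pdivrMl// HC.
Qed.

End poincare.

(** * Restriction and Galerkin orthogonality *)

Section restriction.
Context {R : realType} (n : nat) (A D : set 'rV[R]_n).
Hypotheses (oA : open A) (oD : open D) (AD : A `<=` D).
Notation nu := (@lebesgue_rV R n).
Implicit Types (u g : 'rV[R]_n -> R).
Let mA : measurable A := open_measurable_rV oA.
Let mD : measurable D := open_measurable_rV oD.

Lemma L2_sub g : L2 D g -> L2 A g.
Proof.
by move=> [mg ig]; split; [exact: measurable_funS mg|exact: integrableS ig].
Qed.

(** A test function on the smaller set is one on the larger set, and the integrands vanish outside
    the smaller one. *)
Lemma weak_partial_sub i u g : weak_partial D i u g -> weak_partial A i u g.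
Proof.
move=> wg phi tphi; have := wg _ (test_sub AD tphi).
have out (f psi : 'rV[R]_n -> R) : test_function A psi ->
    \int[nu]_(x in D) (f x * psi x) = \int[nu]_(x in A) (f x * psi x).
  move=> tpsi; rewrite -[RHS]Rintegral_out => [|x Ax]; last by rewrite (test_out tpsi Ax) mulr0.
  rewrite -[LHS]Rintegral_out// => x Dx.
  by rewrite (test_out (test_sub AD tpsi) Dx) mulr0.
by rewrite (out _ _ tphi) (out _ _ (test_partial i tphi)).
Qed.

Lemma H1_sub u : sobolevH1 D u -> sobolevH1 A u.
Proof.
move=> [Lu Hu]; split; first exact: L2_sub.
by move=> i; have [g [Lg wg]] := Hu i; exists g; split; [exact: L2_sub|exact: weak_partial_sub].
Qed.

Lemma wpart_sub u i : sobolevH1 D u ->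
  {ae nu, forall x, A x -> wpart A u i x = wpart D u i x}.
Proof.
move=> Hu; have [Lw ww] := wpartP i Hu.
by apply: (wpart_unique oA (H1_sub Hu)); [exact: L2_sub|exact: weak_partial_sub].
Qed.

(** The theorem integrates over the smaller cylinder a gradient chosen on the larger one; the two
    choices agree almost everywhere on the smaller set. *)
Lemma L2norm_wgrad_sub u : sobolevH1 D u ->
  L2norm_field A (wgrad D u) ^+ 2 = dform A u u.
Proof.
move=> Hu; have HuA := H1_sub Hu.
have LA i : L2 A (wpart A u i) by exact: wpart_L2.
have LD i : L2 A (wpart D u i) by apply: L2_sub; exact: wpart_L2.
rewrite /L2norm_field sqr_sqrtr; last first.
  by apply: Rintegral_ge0 => x _; apply: sumr_ge0 => i _; rewrite -expr2 sqr_ge0.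
rewrite (dformE oA HuA HuA) /dotv Rintegral_sum//; last first.
  by move=> i; exact: (sqint_integrableM mA (LD i) (LD i)).
apply: eq_bigr => i _; rewrite (ae_eq_ip mA (LA i).1 (LD i).1 (LA i).1 (wpart_sub i Hu)).
by rewrite ipC (ae_eq_ip mA (LA i).1 (LD i).1 (LD i).1 (wpart_sub i Hu)).
Qed.

Lemma dform_sub_le u : sobolevH1 D u -> dform A u u <= dform D u u.
Proof.
move=> Hu; rewrite -L2norm_wgrad_sub// -(L2norm_wgrad_sq D) /L2norm_field.
have nn x : 0 <= dotv (wgrad D u x) (wgrad D u x).
  by apply: sumr_ge0 => i _; rewrite -expr2 sqr_ge0.
have iD : nu.-integrable D (EFin \o (fun x => dotv (wgrad D u x) (wgrad D u x))).
  rewrite (_ : _ \o _ = fun x => \sum_(i < n) (wpart D u i x * wpart D u i x)%:E).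
    apply: integrable_sum => // i _.
    exact: (sqint_integrableM mD (wpart_L2 i Hu) (wpart_L2 i Hu)).
  by apply/funext => x; rewrite sumEFin.
have iA := integrableS mD mA AD iD.
rewrite !sqr_sqrtr ?Rintegral_ge0//; apply: fine_le.
- exact: integrable_fin_num.
- exact: integrable_fin_num.
- apply: ge0_subset_integral => //; first by case/integrableP: iD.
  by move=> x _; rewrite lee_fin.
Qed.

End restriction.

(** * Galerkin orthogonality and passage to the limit in the Dirichlet form *)

Section dform_lemmas.
Context {R : realType} (n : nat) (D : set 'rV[R]_n).
Hypothesis oD : open D.
Implicit Types (u v w : 'rV[R]_n -> R).

Lemma H1_0 : sobolevH1 D (fun=> 0).
Proof. exact: H10_H1 (H10_0 oD). Qed.

Lemma H1_sum I (r : seq I) (F : I -> 'rV[R]_n -> R) :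
  (forall i, sobolevH1 D (F i)) -> sobolevH1 D (fun x => \sum_(i <- r) F i x).
Proof.
move=> HF; elim: r => [|i r IH]; first by under eq_fun do rewrite big_nil; exact: H1_0.
by under eq_fun do rewrite big_cons; exact: H1D.
Qed.

Lemma dform0l w : sobolevH1 D w -> dform D (fun=> 0) w = 0.
Proof.
move=> Hw; rewrite -[RHS](mul0r (dform D (fun=> 0) w)) -(dformZl oD 0 H1_0 Hw).
by congr (dform D _ w); apply/funext => x; rewrite mul0r.
Qed.

Lemma dform_suml I (r : seq I) (F : I -> 'rV[R]_n -> R) w :
  (forall i, sobolevH1 D (F i)) -> sobolevH1 D w ->
  dform D (fun x => \sum_(i <- r) F i x) w = \sum_(i <- r) dform D (F i) w.
Proof.
move=> HF Hw; elim: r => [|i r IH].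
  rewrite big_nil -[RHS](dform0l Hw); congr (dform D _ w).
  by apply/funext => x; rewrite big_nil.
rewrite big_cons -IH -(dformDl oD (HF i) (H1_sum r HF) Hw).
by congr (dform D _ w); apply/funext => x; rewrite big_cons.
Qed.

Lemma dformBl u v w : sobolevH1 D u -> sobolevH1 D v -> sobolevH1 D w ->
  dform D (fun x => u x - v x) w = dform D u w - dform D v w.
Proof.
move=> Hu Hv Hw; rewrite -mulN1r -(dformZl oD (-1) Hv Hw).
rewrite -(dformDl oD Hu (H1Z oD (-1) Hv) Hw).
by congr (dform D _ w); apply/funext => x; rewrite mulN1r.
Qed.

Lemma dform_subC u v : sobolevH1 D u -> sobolevH1 D v ->
  dform D (fun x => u x - v x) (fun x => u x - v x) =
  dform D (fun x => v x - u x) (fun x => v x - u x).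
Proof.
move=> Hu Hv; have Huv := H1B oD Hu Hv; have Hvu := H1B oD Hv Hu.
rewrite [X in dform D X _](_ : _ = fun x => -1 * (v x - u x)); last first.
  by apply/funext => x; rewrite mulN1r opprB.
rewrite (dformZl oD (-1) Hvu Huv) dformC.
rewrite [X in dform D X _](_ : _ = fun x => -1 * (v x - u x)); last first.
  by apply/funext => x; rewrite mulN1r opprB.
by rewrite (dformZl oD (-1) Hvu Hvu) mulrA mulrNN !mul1r.
Qed.

(** As e is orthogonal to v - u, the vector w - u = e + (v - u) is an orthogonal sum. *)
Lemma dform_galerkin w v u : sobolevH1 D w -> sobolevH1 D v -> sobolevH1 D u ->
  let e x := w x - v x in
  dform D e v = 0 -> dform D e u = 0 ->
  dform D e e <= dform D (fun x => w x - u x) (fun x => w x - u x).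
Proof.
move=> Hw Hv Hu e ev eu; have He : sobolevH1 D e by exact: H1B.
have Hwu := H1B oD Hw Hu.
have ue : dform D u e = 0 by rewrite dformC.
have ve : dform D v e = 0 by rewrite dformC.
have := dformBl Hw Hv He; have := dformBl Hw Hu He; have := dform_polar oD (-1) Hwu He.
have := dform_ge0 D (fun x => (w x - u x) + -1 * e x).
rewrite ue ve -/e; move: (dform D (fun x => w x - u x + _) _) (dform D (fun x => w x - u x) e).
move: (dform D e e) (dform D w e) (dform D (fun x => w x - u x) _); clear => a b c x y; lra.
Qed.

(** The energy bound is kept by approximation in energy: |w|^2 <= (1 + t) |v|^2 + (1 + 1/t) |w -
    v|^2. With the distance squared at most t^2 and t <= 1, the excess over B is at most t B + t^2 +
    t <= t (B + 2). *)
Lemma dform_near_le w (B : R) : sobolevH1 D w -> 0 <= B ->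
  (forall e, 0 < e -> exists v, [/\ sobolevH1 D v, dform D v v <= B &
     dform D (fun x => w x - v x) (fun x => w x - v x) <= e]) ->
  dform D w w <= B.
Proof.
move=> Hw B0 H; apply/ler_addgt0Pr => e e0.
pose t := Num.min 1 (e / (B + 2)).
have B2 : 0 < B + 2 by rewrite ltr_wpDl.
have t0 : 0 < t by rewrite lt_min ltr01 divr_gt0.
have t1 : t <= 1 by rewrite ge_min lexx.
have te : t * (B + 2) <= e by rewrite -ler_pdivlMr// ge_min lexx orbT.
have [v [Hv vB hv]] := H (t ^+ 2) (exprn_gt0 _ t0).
have Hwv := H1B oD Hw Hv.
have := dform_ge0 D (fun x => (w x - v x) + - t * v x).
rewrite (dform_polar oD (- t) Hwv Hv).
have := dform_polar oD 1 Hwv Hv.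
have -> : (fun x => w x - v x + 1 * v x) = w by apply/funext => x; ring.
move=> ->; move: vB hv.
move: (dform D v v) (dform D (fun x => w x - v x) v) (dform D (fun x => w x - v x) _) => a b c.
clear -t0 t1 te B0 => aB ct h.
have h1 : c / t <= t by rewrite ler_pdivrMr// -expr2.
have h2 : 0 <= c / t - 2 * b + t * a.
  have -> : c / t - 2 * b + t * a = (c + 2 * - t * b + (- t) ^+ 2 * a) / t.
    by field; rewrite gt_eqF.
  by rewrite divr_ge0// ltW.
have h3 : t * a <= t * B by rewrite ler_pM2l.
have h4 : t ^+ 2 <= t by rewrite expr2 ler_piMl// ltW.
move: h1 h2 h3 h4 ct aB te; rewrite mulrDr.
move: (c / t) (t * a) (t * B) (t ^+ 2) => x y z s; lra.
Qed.

End dform_lemmas.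

(** * Hyperbolic cosine profiles *)

Section hyperbolic.
Context {R : realType}.
Notation mu := (@lebesgue_measure R).
Implicit Types (p q : R -> R) (a b c l t L : R).

Definition sinhR t : R := (expR t - expR (- t)) / 2.

Definition gcosh l b t : R := coshR (b * t) / coshR (b * l).

Lemma coshR_gt0 t : 0 < coshR t.
Proof. by rewrite divr_gt0// addr_gt0// expR_gt0. Qed.

Lemma coshRN t : coshR (- t) = coshR t.
Proof. by rewrite /coshR opprK addrC. Qed.

Lemma derive1_expR : derive1 (@expR R) = @expR R.
Proof. by rewrite -[RHS]derive_expR; apply/funext => x; rewrite derive1E. Qed.

Lemma smooth1_expR : smooth1 (@expR R).
Proof.
apply: (@smooth1_coind _ (fun f => f = @expR R)) => // _ ->.
by rewrite derive1_expR; split => // x; exact: derivable_expR.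
Qed.

Lemma smooth1_expRM c : smooth1 (fun t => expR (c * t)).
Proof. by apply: (smooth1_comp _ smooth1_expR); apply: smooth1Z; exact: smooth1_id. Qed.

Lemma derive1_expRM c : derive1 (fun t => expR (c * t)) = fun t => c * expR (c * t).
Proof.
have sc : smooth1 (fun t : R => c * t) by apply: smooth1Z; exact: smooth1_id.
rewrite (derive1_compE (smooth1_derivable sc) (smooth1_derivable smooth1_expR)).
rewrite derive1_expR (derive1Z c smooth1_id).
by apply/funext => t; rewrite derive1_id mulr1 mulrC.
Qed.

Lemma gcoshE l b : gcosh l b =
  fun t => (2 * coshR (b * l))^-1 * (expR (b * t) + expR (- b * t)).
Proof.
apply/funext => t; rewrite /gcosh /coshR mulNr; have := coshR_gt0 (b * l).
by rewrite /coshR => h; field; move: h; rewrite pmulr_lgt0// => /gt_eqF ->.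
Qed.

Lemma smooth1_gcosh l b : smooth1 (gcosh l b).
Proof.
by rewrite gcoshE; apply: smooth1Z; apply: smooth1D; exact: smooth1_expRM.
Qed.

Lemma derive1_gcosh l b : derive1 (gcosh l b) = fun t => b * sinhR (b * t) / coshR (b * l).
Proof.
rewrite gcoshE derive1Z; last by apply: smooth1D; exact: smooth1_expRM.
rewrite (derive1D (smooth1_derivable (smooth1_expRM b)) (smooth1_derivable (smooth1_expRM (- b)))).
rewrite !derive1_expRM; apply/funext => t; rewrite /sinhR !mulNr.
by field; rewrite gt_eqF// coshR_gt0.
Qed.

Lemma derive1_derive1_gcosh l b : derive1 (derive1 (gcosh l b)) = fun t => b ^+ 2 * gcosh l b t.
Proof.
have -> : derive1 (gcosh l b) =
    fun t => b / (2 * coshR (b * l)) * (expR (b * t) + -1 * expR (- b * t)).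
  rewrite derive1_gcosh; apply/funext => t; rewrite /sinhR !mulNr.
  by field; rewrite gt_eqF// coshR_gt0.
have sm := smooth1Z (-1) (smooth1_expRM (- b)).
rewrite derive1Z; last by apply: smooth1D => //; exact: smooth1_expRM.
rewrite (derive1D (smooth1_derivable (smooth1_expRM b)) (smooth1_derivable sm)).
rewrite (derive1Z _ (smooth1_expRM _)) !derive1_expRM.
apply/funext => t; rewrite /gcosh; move: (coshR_gt0 (b * l)); move: (coshR (b * l)) => C C0.
by rewrite /coshR !mulNr; field; rewrite gt_eqF.
Qed.

Lemma gcosh1 l b : gcosh l b l = 1.
Proof. by rewrite /gcosh divff// gt_eqF// coshR_gt0. Qed.

Lemma gcoshN1 l b : gcosh l b (- l) = 1.
Proof. by rewrite /gcosh mulrN coshRN divff// gt_eqF// coshR_gt0. Qed.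

Lemma psiE l b : psi l b = fun t => 1 - gcosh l b t.
Proof. by []. Qed.

Lemma smooth1_psi l b : smooth1 (psi l b).
Proof. by rewrite psiE; apply: smooth1B; [exact: smooth1_cst|exact: smooth1_gcosh]. Qed.

Lemma derive1_psi l b : derive1 (psi l b) = fun t => -1 * derive1 (gcosh l b) t.
Proof.
rewrite psiE (derive1B (smooth1_cst 1) (smooth1_gcosh l b)).
by apply/funext => t; rewrite derive1_cst add0r mulN1r.
Qed.

(** Integration by parts: the integrands add up to the derivative of p' q. *)
Lemma ip_derive1 L p q : 0 < L -> smooth1 p -> smooth1 q ->
  ip mu `]-L, L[ (derive1 p) (derive1 q) + ip mu `]-L, L[ (derive1 (derive1 p)) q =
  derive1 p L * q L - derive1 p (- L) * q (- L).
Proof.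
move=> L0 sp sq; have sp' := smooth1_derive sp; have sp'' := smooth1_derive sp'.
have cp' := smooth1_continuous sp'; have cp'' := smooth1_continuous sp''.
have cq := smooth1_continuous sq; have cq' := smooth1_continuous (smooth1_derive sq).
have sM := smooth1M sp' sq.
rewrite -(FTC2_smooth1 (gtrN L0) sM) -Rintegral_oo_cc; last first.
  by apply: smooth1_continuous; exact: smooth1_derive.
rewrite (derive1M (smooth1_derivable sp') (smooth1_derivable sq)) RintegralD//.
  by apply: continuous_integrable_oo; exact: continuous_mulR.
by apply: continuous_integrable_oo; exact: continuous_mulR.
Qed.

(** The weak form of g'' = b^2 g; the boundary terms vanish with p. *)
Lemma gcosh_weak L b p : 0 < L -> smooth1 p -> p L = 0 -> p (- L) = 0 ->
  ip mu `]-L, L[ (derive1 (gcosh L b)) (derive1 p) + b ^+ 2 * ip mu `]-L, L[ (gcosh L b) p = 0.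
Proof.
move=> L0 sp pL pNL; have sg := smooth1_gcosh L b.
have := ip_derive1 L0 sg sp; rewrite pL pNL !mulr0 subrr => <-; congr (_ + _).
rewrite derive1_derive1_gcosh ipZl//; apply: sqint_I; exact: smooth1_continuous.
Qed.

(* The integrand is the derivative of [gcosh l b * derive1 (gcosh l b)]. *)
Lemma gcosh_energy l L b : 0 < L -> 0 < b ->
  ip mu `]-L, L[ (derive1 (gcosh l b)) (derive1 (gcosh l b)) +
  b ^+ 2 * ip mu `]-L, L[ (gcosh l b) (gcosh l b) <= 2 * b * expR (- (2 * b * (l - L))).
Proof.
move=> L0 b0; have sg := smooth1_gcosh l b.
have -> : b ^+ 2 * ip mu `]-L, L[ (gcosh l b) (gcosh l b) =
    ip mu `]-L, L[ (derive1 (derive1 (gcosh l b))) (gcosh l b).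
  by rewrite derive1_derive1_gcosh ipZl//; apply: sqint_I; exact: smooth1_continuous.
rewrite ip_derive1// derive1_gcosh /gcosh mulrN coshRN.
have -> : expR (- (2 * b * (l - L))) = expR (b * L) ^+ 2 / expR (b * l) ^+ 2.
  rewrite -!expRM_natl -expRN -expRD; congr expR; ring.
rewrite /sinhR /coshR opprK !expRN.
have : 1 <= expR (b * L) by rewrite -expR0 ler_expR mulr_ge0// ltW.
move: (expR_gt0 (b * L)) (expR_gt0 (b * l)); move: (expR (b * L)) (expR (b * l)) => x y x0 y0 x1.
have -> : 2 * b * (x ^+ 2 / y ^+ 2) = 2 * b / y ^+ 2 * x ^+ 2 by ring.
(* With x = e^(b L) and y = e^(b l), the boundary term is 2 b (x^2 - x^(-2)) / (y + 1/y)^2, at most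
   2 b x^2 / y^2. *)
have -> : b * ((x - x^-1) / 2) / ((y + y^-1) / 2) * ((x + x^-1) / 2 / ((y + y^-1) / 2)) -
    b * ((x^-1 - x) / 2) / ((y + y^-1) / 2) * ((x + x^-1) / 2 / ((y + y^-1) / 2)) =
    2 * b / (y + y^-1) ^+ 2 * (x ^+ 2 - x^-1 ^+ 2).
  by field; rewrite !gt_eqF// addr_gt0// mulr_gt0.
have yi : 0 < y^-1 by rewrite invr_gt0.
apply: ler_pM.
- by rewrite divr_ge0 ?sqr_ge0 ?mulr_ge0// ltW.
- have xi : x^-1 <= 1 by rewrite invf_le1.
  by rewrite subr_ge0 ler_pXn2r ?nnegrE ?invr_ge0 ?(ltW x0)// (le_trans xi x1).
- rewrite ler_pM2l ?mulr_gt0// lef_pV2 ?posrE ?exprn_gt0 ?addr_gt0//.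
  by rewrite ler_pXn2r ?nnegrE ?addr_ge0 ?ltW// ltrDl.
- by rewrite gerBl sqr_ge0.
Qed.

Lemma sinhR_ge0 t : 0 <= t -> 0 <= sinhR t.
Proof. by move=> t0; rewrite divr_ge0// subr_ge0 ler_expR (@le_trans _ _ 0)// oppr_le0. Qed.

Lemma sinhRN t : sinhR (- t) = - sinhR t.
Proof. by rewrite /sinhR opprK -mulNr opprB. Qed.

(** Both derivatives are nonnegative multiples of a hyperbolic sine, which is odd, so their product
    is even in t and the case t >= 0 suffices. *)
Lemma derive1_gcoshM_ge0 l b c t : 0 <= b -> 0 <= c ->
  0 <= derive1 (gcosh l b) t * derive1 (gcosh l c) t.
Proof.
move=> b0 c0; rewrite !derive1_gcosh.
have -> : b * sinhR (b * t) / coshR (b * l) * (c * sinhR (c * t) / coshR (c * l)) =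
    b / coshR (b * l) * (c / coshR (c * l)) * (sinhR (b * t) * sinhR (c * t)) by ring.
apply: mulr_ge0; first by apply: mulr_ge0; apply: divr_ge0 => //; exact: ltW (coshR_gt0 _).
wlog t0 : t / 0 <= t.
  move=> H; have [/H//|/ltW t0] := leP 0 t.
  by have := H (- t); rewrite !mulrN !sinhRN mulrNN oppr_ge0; apply.
by apply: mulr_ge0; apply: sinhR_ge0; exact: mulr_ge0.
Qed.

Lemma gcosh_gt0 l b t : 0 < gcosh l b t.
Proof. by rewrite divr_gt0 ?coshR_gt0. Qed.

(** Since c <= b, the factor 2 b is at most (2 / c) b^2. The square is the right weight: against
    |v_k|^2, the m_k^2 sum to the energy of u_oo. *)
Lemma gcosh_energy_le l L b c : 0 < L -> L <= l -> 0 < c -> c <= b ->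
  ip mu `]-L, L[ (derive1 (gcosh l b)) (derive1 (gcosh l b)) +
  b ^+ 2 * ip mu `]-L, L[ (gcosh l b) (gcosh l b) <=
  2 / c * expR (- (2 * c * (l - L))) * b ^+ 2.
Proof.
move=> L0 Ll c0 cb; have b0 := lt_le_trans c0 cb.
apply: (le_trans (gcosh_energy l L0 b0)).
have -> : 2 / c * expR (- (2 * c * (l - L))) * b ^+ 2 =
    (2 * b) * (b / c) * expR (- (2 * c * (l - L))) by ring.
apply: ler_pM; rewrite ?expR_ge0//.
- by apply: mulr_ge0 => //; exact: ltW.
- by rewrite ler_peMr ?mulr_ge0 ?(ltW b0)// ler_pdivlMr// mul1r.
- by rewrite ler_expR lerN2 ler_wpM2r ?subr_ge0// ler_pM2l.
Qed.

End hyperbolic.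

(** * The error estimate *)

Section spectral_decomposition.
Context {R : realType} (n : nat) (omega : set 'rV[R]_n.+1).
Hypothesis oomega : open omega.
Notation nu := (@lebesgue_rV R n.+1).
Notation b := (ip nu omega).
Notation a := (dform omega).
Implicit Types (u v w : 'rV[R]_n.+1 -> R).
Let mo : measurable omega := open_measurable_rV oomega.

Lemma ae_zero_ip0 v w : sobolevH1 omega v -> sobolevH1 omega w -> ae_zero omega v -> b v w = 0.
Proof.
move=> Hv Hw v0; rewrite -(ip0l nu mo w); apply: (ae_eq_ip mo (H1_L2 Hv).1 _ (H1_L2 Hw).1 v0).
exact: measurable_cst.
Qed.

(** If u vanished, f would be orthogonal to all test functions, hence 0 by the fundamental lemma. *)
Lemma weak_solution_neq0 f u : L2 omega f -> ~ ae_zero omega f -> weak_solution omega f u ->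
  ~ ae_zero omega u.
Proof.
move=> Lf f0 [/H10_H1 Hu su] u0; apply: f0; apply: fundamental_lemma => // phi tphi.
have Hp := test_H10 oomega tphi; rewrite -(su _ Hp).
exact: (H1_ip0_dform0 oomega Hu (H10_H1 Hp) (ae_zero_ip0 Hu Hu u0)).
Qed.

Lemma spectral_decomp u N (h : nat -> 'rV[R]_n.+1 -> R) : sobolevH10 omega u ->
  ~ ae_zero omega u -> (forall k, sobolevH10 omega (h k)) ->
  exists r, exists (v : 'I_r -> 'rV[R]_n.+1 -> R) (mu : 'I_r -> R),
    [/\ forall i, sobolevH10 omega (v i) /\ lambda1 omega <= mu i,
        forall i j, i != j -> b (v i) (v j) = 0,
        forall i j, a (v i) (v j) = mu i ^+ 2 * b (v i) (v j),
        forall i k, (k < N)%N -> a (v i) (h k) = mu i ^+ 2 * b (v i) (h k) &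
        forall w, sobolevH10 omega w ->
          b u w = \sum_i b (v i) w /\ a u w = \sum_i a (v i) w].
Proof.
move=> Hu u0 Hh; pose h' k := if k is k'.+1 then h k' else u.
have Hh' k : sobolevH10 omega (h' k) by case: k => [|k]; [exact: Hu|exact: Hh].
have [r [v [d [Hv orth evv evh sums]]]] := @eigen_decomp R _ (sobolevH10 omega) b a
  (H10D oomega) (fun c u => @H10Z _ _ _ oomega c u) (H10_0 oomega) (ipC nu omega)
  (fun u v w Hu Hv Hw => ipDl mo (H1_L2 (H10_H1 Hu)) (H1_L2 (H10_H1 Hv)) (H1_L2 (H10_H1 Hw)))
  (fun c u w Hu Hw => ipZl mo c (H1_L2 (H10_H1 Hu)) (H1_L2 (H10_H1 Hw)))
  (ip_ge0 nu omega) (dformC omega)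
  (fun u v w Hu Hv Hw => dformDl oomega (H10_H1 Hu) (H10_H1 Hv) (H10_H1 Hw))
  (fun c u w Hu Hw => dformZl oomega c (H10_H1 Hu) (H10_H1 Hw))
  (fun u w Hu Hw => H1_ip0_dform0 oomega (H10_H1 Hu) (H10_H1 Hw))
  N.+1 h' (ltn0Sn N) Hh'.
(* If v_i is null, its eigenvalue is arbitrary because both forms vanish on it; the quotient of u is
   inserted to keep the lower bound lambda_1. Otherwise a(v_i, v_i) = d_i b(v_i, v_i) identifies d_i
   with the square of the quotient of v_i. *)
pose mu i := rayleigh omega (if b (v i) (v i) == 0 then u else v i).
have muE i w : sobolevH10 omega w -> a (v i) w = d i * b (v i) w ->
    a (v i) w = mu i ^+ 2 * b (v i) w.
  move=> Hw e; have Hvi := H10_H1 (Hv i); rewrite /mu; case: ifP => [/eqP v0|/eqP/eqP v0].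
    rewrite (H1_ip0_dform0 oomega Hvi (H10_H1 Hw) v0) ae_zero_ip0 ?mulr0//.
      exact: H10_H1.
    by apply: (ip_eq0_ae mo (H1_L2 Hvi)).
  by rewrite e; congr (_ * _); apply: (mulIf v0); rewrite rayleigh_sq// -evv.
exists r, v, mu; split.
- move=> i; split; first exact: Hv.
  rewrite /mu; case: ifP => [_|/eqP v0].
    exact: (lambda1_le_rayleigh Hu u0).
  apply: lambda1_le_rayleigh; first exact: Hv.
  by move=> vi0; apply: v0; apply: ae_zero_ip0 vi0; exact: H10_H1 (Hv i).
- exact: orth.
- by move=> i j; exact: (muE i (v j) (Hv j) (evv i j)).
- by move=> i k kN; exact: (muE i (h k) (Hh k) (evh i k.+1 kN)).
- exact: sums.
Qed.

End spectral_decomposition.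

Lemma sub_cylinder (R : realType) n (omega : set 'rV[R]_n) (L l : R) : L <= l ->
  cylinder L omega `<=` cylinder l omega.
Proof.
move=> Ll x [/andP[h1 h2] h3]; split=> //; apply/andP; split; last exact: lt_le_trans Ll.
by apply: le_lt_trans h1; rewrite lerN2.
Qed.

Section error_estimate.
Context {R : realType} (n : nat) (omega : set 'rV[R]_n.+1) (f uoo : 'rV[R]_n.+1 -> R).
Hypotheses (oomega : open omega) (bomega : bounded_set omega).
Hypotheses (Lf : L2 omega f) (f0 : ~ ae_zero omega f) (suoo : weak_solution omega f uoo).
Variables (l : R) (l0 : 0 < l) (ul : 'rV[R]_n.+2 -> R).
Notation Omega := (cylinder l omega).
Hypothesis sul : weak_solution Omega (tens (fun=> 1) f) ul.
Notation I := (`]-l, l[%classic : set R).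
Notation mu := (@lebesgue_measure R).
Notation nu := (@lebesgue_rV R n.+1).
Notation b := (ip nu omega).
Notation a := (dform omega).
Notation lam := (rayleigh omega uoo).
Let mo : measurable omega := open_measurable_rV oomega.
Let oO : open Omega := open_cylinder oomega.
Let mO : measurable Omega := open_measurable_rV oO.
Let Huoo : sobolevH10 omega uoo := suoo.1.
Let uoo0 : ~ ae_zero omega uoo := weak_solution_neq0 oomega Lf f0 suoo.
Let g := gcosh l lam.

Definition werr x : R := ul x - tens (psi l lam) uoo x.

Lemma werr_H10 : sobolevH10 Omega werr.
Proof.
apply: (H10B oO sul.1); apply: (tens_H10 oomega l0 (smooth1_psi l lam)) => //.
  by rewrite psiE gcosh1 subrr.
by rewrite psiE gcoshN1 subrr.
Qed.

(** Against p (x) h the solution u_l acts as (1, p) (f, h), which is (1, p) a(u_oo, h) by the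
    equation of u_oo. Subtracting psi = 1 - g cancels this term and leaves g alone. *)
Lemma dform_werr_tens p h : smooth1 p -> p l = 0 -> p (- l) = 0 -> sobolevH10 omega h ->
  dform Omega werr (tens p h) =
  ip mu I (derive1 g) (derive1 p) * b uoo h + ip mu I g p * a uoo h.
Proof.
move=> sp pl pNl Hh; have Hp := tens_H10 oomega l0 sp pl pNl Hh.
have sps := smooth1_psi l lam; have sg : smooth1 g := smooth1_gcosh l lam.
have Ht := tens_H1 oomega l0 sps (H10_H1 Huoo).
rewrite (dformBl oO (H10_H1 sul.1) Ht (H10_H1 Hp)).
rewrite (dform_tens oomega l0 sps sp (H10_H1 Huoo) (H10_H1 Hh)).
have -> : dform Omega ul (tens p h) = ip mu I (fun=> 1) p * a uoo h.
  rewrite /dform (sul.2 _ Hp) (suoo.2 _ Hh).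
  have c1 := smooth1_continuous (smooth1_cst (1 : R)).
  apply: (ip_tens l oomega c1 (smooth1_continuous sp) Lf).
  exact: H1_L2 (H10_H1 Hh).
have s1 := sqint_I l (smooth1_continuous (smooth1_cst (1 : R))).
have s2 := sqint_I l (smooth1_continuous sg); have s3 := sqint_I l (smooth1_continuous sp).
have s2' := sqint_I l (smooth1_continuous (smooth1_derive sg)).
have s3' := sqint_I l (smooth1_continuous (smooth1_derive sp)).
have mI : measurable (I : set (measurableTypeR R)) by exact: measurable_itv.
rewrite derive1_psi (ipZl mI (-1) s2' s3').
have -> : ip mu I (psi l lam) p = ip mu I (fun=> 1) p - ip mu I g p by exact: (ipBl mI).
rewrite -/g; move: (ip mu I _ _) (ip mu I _ _) (ip mu I _ _) (a uoo h) (b uoo h).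
by move=> ? ? ? ? ?; ring.
Qed.

Section approximant.
Variables (r : nat) (v : 'I_r -> 'rV[R]_n.+1 -> R) (m : 'I_r -> R).
Hypothesis Hv : forall i, sobolevH10 omega (v i) /\ lambda1 omega <= m i.
Hypothesis vorth : forall i j, i != j -> b (v i) (v j) = 0.
Hypothesis veig : forall i j, a (v i) (v j) = m i ^+ 2 * b (v i) (v j).
Hypothesis vsum : forall w, sobolevH10 omega w ->
  b uoo w = \sum_i b (v i) w /\ a uoo w = \sum_i a (v i) w.
Let gd i t : R := g t - gcosh l (m i) t.

Definition wapp x : R := \sum_(i < r) tens (gd i) (v i) x.

Let sg b : smooth1 (gcosh l b) := smooth1_gcosh l b.
Let sgd i : smooth1 (gd i) := smooth1B (sg _) (sg _).
Let Hv1 i : sobolevH1 omega (v i) := H10_H1 (Hv i).1.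

Lemma wapp_H1 L : 0 < L -> sobolevH1 (cylinder L omega) wapp.
Proof.
by move=> L0; apply: (H1_sum (open_cylinder oomega)) => i; exact: (tens_H1 oomega L0).
Qed.

(** Once u_oo is replaced by the sum of the v_i, the terms with g cancel. Mode i leaves the factor
    (g_m', p') + m^2 (g_m, p) with m = m_i, which is 0 by [gcosh_weak]. *)
Lemma dform_werr_wapp p h : smooth1 p -> p l = 0 -> p (- l) = 0 -> sobolevH10 omega h ->
  (forall i, a (v i) h = m i ^+ 2 * b (v i) h) ->
  dform Omega (fun x => werr x - wapp x) (tens p h) = 0.
Proof.
move=> sp pl pNl Hh eh; have Hp := tens_H1 oomega l0 sp (H10_H1 Hh).
rewrite (dformBl oO (H10_H1 werr_H10) (wapp_H1 l0) Hp) dform_werr_tens//.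
rewrite (dform_suml oO (index_enum _) (fun i => tens_H1 oomega l0 (sgd i) (Hv1 i)) Hp).
have [-> ->] := vsum Hh; rewrite !mulr_sumr -big_split/= -sumrB big1// => i _.
rewrite (dform_tens oomega l0 (sgd i) sp (Hv1 i) (H10_H1 Hh)) eh.
have mI : measurable (I : set (measurableTypeR R)) by exact: measurable_itv.
have I2 q (sq : smooth1 q) := sqint_I l (smooth1_continuous sq).
have I2' q (sq : smooth1 q) := sqint_I l (smooth1_continuous (smooth1_derive sq)).
have -> : ip mu I (gd i) p = ip mu I g p - ip mu I (gcosh l (m i)) p.
  exact: (ipBl mI (I2 _ (sg _)) (I2 _ (sg _)) (I2 _ sp)).
have -> : ip mu I (derive1 (gd i)) (derive1 p) =
    ip mu I (derive1 g) (derive1 p) - ip mu I (derive1 (gcosh l (m i))) (derive1 p).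
  rewrite (derive1B (sg _) (sg _)).
  exact: (ipBl mI (I2' _ (sg _)) (I2' _ (sg _)) (I2' _ sp)).
have := gcosh_weak (m i) l0 sp pl pNl.
move: (ip mu I (derive1 (gcosh _ _)) _) (ip mu I (gcosh _ _) _) => x y e.
move: (ip mu I _ _) (ip mu I _ _) (b (v i) h) => z s t.
have -> : x = - (m i ^+ 2 * y) by apply/eqP; rewrite -addr_eq0 e.
ring.
Qed.

(** Each profile g - g_m vanishes at both ends, where g and g_m equal 1, so the summands of [wapp]
    are themselves admissible. *)
Lemma dform_werr_sub_wapp_wapp : dform Omega (fun x => werr x - wapp x) wapp = 0.
Proof.
have He := H1B oO (H10_H1 werr_H10) (wapp_H1 l0).
rewrite dformC (dform_suml oO (index_enum _) (fun i => tens_H1 oomega l0 (sgd i) (Hv1 i)) He).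
rewrite big1// => i _; rewrite dformC; apply: (dform_werr_wapp (sgd i) _ _ (Hv i).1).
- by rewrite /gd /g !gcosh1 subrr.
- by rewrite /gd /g !gcoshN1 subrr.
- by move=> j; exact: veig.
Qed.

(** Parseval: the expansion of u_oo is inserted in both arguments, and the mixed terms vanish. *)
Lemma vsum_diag : b uoo uoo = \sum_i b (v i) (v i) /\
  a uoo uoo = \sum_i m i ^+ 2 * b (v i) (v i).
Proof.
have [-> ->] := vsum Huoo; split; apply: eq_bigr => i _.
  rewrite ipC (vsum (Hv i).1).1 (bigD1 i)//= big1 ?addr0// => j; exact: vorth.
rewrite dformC (vsum (Hv i).1).2 (bigD1 i)//= big1 ?addr0 => [|j ji]; first exact: veig.
by rewrite veig vorth// mulr0.
Qed.

(** Orthogonality of the v_i reduces the energy to a sum over modes, and [ipB_le] separates g from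
    g_m in each. The g_m parts sum to at most K a(u_oo, u_oo), with K = (2 / lambda_1) e^(-2
    lambda_1 (l - L)). *)
Lemma wapp_energy L : 0 < L -> L <= l ->
  dform (cylinder L omega) wapp wapp <=
  4 / lambda1 omega * expR (- (2 * lambda1 omega * (l - L))) * a uoo uoo.
Proof.
move=> L0 Ll; have lam1 := lambda1_gt0 oomega bomega Huoo uoo0.
have lamle := lambda1_le_rayleigh Huoo uoo0.
have oC : open (cylinder L omega) := open_cylinder oomega.
pose J : set (measurableTypeR R) := `]-L, L[%classic.
have mJ : measurable J by exact: measurable_itv.
have Ht i := tens_H1 oomega L0 (sgd i) (Hv1 i).
have -> : dform (cylinder L omega) wapp wapp =
    \sum_i (ip mu J (derive1 (gd i)) (derive1 (gd i)) + m i ^+ 2 * ip mu J (gd i) (gd i)) * b (v i) (v i).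
  rewrite (dform_suml oC (index_enum _) Ht (wapp_H1 L0)); apply: eq_bigr => i _.
  rewrite dformC (dform_suml oC (index_enum _) Ht (Ht i)) (bigD1 i)//= big1 => [|j ji].
    rewrite addr0 (dform_tens oomega L0 (sgd i) (sgd i) (Hv1 i) (Hv1 i)) veig.
    by move: (ip mu _ _ _) (ip mu _ _ _) (b _ _) => x y z; ring.
  by rewrite (dform_tens oomega L0 (sgd j) (sgd i) (Hv1 j) (Hv1 i)) veig vorth// !mulr0 addr0.
have J2 q (sq : smooth1 q) := sqint_I L (smooth1_continuous sq).
have J2' q (sq : smooth1 q) := sqint_I L (smooth1_continuous (smooth1_derive sq)).
pose E c := ip mu J (derive1 (gcosh l c)) (derive1 (gcosh l c)) + c ^+ 2 * ip mu J (gcosh l c) (gcosh l c).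
pose K := 2 / lambda1 omega * expR (- (2 * lambda1 omega * (l - L))).
have EK c : lambda1 omega <= c -> E c <= K * c ^+ 2 by move=> lc; exact: gcosh_energy_le.
apply: (@le_trans _ _ (\sum_i (ip mu J (derive1 g) (derive1 g) + m i ^+ 2 * ip mu J g g + K * m i ^+ 2) * b (v i) (v i))).
  apply: ler_sum => i _; apply: ler_wpM2r; first exact: ip_ge0.
  have h1 : ip mu J (gd i) (gd i) <= ip mu J g g + ip mu J (gcosh l (m i)) (gcosh l (m i)).
    apply: (ipB_le mJ (J2 _ (sg _)) (J2 _ (sg _))) => t _.
    by rewrite mulr_ge0// ltW// gcosh_gt0.
  have h2 : ip mu J (derive1 (gd i)) (derive1 (gd i)) <= ip mu J (derive1 g) (derive1 g) +
      ip mu J (derive1 (gcosh l (m i))) (derive1 (gcosh l (m i))).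
    rewrite (derive1B (sg _) (sg _)).
    apply: (ipB_le mJ (J2' _ (sg _)) (J2' _ (sg _))) => t _.
    apply: derive1_gcoshM_ge0; first exact: rayleigh_ge0.
    by apply: le_trans (Hv i).2; exact: ltW.
  have := EK _ (Hv i).2; rewrite /E.
  have h3 := ler_wpM2l (sqr_ge0 (m i)) h1; rewrite mulrDr in h3.
  move=> h4; apply: (le_trans (lerD h2 h3)); rewrite addrACA lerD2l; exact: h4.
have [Sb Sa] := vsum_diag.
have -> : \sum_i (ip mu J (derive1 g) (derive1 g) + m i ^+ 2 * ip mu J g g + K * m i ^+ 2) * b (v i) (v i) =
    ip mu J (derive1 g) (derive1 g) * b uoo uoo + (ip mu J g g + K) * a uoo uoo.
  rewrite Sb Sa !mulr_sumr -big_split/=; apply: eq_bigr => i _.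
  by move: (ip mu J _ _) (ip mu J _ _) (b _ _) => x y z; ring.
(* The g parts sum to (g', g') b(u_oo, u_oo) + (g, g) a(u_oo, u_oo). By a(u_oo, u_oo) = lambda_oo^2
   b(u_oo, u_oo) this is the one-dimensional energy of g times b(u_oo, u_oo), again at most K
   a(u_oo, u_oo). *)
have e := rayleigh_sq oomega (H10_H1 Huoo).
have := ler_wpM2r (ip_ge0 nu omega uoo) (EK _ lamle); rewrite /E -/g.
have -> : 4 / lambda1 omega * expR (- (2 * lambda1 omega * (l - L))) = 2 * K.
  by rewrite /K; ring.
rewrite -e; clear EK; move: (ip mu J _ _) (ip mu J _ _) (b uoo uoo) (lam ^+ 2) K => y x z s k h.
have -> : x * z + (y + k) * (s * z) = (x + s * y) * z + k * s * z by ring.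
have -> : 2 * k * (s * z) = k * s * z + k * s * z by ring.
by rewrite lerD2r.
Qed.

End approximant.

Lemma dform_werr_le L : 0 < L -> L <= l ->
  dform (cylinder L omega) werr werr <=
  4 / lambda1 omega * expR (- (2 * lambda1 omega * (l - L))) * a uoo uoo.
Proof.
move=> L0 Ll; have lam1 := lambda1_gt0 oomega bomega Huoo uoo0.
have oC : open (cylinder L omega) := open_cylinder oomega.
have CO : cylinder L omega `<=` Omega := sub_cylinder Ll.
have Hw := H10_H1 werr_H10.
apply: (dform_near_le oC (H1_sub oC oO CO Hw)).
  by rewrite mulr_ge0 ?dform_ge0// mulr_ge0 ?expR_ge0// divr_ge0// ltW.
move=> e e0; have e4 : 0 < e / 4 by rewrite divr_gt0.
have [_ /(_ _ e4)[phi tphi hphi]] := (H10P oO werr).1 werr_H10.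
have [N [p [h [sp pend th hPhi]]]] := tens_dense oomega bomega l0 tphi e4.
(* The finite family of factors is extended by 0 to all indices, as the diagonalisation takes a
   sequence. *)
pose h' k := if insub k is Some i then h i else fun=> 0.
have Hh' k : sobolevH10 omega (h' k).
  rewrite /h'; case: insub => [i|]; first exact: (test_H10 oomega (th i)).
  exact: (H10_0 oomega).
have [r [v [m [Hv vorth veig vh vsum]]]] := spectral_decomp oomega N Huoo uoo0 Hh'.
exists (wapp v m); split.
- exact: wapp_H1.
- exact: wapp_energy.
have HwO := wapp_H1 Hv l0; have He := H1B oO Hw HwO.
have Hp := test_sobolevH1 mO tphi.
pose Phi x := \sum_(i < N) tens (p i) (h i) x.
have Hti i := tens_H1 oomega l0 (sp i) (test_sobolevH1 mo (th i)).
have HPhi : sobolevH1 Omega Phi by exact: (H1_sum oO (index_enum _) Hti).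
(* Orthogonality holds on the whole cylinder only, so the error is enlarged to it before being
   compared with the trial function [Phi]. *)
apply: (le_trans (dform_sub_le oC oO CO He)).
apply: (le_trans (dform_galerkin oO Hw HwO HPhi (dform_werr_sub_wapp_wapp Hv veig vsum) _)).
  rewrite dformC (dform_suml oO (index_enum _) Hti He) big1// => i _.
  rewrite dformC; apply: (dform_werr_wapp Hv vsum (sp i) (pend i).1 (pend i).2).
    exact: (test_H10 oomega (th i)).
  move=> j; have := vh j i (ltn_ord i); rewrite /h' insubT//.
  by move=> ?; rewrite /= (_ : Sub _ _ = i)//; exact: val_inj.
have := dform_triangle2 oO (H1B oO Hw Hp) (H1B oO Hp HPhi).
have -> : (fun x => werr x - phi x + (phi x - Phi x)) = fun x => werr x - Phi x.
  by apply/funext => x; rewrite addrA subrK.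
rewrite (dform_subC oO Hw Hp) (dform_subC oO Hp HPhi) => h1; apply: (le_trans h1); apply: ltW.
(* Both distances, from [werr] to phi and from phi to [Phi], are below e / 4, and the triangle
   inequality doubles each. *)
apply: quarter_sum hPhi; apply: le_lt_trans hphi.
by rewrite /H1sq lerDr ip_ge0.
Qed.

End error_estimate.

(** * Exponential decay of the bound *)

Lemma mulr_expRN_le (R : realType) (c t : R) : 0 < c -> t * expR (- (c * t)) <= c^-1.
Proof.
move=> c0; rewrite expRN ler_pdivrMr ?expR_gt0// ler_pdivlMl//.
by apply: le_trans (expR_ge1Dx _); rewrite lerDr.
Qed.

(** Writing e^(-2 lambda_1 l) as e^(-2 lambda_1 (l - delta)) e^(-2 lambda_1 delta), the linear
    factor l - delta is absorbed at the cost of 1 / (2 lambda_1). The constant is 4 (1 + 6/2) =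
    16. *)
Lemma error_bound_le (R : realType) n (omega : set 'rV[R]_n) u (l delta : R) :
  0 < lambda1 omega ->
  error_bound omega u l delta <=
  (4 * L2norm omega u ^+ 2 + 16 / lambda1 omega * L2norm_field omega (wgrad omega u) ^+ 2) *
  expR (- (2 * lambda1 omega * delta)).
Proof.
move=> lam0; rewrite /error_bound /constC1 /constC2.
move: (lambda1 omega) lam0 => lam lam0.
have h : (l - delta) * expR (- (2 * lam * l)) <= (2 * lam)^-1 * expR (- (2 * lam * delta)).
  have -> : - (2 * lam * l) = - (2 * lam * (l - delta)) + - (2 * lam * delta) by ring.
  rewrite expRD mulrA ler_wpM2r ?expR_ge0// mulr_expRN_le// mulr_gt0//.
move: (L2norm omega u ^+ 2) (sqr_ge0 (L2norm_field omega (wgrad omega u))) => U.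
move: (L2norm_field omega _ ^+ 2) => V V0.
have -> : (4 * U + 16 / lam * V) * expR (- (2 * lam * delta)) =
    4 * expR (- (2 * lam * delta)) * U +
    4 * (lam^-1 * expR (- (2 * lam * delta)) + 6 * ((2 * lam)^-1 * expR (- (2 * lam * delta)))) * V.
  by field; rewrite gt_eqF.
by rewrite lerD2l ler_wpM2r// ler_pM2l// lerD2l -mulrA ler_pM2l.
Qed.

(* The ambient dimension is n = m.+2, so n >= 2 and omega lies in R^(n-1).  In the last
   part beta is the lower bound of delta as l -> +oo: the right-hand side decays
   exponentially in beta, and tends to 0 as soon as beta does to +oo. *)
Theorem lemma2 (R : realType) (m : nat)
    (omega : set 'rV[R]_m.+1) (f uoo : 'rV[R]_m.+1 -> R)
    (omega_open : open omega) (omega_bounded : bounded_set omega)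
    (omega_connected : connected omega)
    (omega_lipschitz : lipschitz_boundary omega)
    (f_L2 : L2 omega f) (f_neq0 : ~ ae_zero omega f)
    (uoo_sol : weak_solution omega f uoo) :
  let lambda_oo := rayleigh omega uoo in
  (forall (l : R) (ul : 'rV[R]_m.+2 -> R), 0 < l ->
     weak_solution (cylinder l omega) (tens (fun=> 1) f) ul ->
     let w := fun x => ul x - tens (psi l lambda_oo) uoo x in
     sobolevH1 (cylinder l omega) w /\
     forall delta : R, 0 <= delta < l ->
       L2norm_field (cylinder (l - delta) omega) (wgrad (cylinder l omega) w) ^+ 2
         <= error_bound omega uoo l delta)
  /\
  (0 < lambda1 omega /\
   exists K : R, 0 < K /\
   forall delta beta : R -> R,
     (forall l, 0 < l -> 0 <= delta l < l) ->
     (\forall l \near +oo, beta l <= delta l) ->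
     (\forall l \near +oo,
        error_bound omega uoo l (delta l)
          <= K * expR (- (2 * lambda1 omega * beta l))) /\
     (beta l @[l --> +oo] --> +oo ->
        error_bound omega uoo l (delta l) @[l --> +oo] --> (0 : R))).
Proof.
move=> lambda_oo; have Huoo := uoo_sol.1.
have uoo_neq0 := weak_solution_neq0 omega_open f_L2 f_neq0 uoo_sol.
have lam0 := lambda1_gt0 omega_open omega_bounded Huoo uoo_neq0.
(* The energy estimate gives the summand of [error_bound] with 1 / lambda_1; the other summands are
   nonnegative for 0 <= d < l. *)
have eb_ge l d : 0 <= d < l -> 4 / lambda1 omega * expR (- (2 * lambda1 omega * d)) *
    dform omega uoo uoo <= error_bound omega uoo l d.
  move=> /andP[d0 dl].
  rewrite /error_bound /constC1 /constC2 L2norm_wgrad_sq -[leLHS]add0r.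
  apply: lerD; first by rewrite mulr_ge0 ?sqr_ge0// mulr_ge0// expR_ge0.
  apply: ler_wpM2r; first exact: dform_ge0.
  rewrite -mulrA ler_pM2l// lerDl mulr_ge0 ?expR_ge0// mulr_ge0// subr_ge0 ltW//.
split=> [l ul l0 sul w|].
  have Hw : sobolevH1 (cylinder l omega) w.
    exact: H10_H1 (werr_H10 omega_open uoo_sol l0 sul).
  split=> // d d0l; have /andP[d0 dl] := d0l.
  have L0 : 0 < l - d by rewrite subr_gt0.
  have Ll : l - d <= l by rewrite gerBl.
  rewrite (L2norm_wgrad_sub (open_cylinder omega_open) (open_cylinder omega_open)
    (sub_cylinder Ll) Hw).
  apply: le_trans (eb_ge _ _ d0l).
  have := dform_werr_le omega_open omega_bounded f_L2 f_neq0 uoo_sol l0 sul L0 Ll.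
  by rewrite subKr.
split=> //.
pose K : R := 4 * L2norm omega uoo ^+ 2 +
  16 / lambda1 omega * L2norm_field omega (wgrad omega uoo) ^+ 2.
have K0 : 0 <= K.
  by apply: addr_ge0; apply: mulr_ge0; rewrite ?sqr_ge0 ?divr_ge0 ?(ltW lam0).
(* Adding 1 turns the nonnegative constant into a positive one. *)
exists (K + 1); split; first by rewrite ltr_wpDl.
move=> delta beta hd hb.
have bnd : \forall l \near +oo, error_bound omega uoo l (delta l) <=
    (K + 1) * expR (- (2 * lambda1 omega * beta l)).
  apply: filterS hb => l bd; apply: (le_trans (error_bound_le uoo l (delta l) lam0)).
  rewrite -/K; apply: ler_pM; rewrite ?expR_ge0// ?lerDl//.
  by rewrite ler_expR lerN2 ler_pM2l// mulr_gt0.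
split=> // boo.
(* The lower bound 0 follows from [eb_ge], which applies once l > 0. *)
apply: (@squeeze_cvgr _ _ _ _ (fun=> 0) (fun l => (K + 1) * expR (- (2 * lambda1 omega * beta l)))).
- apply: filterS2 bnd (nbhs_pinfty_gt (num_real 0)) => l -> l0; rewrite andbT.
  have := hd _ l0; move=> /eb_ge; apply: le_trans.
  by rewrite mulr_ge0 ?dform_ge0// mulr_ge0 ?expR_ge0// divr_ge0// ltW.
- exact: cvg_cst.
rewrite -[X in _ --> X](mulr0 (K + 1)); apply: cvgMr.
apply: (cvg_comp _ _ _ (@cvgr_expR R)).
by apply: gt0_cvgMry boo; rewrite mulr_gt0.
Qed.
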